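(* Let $(R,\mathfrak m)$ be a commutative Noetherian local ring of dimension one whose $\mathfrak m$-adic completion is reduced, so that $\operatorname{CM}(R)=\operatorname{CM}_0(R)$ holds. Let $\mathcal X$ be a subcategory of $\operatorname{Mod} R$ containing $\Omega^2\operatorname{CM}(R)$ and let $\mathcal Y$ be a subcategory of $\operatorname{Mod} R$ containing $\operatorname{CM}(R)$. Then $$\mathbb E^0(\operatorname{CM}(R),\mathcal X)=\mathbb E^1(\operatorname{CM}(R),\mathcal X)=\mathbb T_0(\operatorname{CM}(R),\mathcal Y)=\mathcal C(R).$$ In particular, $\mathbb E^0(\operatorname{CM}(R))=\mathbb E^1(\operatorname{CM}(R))=\mathbb T_0(\operatorname{CM}(R))=\mathcal C(R)$.
   Context: $\operatorname{Mod} R$ is the category of all $R$-modules and $\operatorname{mod} R$ the category of finitely generated $R$-modules. All subcategories of $\operatorname{Mod} R$ are full, closed under isomorphism, and contain the zero module, so a subcategory is determined by its collection of objects. A finitely generated $R$-module $M$ is maximal Cohen--Macaulay if $\operatorname{depth}_{R_{\mathfrak p}}M_{\mathfrak p}=\dim R_{\mathfrak p}$ for all $\mathfrak p\in\operatorname{Supp}_R M$ (so the zero module is included). $\operatorname{CM}(R)$ is the subcategory of $\operatorname{mod} R$ of maximal Cohen--Macaulay modules, and $\operatorname{CM}_0(R)$ is the subcategory of those $M\in\operatorname{CM}(R)$ such that $M_{\mathfrak p}$ is a free $R_{\mathfrak p}$-module for every non-maximal prime ideal $\mathfrak p$. For a subcategory $\mathcal Z$ of $\operatorname{mod} R$ and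 $n\ge1$, $\Omega^n\mathcal Z$ is the collection of all modules $M$ for which there is an exact sequence $0\to M\to P_{n-1}\to\cdots\to P_0\to N\to 0$ with $N\in\mathcal Z$ and $P_0,\dots,P_{n-1}$ finitely generated projective $R$-modules. For subcategories $\mathcal A,\mathcal B$ of $\operatorname{Mod} R$ and an integer $n\ge0$, $$\mathbb T_n(\mathcal A,\mathcal B)=\bigcap_{i>n}\bigcap_{A\in\mathcal A}\bigcap_{B\in\mathcal B}\operatorname{ann}_R\operatorname{Tor}^R_i(A,B),\qquad \mathbb E^n(\mathcal A,\mathcal B)=\bigcap_{i>n}\bigcap_{A\in\mathcal A}\bigcap_{B\in\mathcal B}\operatorname{ann}_R\operatorname{Ext}_R^i(A,B),$$ and $\mathbb T_n(\mathcal A)=\mathbb T_n(\mathcal A,\mathcal A)$, $\mathbb E^n(\mathcal A)=\mathbb E^n(\mathcal A,\mathcal A)$. Here $\operatorname{ann}_R X=\{r\in R: rX=0\}$. $Q(R)$ is the total ring of fractions of $R$ (localization at all non-zero-divisors), $\overline R$ is the integral closure of $R$ in $Q(R)$, and the conductor is $\mathcal C(R)=(R:\overline R)=\{x\in Q(R): x\overline R\subseteq R\}$, an ideal of $R$. *)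

(* Defs.v *)
From HB Require Import structures.
From mathcomp Require Import all_boot all_algebra.
From mathcomp Require Import boolp classical_sets functions.
From mathcomp Require Import ring.
From mathcomp.multinomials Require Import freeg.

Set Implicit Arguments.
Unset Strict Implicit.
Unset Printing Implicit Defensive.
Import GRing.Theory.
Local Open Scope ring_scope.
Local Open Scope quotient_scope.
Local Open Scope classical_set_scope.

Record submod (R : comNzRingType) (V : lmodType R) := Submod {
  submod_pred :> {pred V};
  submodP : submod_closed submod_pred }.

HB.instance Definition _ (R : comNzRingType) (V : lmodType R) (N : submod V) :=
  GRing.isSubmodClosed.Build R V (submod_pred N) (submodP N).

Section Submodules.
Variables (R : comNzRingType) (V : lmodType R).

Record subm (N : submod V) := Subm {
  subm_val :> V;
  subm_valP : subm_val \in submod_pred N }.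

HB.instance Definition _ (N : submod V) := [isSub for @subm_val N].
HB.instance Definition _ (N : submod V) := [Choice of subm N by <:].
HB.instance Definition _ (N : submod V) :=
  [SubChoice_isSubLmodule of subm N by <:].

Definition quotm (N : submod V) : Type := Quotient.quot (submod_pred N).
HB.instance Definition _ (N : submod V) := GRing.Zmodule.on (quotm N).

Definition proj (N : submod V) (x : V) : quotm N :=
  \pi_(Quotient.quot (submod_pred N)) x.
Definition lift_repr (N : submod V) (q : quotm N) : V :=
  repr (q : Quotient.quot (submod_pred N)).

Lemma lift_reprK (N : submod V) (q : quotm N) : proj N (lift_repr q) = q.
Proof. exact: reprK. Qed.

Lemma proj_eq (N : submod V) (x y : V) :
  proj N x = proj N y <-> x - y \in submod_pred N.
Proof. by rewrite Quotient.idealrBE; split=> [xy|/eqP //]; apply/eqP. Qed.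

Lemma projD (N : submod V) : {morph proj N : x y / x + y}.
Proof. exact: Quotient.pi_add. Qed.

Section Scale.
Variable N : submod V.

Definition quotm_scale (a : R) (q : quotm N) := proj N (a *: lift_repr q).

Lemma proj_scale a x : quotm_scale a (proj N x) = proj N (a *: x).
Proof. by apply/proj_eq; rewrite -scalerBr rpredZ //; apply/proj_eq/lift_reprK. Qed.

Lemma quotm_scaleA a b q : quotm_scale a (quotm_scale b q) = quotm_scale (a * b) q.
Proof. by rewrite -[q]lift_reprK !proj_scale scalerA. Qed.

Lemma quotm_scale1 q : quotm_scale 1 q = q.
Proof. by rewrite -[q]lift_reprK proj_scale scale1r. Qed.

Lemma quotm_scaleDr a : {morph quotm_scale a : p q / p + q}.
Proof.
by move=> p q; rewrite -[p]lift_reprK -[q]lift_reprK -projD !proj_scale scalerDr projD.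
Qed.

Lemma quotm_scaleDl q a b :
  quotm_scale (a + b) q = quotm_scale a q + quotm_scale b q.
Proof. by rewrite -[q]lift_reprK !proj_scale -projD scalerDl. Qed.

HB.instance Definition _ := GRing.Zmodule_isLmodule.Build R (quotm N)
  quotm_scaleA quotm_scale1 quotm_scaleDr (fun q a b => quotm_scaleDl q a b).

Lemma proj_is_linear : linear (proj N).
Proof. by move=> a x y; rewrite projD -proj_scale. Qed.
HB.instance Definition _ := GRing.isLinear.Build R V (quotm N) *:%R (proj N)
  proj_is_linear.
End Scale.
End Submodules.

Definition span (R : comNzRingType) (V : lmodType R) (A : set V) : {pred V} :=
  fun x => `[< forall N : submod V, (forall a, A a -> a \in N) -> x \in N >].

Lemma span_submod (R : comNzRingType) (V : lmodType R) (A : set V) :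
  submod_closed (span A).
Proof.
split=> [|a x y /asboolP Hx /asboolP Hy]; apply/asboolP=> N AN.
  exact: rpred0.
by rewrite rpredD ?rpredZ ?Hx ?Hy.
Qed.

Definition spanm (R : comNzRingType) (V : lmodType R) (A : set V) : submod V :=
  Submod (span_submod A).

Section Kernel.
Variables (R : comNzRingType) (U V W : lmodType R).

Lemma ker_submod (g : {linear V -> W}) : submod_closed [pred x | g x == 0].
Proof.
split=> [|a x y]; rewrite !inE ?raddf0 // => /eqP gx /eqP gy.
by rewrite linearP gx gy scaler0 addr0.
Qed.

Definition ker (g : {linear V -> W}) : submod V := Submod (ker_submod g).

Lemma bound_submod (f : {linear U -> V}) (g : {linear V -> W}) :
  submod_closed [pred x : subm (ker g) | `[< exists u, f u = val x >]].
Proof.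
split=> [|a x y]; first by apply/asboolP; exists 0; rewrite raddf0.
move=> /asboolP[u fu] /asboolP[v fv]; apply/asboolP; exists (a *: u + v).
by rewrite linearP fu fv.
Qed.

(* Homology of U --f--> V --g--> W at V.  No relation g \o f = 0 is required
   for the definition to make sense; it is ker g / (im f `&` ker g). *)
Definition homology (f : {linear U -> V}) (g : {linear V -> W}) : lmodType R :=
  quotm (Submod (bound_submod f g)).
End Kernel.

Definition ann (R : comNzRingType) (V : lmodType R) : set R :=
  [set r | forall x : V, r *: x = 0].

Section Hom.
Variables (R : comNzRingType) (U V : lmodType R).

Definition Hom : Type := {linear U -> V}.
Definition hom_fun (f : Hom) : U -> V := (f : {linear U -> V}).

Lemma hom_ext (f g : Hom) : hom_fun f =1 hom_fun g -> f = g.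
Proof.
move=> /funext; case: f => f cf; case: g => g cg; rewrite /hom_fun /= => fg.
case: g / fg cg => cg; congr GRing.Linear.Pack.
case: cf => [[c1] [c2]]; case: cg => [[d1] [d2]].
by rewrite (Prop_irrelevance c1 d1) (Prop_irrelevance c2 d2).
Qed.

HB.instance Definition _ := gen_eqMixin Hom.
HB.instance Definition _ := gen_choiceMixin Hom.

Definition hom_zero : Hom := \0 : {linear U -> V}.
Definition hom_add (f g : Hom) : Hom := hom_fun f \+ hom_fun g : {linear U -> V}.
Definition hom_opp (f : Hom) : Hom := \- hom_fun f : {linear U -> V}.
Definition hom_scale (a : R) (f : Hom) : Hom := a \*: hom_fun f : {linear U -> V}.

Lemma hom_addA : associative hom_add.
Proof. by move=> f g h; apply: hom_ext => x; exact: addrA. Qed.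
Lemma hom_addC : commutative hom_add.
Proof. by move=> f g; apply: hom_ext => x; exact: addrC. Qed.
Lemma hom_add0 : left_id hom_zero hom_add.
Proof. by move=> f; apply: hom_ext => x; exact: add0r. Qed.
Lemma hom_addN : left_inverse hom_zero hom_opp hom_add.
Proof. by move=> f; apply: hom_ext => x; exact: addNr. Qed.

HB.instance Definition _ :=
  GRing.isZmodule.Build Hom hom_addA hom_addC hom_add0 hom_addN.

Lemma hom_scaleA a b f : hom_scale a (hom_scale b f) = hom_scale (a * b) f.
Proof. by apply: hom_ext => x; exact: scalerA. Qed.
Lemma hom_scale1 : left_id 1 hom_scale.
Proof. by move=> f; apply: hom_ext => x; exact: scale1r. Qed.
Lemma hom_scaleDr : right_distributive hom_scale +%R.
Proof. by move=> a f g; apply: hom_ext => x; exact: scalerDr. Qed.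
Lemma hom_scaleDl f : {morph hom_scale^~ f : a b / a + b}.
Proof. by move=> a b; apply: hom_ext => x; exact: scalerDl. Qed.

HB.instance Definition _ := GRing.Zmodule_isLmodule.Build R Hom
  hom_scaleA hom_scale1 hom_scaleDr hom_scaleDl.
End Hom.

Section HomMap.
Variables (R : comNzRingType) (U U' : lmodType R) (f : {linear U -> U'}).
Variable V : lmodType R.

Definition hom_map (g : Hom U' V) : Hom U V := hom_fun g \o f : {linear U -> V}.

Lemma hom_map_is_linear : linear hom_map.
Proof. by move=> a g h; apply: hom_ext. Qed.
HB.instance Definition _ :=
  GRing.isLinear.Build R (Hom U' V) (Hom U V) *:%R hom_map hom_map_is_linear.
End HomMap.
Arguments hom_map {R U U'} f V g.

Section FreeLift.
Variables (R : comNzRingType) (K : choiceType) (V : lmodType R) (f : K -> V).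

Definition free_lift : {freeg K / R} -> V := fglift f.

Lemma free_lift_is_additive : additive free_lift.
Proof. exact: lift_is_additive. Qed.
HB.instance Definition _ := GRing.isZmodMorphism.Build {freeg K / R} V free_lift
  free_lift_is_additive.

Lemma free_lift_is_linear : scalable free_lift.
Proof.
move=> a x.
have -> : a *: x = \sum_(z <- dom x) << a * coeff z x *g z >> by [].
rewrite -{3}[x]freeg_sumE !raddf_sum; apply: eq_bigr => i _.
by rewrite /= /free_lift !liftU scalerA.
Qed.

HB.instance Definition _ :=
  GRing.isScalable.Build R {freeg K / R} V *:%R free_lift free_lift_is_linear.
End FreeLift.

Definition projective (R : comNzRingType) (P : lmodType R) : Prop :=
  forall (M N : lmodType R) (g : {linear M -> N}) (f : {linear P -> N}),
    (forall y, exists x, g x = y) -> exists h : {linear P -> M}, g \o h =1 f.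

Lemma free_liftU (R : comNzRingType) (K : choiceType) (V : lmodType R)
  (f : K -> V) k : free_lift f << k >> = f k.
Proof. by rewrite /free_lift liftU scale1r. Qed.

Lemma free_lift_uniq (R : comNzRingType) (K : choiceType) (V : lmodType R)
  (f : {linear {freeg K / R} -> V}) : f =1 free_lift (fun k => f << k >>).
Proof.
move=> x; rewrite -[x]freeg_sumE !raddf_sum; apply: eq_bigr => k _.
have -> : << coeff k x *g k >> = coeff k x *: << k >> :> {freeg K / R}.
  by apply/eqP/freeg_eqP => l; rewrite coeffZ !coeffU mulrA mulr1.
by rewrite /= !linearZ /= free_liftU.
Qed.

Lemma freeg_projective (R : comNzRingType) (K : choiceType) :
  projective ({freeg K / R} : lmodType R).
Proof.
move=> M N g f surj_g.
have [h gh] := choice (fun k : K => surj_g (f << k >>)).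
exists (free_lift h) => x.
rewrite [LHS](free_lift_uniq (g \o free_lift h)) [RHS]free_lift_uniq.
by congr (free_lift _ x); apply/funext => k; rewrite /= free_liftU.
Qed.

Section Tensor.
Variables (R : comNzRingType).

Section TensorProduct.
Variables (U V : lmodType R).

Local Notation "u ** v" := (<< (u, v) >> : {freeg (U * V)%type / R}) (at level 40).

Inductive tensor_rel : set {freeg (U * V)%type / R} :=
| tensor_relDl u u' v : tensor_rel ((u + u') ** v - u ** v - u' ** v)
| tensor_relDr u v v' : tensor_rel (u ** (v + v') - u ** v - u ** v')
| tensor_relZl a u v : tensor_rel ((a *: u) ** v - a *: (u ** v))
| tensor_relZr a u v : tensor_rel (u ** (a *: v) - a *: (u ** v)).

Definition tensor : Type := quotm (spanm tensor_rel).
HB.instance Definition _ := GRing.Lmodule.on tensor.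

Definition tens (u : U) (v : V) : tensor := proj (spanm tensor_rel) (u ** v).
End TensorProduct.

Section TensorMap.
Variables (U U' : lmodType R) (f : {linear U -> U'}) (V : lmodType R).

Definition tensor_map_pre : {linear {freeg (U * V)%type / R} -> tensor U' V} :=
  free_lift (fun uv : U * V => tens (f uv.1) uv.2).

Definition tensor_map (z : tensor U V) : tensor U' V :=
  tensor_map_pre (lift_repr z).

Lemma tensor_map_preU u v : tensor_map_pre << (u, v) >> = tens (f u) v.
Proof. by rewrite /tensor_map_pre /= /free_lift liftU scale1r. Qed.

Lemma tensor_map_pre0 x :
  x \in submod_pred (spanm (@tensor_rel U V)) -> tensor_map_pre x = 0.
Proof.
move=> /asboolP /(_ (ker tensor_map_pre)) Hx; apply/eqP/Hx => {x Hx} y yrel.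
apply/eqP; apply: etrans (_ : proj (spanm (@tensor_rel U' V)) 0 = 0); last exact: raddf0.
case: y / yrel => [u u' v|u v v'|a u v|a u v].
- rewrite !raddfB /= !tensor_map_preU.
  rewrite /tens -!raddfB; apply/proj_eq; rewrite subr0 raddfD.
  by apply/asboolP=> N; apply; exact: tensor_relDl.
- rewrite !raddfB /= !tensor_map_preU /tens -!raddfB; apply/proj_eq; rewrite subr0.
  by apply/asboolP=> N; apply; exact: tensor_relDr.
- rewrite raddfB /= linearZ /= !tensor_map_preU /tens -linearZ -raddfB; apply/proj_eq.
  by rewrite subr0 linearZ; apply/asboolP=> N; apply; exact: tensor_relZl.
- rewrite raddfB /= linearZ /= !tensor_map_preU /tens -linearZ -raddfB; apply/proj_eq.
  by rewrite subr0; apply/asboolP=> N; apply; exact: tensor_relZr.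
Qed.

Lemma tensor_map_proj x : tensor_map (proj _ x) = tensor_map_pre x.
Proof.
apply/eqP; rewrite -subr_eq0 -raddfB; apply/eqP/tensor_map_pre0.
exact/proj_eq/lift_reprK.
Qed.

Lemma tensor_map_is_linear : linear tensor_map.
Proof.
move=> a x y; rewrite -[x]lift_reprK -[y]lift_reprK.
by rewrite -[in LHS]linearP !tensor_map_proj linearP.
Qed.
HB.instance Definition _ :=
  GRing.isLinear.Build R (tensor U V) (tensor U' V) *:%R tensor_map
    tensor_map_is_linear.

Lemma tensor_mapE u v : tensor_map (tens u v) = tens (f u) v.
Proof. by rewrite tensor_map_proj tensor_map_preU. Qed.
End TensorMap.
End Tensor.
Arguments tensor_map {R U U'} f V z.

(* The standard free resolution
     ... -> F_1 = R^(ker (F_0 -> A)) -> F_0 = R^(A) -> A -> 0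
   in which each free module is free on the set of all elements of the
   previous kernel. *)
Section Resolution.
Variables (R : comNzRingType) (A : lmodType R).

Definition cover (M : lmodType R) : {linear {freeg M / R} -> M} :=
  free_lift (fun x : M => x).

Fixpoint syz (n : nat) : lmodType R :=
  if n is k.+1 then subm (ker (cover (syz k))) else A.

Definition res (n : nat) : lmodType R := {freeg (syz n) / R}.

Definition res_aug : {linear res 0 -> A} := cover A.

Definition res_diff (n : nat) : {linear res n.+1 -> res n} :=
  (val : subm (ker (cover (syz n))) -> res n) \o cover (syz n.+1).

Lemma coverU (M : lmodType R) (x : M) : cover M << x >> = x.
Proof. by rewrite /cover /= /free_lift liftU scale1r. Qed.

Lemma res_aug_surj x : exists y, res_aug y = x.
Proof. by exists << x >>; exact: coverU. Qed.

Lemma res_exact0 (x : res 0) : res_aug x = 0 <-> exists y, res_diff 0 y = x.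
Proof.
split=> [/eqP x0|[y <-]]; last exact/eqP/(valP (cover (syz 1) y)).
by exists << Subm (x0 : x \in submod_pred (ker (cover A))) >>; rewrite /= coverU.
Qed.

Lemma res_exact n (x : res n.+1) :
  res_diff n x = 0 <-> exists y, res_diff n.+1 y = x.
Proof.
split=> [x0|[y <-]].
  have kx : x \in submod_pred (ker (cover (syz n.+1))).
    by apply/eqP/val_inj; exact: x0.
  by exists << Subm kx >>; rewrite /= coverU.
rewrite /=.
by move: (valP (cover (syz n.+2) y)) => /eqP ->.
Qed.
End Resolution.

Definition Ext (R : comNzRingType) (i : nat) (A B : lmodType R) : lmodType R :=
  if i is j.+1 then
    homology (hom_map (res_diff A j) B) (hom_map (res_diff A j.+1) B)
  else
    homology (\0 : {linear Hom (res A 0) B -> Hom (res A 0) B})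
             (hom_map (res_diff A 0) B).

Definition Tor (R : comNzRingType) (i : nat) (A B : lmodType R) : lmodType R :=
  if i is j.+1 then
    homology (tensor_map (res_diff A j.+1) B) (tensor_map (res_diff A j) B)
  else
    homology (tensor_map (res_diff A 0) B)
             (\0 : {linear tensor (res A 0) B -> tensor (res A 0) B}).

Record mulset (R : comNzRingType) := MulSet {
  mulset_pred :> {pred R};
  mulset1 : 1 \in mulset_pred;
  mulsetM : forall s t, s \in mulset_pred -> t \in mulset_pred ->
    s * t \in mulset_pred;
  mulset0 : 0 \notin mulset_pred }.

Section FractionModule.
Variables (R : comNzRingType) (S : mulset R) (M : lmodType R).

Record denom := Denom { denom_val :> R; denomP : denom_val \in mulset_pred S }.
HB.instance Definition _ := [isSub for denom_val].
HB.instance Definition _ := [Choice of denom by <:].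

Definition denom1 : denom := Denom (mulset1 S).
Definition denomM (s t : denom) : denom := Denom (mulsetM (denomP s) (denomP t)).

Lemma denom_eq (s t : denom) : s = t :> R -> s = t.
Proof. exact: val_inj. Qed.

Definition frac_eqv (p q : M * denom) : bool :=
  `[< exists u : denom, (u : R) *: ((q.2 : R) *: p.1 - (p.2 : R) *: q.1) = 0 >].

Lemma frac_eqv_refl : reflexive frac_eqv.
Proof. by move=> p; apply/asboolP; exists denom1; rewrite subrr scaler0. Qed.

Lemma frac_eqv_sym : symmetric frac_eqv.
Proof.
suff H p q : frac_eqv p q -> frac_eqv q p by move=> p q; apply/idP/idP; exact: H.
move=> /asboolP[u pq]; apply/asboolP; exists u.
by rewrite -opprB scalerN pq oppr0.
Qed.

Lemma frac_eqvP (x y : M) (s t : denom) :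
  frac_eqv (x, s) (y, t) <->
  exists u : denom, ((u : R) * (t : R)) *: x = ((u : R) * (s : R)) *: y.
Proof.
split=> [/asboolP[u]|[u xy]].
  by rewrite scalerBr !scalerA => /subr0_eq xy; exists u.
by apply/asboolP; exists u; rewrite scalerBr !scalerA xy subrr.
Qed.

Lemma frac_eqv_trans : transitive frac_eqv.
Proof.
move=> [y t] [x s] [z r] /frac_eqvP[u xy] /frac_eqvP[v yz]; apply/frac_eqvP.
exists (denomM (denomM u v) t) => /=.
rewrite (_ : _ * (r : R) = ((v : R) * (r : R)) * ((u : R) * (t : R))); last by ring.
rewrite -scalerA xy scalerA (_ : _ * _ = ((u : R) * (s : R)) * ((v : R) * (r : R))); last by ring.
by rewrite -scalerA yz scalerA; congr (_ *: _); ring.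
Qed.

Canonical frac_equiv := EquivRel frac_eqv frac_eqv_refl frac_eqv_sym frac_eqv_trans.
Canonical frac_encModRel := defaultEncModRel frac_eqv.

Definition frac : Type := {eq_quot frac_eqv}.
HB.instance Definition _ := Choice.on frac.

Definition mkfrac (x : M) (s : denom) : frac := \pi_({eq_quot frac_eqv}) (x, s).
Definition fnum (q : frac) : M := (repr (q : {eq_quot frac_eqv})).1.
Definition fden (q : frac) : denom := (repr (q : {eq_quot frac_eqv})).2.

Lemma mkfracK q : mkfrac (fnum q) (fden q) = q.
Proof. by rewrite /mkfrac -surjective_pairing reprK. Qed.

Lemma mkfracP (x y : M) (s t : denom) :
  mkfrac x s = mkfrac y t <->
  exists u : denom, ((u : R) * (t : R)) *: x = ((u : R) * (s : R)) *: y.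
Proof.
rewrite -frac_eqvP; split=> [/eqP|xy]; last apply/eqP; by rewrite eqmodE.
Qed.

Lemma fracW (P : frac -> Prop) : (forall x s, P (mkfrac x s)) -> forall q, P q.
Proof. by move=> H q; rewrite -[q]mkfracK. Qed.

Lemma fracRP (x : M) (s : denom) : exists u : denom,
  ((u : R) * (s : R)) *: fnum (mkfrac x s) = ((u : R) * (fden (mkfrac x s) : R)) *: x.
Proof. exact/mkfracP/mkfracK. Qed.

Definition frac_add (p q : frac) : frac :=
  mkfrac ((fden q : R) *: fnum p + (fden p : R) *: fnum q) (denomM (fden p) (fden q)).
Definition frac_opp (p : frac) : frac := mkfrac (- fnum p) (fden p).
Definition frac_zero : frac := mkfrac 0 denom1.

Lemma frac_addE x s y t : frac_add (mkfrac x s) (mkfrac y t) =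
  mkfrac ((t : R) *: x + (s : R) *: y) (denomM s t).
Proof.
rewrite /frac_add; apply/mkfracP.
have [u] := fracRP x s; have [v] := fracRP y t.
set x' := fnum (mkfrac x s); set s' := fden (mkfrac x s).
set y' := fnum (mkfrac y t); set t' := fden (mkfrac y t) => yy xx.
exists (denomM u v); rewrite !scalerDr !scalerA /=; congr (_ + _).
  rewrite (_ : _ * _ = ((v : R) * (t : R) * (t' : R)) * ((u : R) * (s : R))); last by ring.
  by rewrite -scalerA xx scalerA; congr (_ *: _); ring.
rewrite (_ : _ * _ = ((u : R) * (s : R) * (s' : R)) * ((v : R) * (t : R))); last by ring.
by rewrite -scalerA yy scalerA; congr (_ *: _); ring.
Qed.

Lemma frac_oppE x s : frac_opp (mkfrac x s) = mkfrac (- x) s.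
Proof.
apply/mkfracP; have [u xx] := fracRP x s; exists u.
by rewrite !scalerN xx.
Qed.

Lemma frac_addA : associative frac_add.
Proof.
elim/fracW=> x s; elim/fracW=> y t; elim/fracW=> z r; rewrite !frac_addE.
apply/mkfracP; exists denom1; rewrite !scalerDr !scalerA /= addrA.
by congr (_ *: _ + _ *: _ + _ *: _); ring.
Qed.

Lemma frac_addC : commutative frac_add.
Proof.
elim/fracW=> x s; elim/fracW=> y t; rewrite !frac_addE addrC.
by congr mkfrac; apply/denom_eq/mulrC.
Qed.

Lemma frac_add0 : left_id frac_zero frac_add.
Proof.
elim/fracW=> x s; rewrite frac_addE scaler0 add0r.
by apply/mkfracP; exists denom1; rewrite !scalerA /=; congr (_ *: _); ring.
Qed.

Lemma frac_addN : left_inverse frac_zero frac_opp frac_add.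
Proof.
elim/fracW=> x s; rewrite frac_oppE frac_addE scalerN addNr.
by apply/mkfracP; exists denom1; rewrite !scaler0.
Qed.

HB.instance Definition _ :=
  GRing.isZmodule.Build frac frac_addA frac_addC frac_add0 frac_addN.
End FractionModule.

Arguments frac {R} S M.
Arguments mkfrac {R} S {M} x s.

Section FractionRing.
Variables (R : comNzRingType) (S : mulset R).

Definition fracR : Type := frac S R^o.
HB.instance Definition _ := GRing.Zmodule.on fracR.

Section Action.
Variable M : lmodType R.

Definition frac_scale (a : fracR) (q : frac S M) : frac S M :=
  mkfrac S ((fnum a : R) *: fnum q) (denomM (fden a) (fden q)).

Lemma frac_scaleE a s x t :
  frac_scale (mkfrac S (a : R^o) s) (mkfrac S x t) = mkfrac S (a *: x) (denomM s t).
Proof.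
rewrite /frac_scale; apply/mkfracP.
have [u] := fracRP (a : R^o) s; have [v] := fracRP x t.
set a' := fnum (mkfrac S (a : R^o) s); set s' := fden (mkfrac S (a : R^o) s).
set x' := fnum (mkfrac S x t); set t' := fden (mkfrac S x t) => xx aa.
exists (denomM u v); rewrite !scalerA /=.
rewrite (_ : _ * _ = ((u : R) * (s : R) * (a' : R)) * ((v : R) * (t : R))); last by ring.
rewrite -scalerA xx scalerA; congr (_ *: _).
by move: aa; rewrite /GRing.scale /= => ->; ring.
Qed.

Lemma fracRD a s b t : mkfrac S (a : R^o) s + mkfrac S (b : R^o) t =
  mkfrac S ((t : R) * a + (s : R) * b : R^o) (denomM s t) :> fracR.
Proof. exact: frac_addE. Qed.

Lemma fracD x s y t : mkfrac S x s + mkfrac S y t =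
  mkfrac S ((t : R) *: x + (s : R) *: y) (denomM s t) :> frac S M.
Proof. exact: frac_addE. Qed.

Lemma frac_scaleDr a : {morph frac_scale a : x y / x + y}.
Proof.
elim/fracW: a => a s; elim/fracW=> x t; elim/fracW=> y r.
rewrite fracD !frac_scaleE fracD.
apply/mkfracP; exists (denom1 S); rewrite !scalerDr !scalerA /=.
by congr (_ *: _ + _ *: _); ring.
Qed.

Lemma frac_scaleDl q : {morph frac_scale^~ q : a b / a + b}.
Proof.
elim/fracW: q => x r; elim/fracW=> a s; elim/fracW=> b t.
rewrite fracRD !frac_scaleE fracD.
apply/mkfracP; exists (denom1 S); rewrite scalerDl !scalerDr !scalerA /=.
by congr (_ *: _ + _ *: _); ring.
Qed.
End Action.

Definition fracR1 : fracR := mkfrac S (1 : R^o) (denom1 S).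
Definition fracR_mul (a b : fracR) : fracR := frac_scale a b.

Lemma fracR_mulE a s b t :
  fracR_mul (mkfrac S (a : R^o) s) (mkfrac S (b : R^o) t) =
  mkfrac S (a * b : R^o) (denomM s t).
Proof. exact: frac_scaleE. Qed.

Lemma frac_scaleA (M : lmodType R) (a b : fracR) (q : frac S M) :
  frac_scale a (frac_scale b q) = frac_scale (fracR_mul a b) q.
Proof.
elim/fracW: a => a s; elim/fracW: b => b t; elim/fracW: q => x r.
rewrite fracR_mulE (frac_scaleE b t x r) !frac_scaleE scalerA.
by congr (mkfrac S _ _); apply/denom_eq/mulrA.
Qed.

Lemma frac_scale1 (M : lmodType R) : left_id fracR1 (@frac_scale M).
Proof.
elim/fracW=> x r; rewrite frac_scaleE scale1r.
by congr (mkfrac S _ _); apply/denom_eq/mul1r.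
Qed.

Lemma fracR_mulA : associative fracR_mul.
Proof. by move=> a b c; exact: frac_scaleA. Qed.
Lemma fracR_mulC : commutative fracR_mul.
Proof.
elim/fracW=> a s; elim/fracW=> b t; rewrite !fracR_mulE mulrC.
by congr (mkfrac S _ _); apply/denom_eq/mulrC.
Qed.
Lemma fracR_mul1 : left_id fracR1 fracR_mul.
Proof. exact: frac_scale1. Qed.
Lemma fracR_mulDl : left_distributive fracR_mul +%R.
Proof. by move=> a b c; exact: frac_scaleDl. Qed.
Lemma fracR_1neq0 : fracR1 != 0.
Proof.
apply/eqP => /mkfracP[u] /=; rewrite scaler0 /GRing.scale /= !mulr1 => u0.
by have := mulset0 S; rewrite -u0 denomP.
Qed.

HB.instance Definition _ := GRing.Zmodule_isComNzRing.Build fracR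
  fracR_mulA fracR_mulC fracR_mul1 fracR_mulDl fracR_1neq0.

HB.instance Definition _ (M : lmodType R) :=
  GRing.Zmodule_isLmodule.Build fracR (frac S M)
    (@frac_scaleA M) (@frac_scale1 M) (@frac_scaleDr M) (@frac_scaleDl M).

Definition to_frac (r : R) : fracR := mkfrac S (r : R^o) (denom1 S).

Lemma to_frac_is_additive : additive to_frac.
Proof.
move=> a b; apply: etrans (_ : mkfrac S (a : R^o) (denom1 S) + mkfrac S (- b : R^o) (denom1 S) = _).
  rewrite fracRD; apply/mkfracP; exists (denom1 S).
  by rewrite /GRing.scale /=; ring.
by congr (_ + _); apply/esym/frac_oppE.
Qed.

Lemma to_frac_is_multiplicative : GRing.monoid_morphism to_frac.
Proof.
split=> // a b; apply/esym/(etrans (fracR_mulE _ _ _ _)).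
by congr (mkfrac S _ _); apply/denom_eq/mulr1.
Qed.

HB.instance Definition _ := GRing.isZmodMorphism.Build R fracR to_frac
  to_frac_is_additive.
HB.instance Definition _ := GRing.isMonoidMorphism.Build R fracR to_frac
  to_frac_is_multiplicative.
End FractionRing.

Section Ideals.
Variable R : comNzRingType.

Definition noetherian : Prop :=
  forall I : submod R^o, exists s : seq R^o, I =i span [set` s].

Definition maximal_ideal (I : idealr R) : Prop :=
  forall J : idealr R, {subset I <= J} -> {subset J <= I}.

Definition local_ring (m : idealr R) : Prop :=
  maximal_ideal m /\ forall J : idealr R, maximal_ideal J -> J =i m.

Definition prime_compl (p : prime_idealr R) : {pred R} := [pred x | x \notin p].

Lemma prime_compl1 (p : prime_idealr R) : 1 \in prime_compl p.
Proof. by rewrite inE /= idealr1. Qed.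

Lemma prime_complM (p : prime_idealr R) s t :
  s \in prime_compl p -> t \in prime_compl p -> s * t \in prime_compl p.
Proof. by rewrite !inE /= prime_idealrM negb_or => -> ->. Qed.

Lemma prime_compl0 (p : prime_idealr R) : 0 \notin prime_compl p.
Proof. by rewrite inE /= negbK idealr0. Qed.

Definition at_prime (p : prime_idealr R) : mulset R :=
  MulSet (prime_compl1 p) (@prime_complM p) (prime_compl0 p).

Definition max_at (p : prime_idealr R) : set (fracR (at_prime p)) :=
  [set z | exists (a : R) (s : denom (at_prime p)),
             a \in p /\ z = mkfrac (at_prime p) (a : R^o) s].

Definition regular : {pred R} := fun x => `[< GRing.lreg x >].

Lemma regular1 : 1 \in regular.
Proof. exact/asboolP/GRing.lreg1. Qed.

Lemma regularM s t : s \in regular -> t \in regular -> s * t \in regular.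
Proof. by move=> /asboolP rs /asboolP rt; apply/asboolP/GRing.lregM. Qed.

Lemma regular0 : 0 \notin regular.
Proof.
apply/asboolP => /(_ 1 0); rewrite !mul0r => /(_ erefl) /eqP.
by rewrite oner_eq0.
Qed.

Definition nonzerodiv : mulset R := MulSet regular1 regularM regular0.
End Ideals.

Definition reduced (R : comNzRingType) : Prop :=
  forall (x : R) (n : nat), x ^+ n = 0 -> x = 0.

Section IdealProduct.
Variables (R : comNzRingType) (I J : idealr R).

Definition ideal_prod : {pred R} :=
  span [set x : R^o | exists a b : R, [/\ a \in I, b \in J & x = a * b]].

Lemma ideal_prod_closed : idealr_closed ideal_prod.
Proof.
have [H0 HP] := span_submod
  [set x : R^o | exists a b : R, [/\ a \in I, b \in J & x = a * b]].
split=> //; apply/negP => /asboolP H1.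
have Isub : submod_closed ((I : pred R) : {pred R^o}).
  by split=> [|a x y xI yI]; [exact: idealr0 | rewrite rpredD // idealMr].
have I1 : (1 : R) \in I.
  by apply: (H1 (Submod Isub)) => _ [a [b [aI _ ->]]]; rewrite mulrC; exact: idealMr.
by rewrite idealr1 in I1.
Qed.

HB.instance Definition _ := isIdealr.Build R ideal_prod ideal_prod_closed.
End IdealProduct.

Section Completion.
Variables (R : comNzRingType) (m : idealr R).

(* [ideal_powS n] is m ^ (n + 1) *)
Fixpoint ideal_powS (n : nat) : idealr R :=
  if n is k.+1 then (ideal_prod m (ideal_powS k) : {pred R}) : idealr R else m.

Definition mod_powS (n : nat) : comNzRingType := {ideal_quot ideal_powS n}.

Definition trans n (q : mod_powS n.+1) : mod_powS n :=
  \pi_({ideal_quot ideal_powS n}) (repr q).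

Lemma ideal_powS_sub n : {subset ideal_powS n.+1 <= ideal_powS n}.
Proof.
move=> x /asboolP Hx.
have Isub : submod_closed ((ideal_powS n : pred R) : {pred R^o}).
  by split=> [|a y z yI zI]; [exact: idealr0 | rewrite rpredD // idealMr].
by apply: (Hx (Submod Isub)) => _ [a [b [_ bI ->]]]; exact: idealMr.
Qed.

Lemma trans_pi n (x : R) :
  trans (\pi_({ideal_quot ideal_powS n.+1}) x) = \pi_({ideal_quot ideal_powS n}) x.
Proof.
apply/eqP; rewrite /trans -Quotient.idealrBE; apply: ideal_powS_sub.
by rewrite Quotient.idealrBE reprK.
Qed.

Lemma trans_is_additive n : additive (@trans n).
Proof.
move=> p q; rewrite -[p]reprK -[q]reprK !trans_pi.
by rewrite -[in LHS]raddfB trans_pi raddfB.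
Qed.

Lemma trans_is_multiplicative n : GRing.monoid_morphism (@trans n).
Proof.
split=> [|p q]; first by rewrite -(rmorph1 (\pi_({ideal_quot ideal_powS n.+1}))) trans_pi rmorph1.
rewrite -[p]reprK -[q]reprK !trans_pi.
by rewrite -[in LHS]rmorphM trans_pi rmorphM.
Qed.

HB.instance Definition _ n :=
  GRing.isZmodMorphism.Build (mod_powS n.+1) (mod_powS n) (@trans n)
    (@trans_is_additive n).
HB.instance Definition _ n :=
  GRing.isMonoidMorphism.Build (mod_powS n.+1) (mod_powS n) (@trans n)
    (@trans_is_multiplicative n).

Definition prod_mod : Type := forall n, mod_powS n.
HB.instance Definition _ := Choice.on prod_mod.

Section ProdRing.
Implicit Types f g h : prod_mod.
Let add f g : prod_mod := fun n => f n + g n.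
Let opp f : prod_mod := fun n => - f n.
Let mul f g : prod_mod := fun n => f n * g n.

Let addA : associative add.
Proof. by move=> f g h; apply: functional_extensionality_dep => n; exact: addrA. Qed.
Let addC : commutative add.
Proof. by move=> f g; apply: functional_extensionality_dep => n; exact: addrC. Qed.
Let add0 : left_id (fun n => 0) add.
Proof. by move=> f; apply: functional_extensionality_dep => n; exact: add0r. Qed.
Let addN : left_inverse (fun n => 0) opp add.
Proof. by move=> f; apply: functional_extensionality_dep => n; exact: addNr. Qed.
HB.instance Definition _ := GRing.isZmodule.Build prod_mod addA addC add0 addN.

Let mulA : associative mul.
Proof. by move=> f g h; apply: functional_extensionality_dep => n; exact: mulrA. Qed.
Let mulC : commutative mul.
Proof. by move=> f g; apply: functional_extensionality_dep => n; exact: mulrC. Qed.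
Let mul1 : left_id (fun n => 1) mul.
Proof. by move=> f; apply: functional_extensionality_dep => n; exact: mul1r. Qed.
Let mulD : left_distributive mul +%R.
Proof. by move=> f g h; apply: functional_extensionality_dep => n; exact: mulrDl. Qed.
Let one_neq0 : (fun n => 1) != 0 :> prod_mod.
Proof.
apply/eqP => /(congr1 (fun f : prod_mod => f 0%N)) /eqP.
by apply/negP/oner_neq0.
Qed.
HB.instance Definition _ := GRing.Zmodule_isComNzRing.Build prod_mod
  mulA mulC mul1 mulD one_neq0.
End ProdRing.

Definition compatible : {pred prod_mod} :=
  fun f => `[< forall n, trans (f n.+1) = f n >].

Lemma compatible_subring : subring_closed compatible.
Proof.
split=> [|f g /asboolP Hf /asboolP Hg|f g /asboolP Hf /asboolP Hg];
  apply/asboolP => n.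
- exact: rmorph1.
- by rewrite -[LHS]/(trans (f n.+1 - g n.+1)) rmorphB /= Hf Hg.
- by rewrite -[LHS]/(trans (f n.+1 * g n.+1)) rmorphM /= Hf Hg.
Qed.
HB.instance Definition _ :=
  GRing.isSubringClosed.Build prod_mod compatible compatible_subring.

(* The inverse limit of the rings R / m ^ (n + 1). *)
Record completion := Completion {
  completion_val :> prod_mod;
  completionP : completion_val \in compatible }.
HB.instance Definition _ := [isSub for completion_val].
HB.instance Definition _ := [Choice of completion by <:].
HB.instance Definition _ := [SubChoice_isSubComNzRing of completion by <:].
End Completion.

(* The supremum of a nonempty set of natural numbers; [None] stands for
   infinity. *)
Definition nat_sup (A : set nat) : option nat :=
  if pselect (exists n, A n /\ forall k, A k -> (k <= n)%N) is left h
  then Some (projT1 (cid h)) else None.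

Definition krull_dim (R : comNzRingType) : option nat :=
  nat_sup [set n | exists p : nat -> prime_idealr R, forall i, (i < n)%N ->
    {subset p i <= p i.+1} /\ ~ {subset p i.+1 <= p i}].

Section Depth.
Variables (R : comNzRingType) (M : lmodType R).

Definition ideal_mul (s : seq R) : submod M :=
  spanm [set z : M | exists a x, a \in s /\ z = a *: x].

Definition regular_seq (s : seq R) : Prop :=
  (forall i, (i < size s)%N -> forall x : quotm (ideal_mul (take i s)),
     s`_i *: x = 0 -> x = 0) /\
  exists x : quotm (ideal_mul s), x != 0.

(* The supremum of the lengths of the M-regular sequences in [I].  It is used
   for R local, I its maximal ideal, and M finitely generated and nonzero. *)
Definition depth (I : set R) : option nat :=
  nat_sup [set n | exists s : seq R,
    [/\ size s = n, forall a, a \in s -> I a & regular_seq s]].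
End Depth.

Section Modules.
Variable R : comNzRingType.

Definition iso (M N : lmodType R) : Prop :=
  exists f : {linear M -> N}, bijective f.

Definition fin_gen (M : lmodType R) : Prop :=
  exists s : seq M, forall x, x \in span [set` s].

Definition free_module (M : lmodType R) : Prop :=
  exists K : choiceType, iso M {freeg K / R}.

Definition subcategory (X : lmodType R -> Prop) : Prop :=
  (forall M N, iso M N -> X M -> X N) /\
  (forall M : lmodType R, (forall x : M, x = 0) -> X M).

(* Omega^n Z, via exact sequences 0 -> C_(n+1) -> C_n -> ... -> C_1 -> C_0 -> 0
   with C_(n+1) = M, C_0 = N in Z, and C_(i+1) = P_i. *)
Definition syzygy (n : nat) (Z : lmodType R -> Prop) (M : lmodType R) : Prop :=
  exists (C : nat -> lmodType R) (d : forall i, {linear C i.+1 -> C i}),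
    [/\ iso M (C n.+1), Z (C 0%N),
        forall i, (i < n)%N -> fin_gen (C i.+1) /\ projective (C i.+1),
        (forall y, exists x, d 0%N x = y) /\ injective (d n)
      & forall i, (i < n)%N -> forall x : C i.+1,
          d i x = 0 <-> exists y, d i.+1 y = x].

Definition ann_Ext (n : nat) (A B : lmodType R -> Prop) : set R :=
  [set r | forall i M N, (n < i)%N -> A M -> B N -> ann (Ext i M N) r].

Definition ann_Tor (n : nat) (A B : lmodType R -> Prop) : set R :=
  [set r | forall i M N, (n < i)%N -> A M -> B N -> ann (Tor i M N) r].
End Modules.

Definition ring_at (R : comNzRingType) (p : prime_idealr R) : comNzRingType :=
  fracR (at_prime p).

Definition localize (R : comNzRingType) (M : lmodType R) (p : prime_idealr R) :
  lmodType (ring_at p) := frac (at_prime p) M.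

Definition supp (R : comNzRingType) (M : lmodType R) (p : prime_idealr R) : Prop :=
  exists x : localize M p, x != 0.

Definition CM (R : comNzRingType) (M : lmodType R) : Prop :=
  fin_gen M /\ forall p : prime_idealr R, supp M p ->
    depth (localize M p) (@max_at R p) = krull_dim (ring_at p).

Definition CM0 (R : comNzRingType) (M : lmodType R) : Prop :=
  CM M /\ forall p : prime_idealr R, ~ maximal_ideal p ->
    free_module (localize M p).

Arguments CM R M : clear implicits.
Arguments CM0 R M : clear implicits.

Definition total_frac (R : comNzRingType) : comNzRingType := fracR (nonzerodiv R).

Definition to_total (R : comNzRingType) : {rmorphism R -> total_frac R} :=
  to_frac (nonzerodiv R).
Arguments to_total : clear implicits.

Definition integral_closure (R : comNzRingType) : set (total_frac R) :=
  [set z | integralOver (to_total R) z].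
Arguments integral_closure : clear implicits.

Definition conductor_frac (R : comNzRingType) : set (total_frac R) :=
  [set x | forall z, integral_closure R z -> range (to_total R) (x * z)].
Arguments conductor_frac : clear implicits.

(* The conductor as an ideal of R.  Since 1 is integral over R,
   [conductor_frac R] is contained in the image of R -> Q(R), so that taking
   the inverse image loses nothing. *)
Definition conductor (R : comNzRingType) : set R :=
  to_total R @^-1` conductor_frac R.
Arguments conductor : clear implicits.

(* Main.v *)
From HB Require Import structures.
From mathcomp Require Import all_boot all_algebra.
From mathcomp Require Import boolp classical_sets functions.
From mathcomp Require Import ring.
From mathcomp.multinomials Require Import freeg.
Require Import Defs.

Set Implicit Arguments.
Unset Strict Implicit.
Unset Printing Implicit Defensive.
Import GRing.Theory.
Local Open Scope ring_scope.
Local Open Scope quotient_scope.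
Local Open Scope classical_set_scope.

(** Let [V] be the integral closure of [R] in its total ring of fractions and [C]
    the conductor.  The proof is elementary and has three parts.

    Finiteness of [V].  A regular element [x] of the maximal ideal makes [R / x R]
    of finite length [e], and a comparison of lengths bounds by [e] the number of
    generators of every ideal containing a power of [x].  Hence every integral
    element has degree at most [e] ([uniform_degree]), so that the [e]-th power of
    an element of [x ^+ n * V `&` R] is divisible by [x ^+ n].  If [V] had
    unbounded denominators, a limit of such elements would be a nonzero nilpotent
    of the completion ([integral_closure_bounded]).  Thus [V] is a finite
    [R]-module and [C] contains a regular element.

    [C] annihilates.  The maximal Cohen--Macaulay modules are the finitely
    generated torsion-free ones.  Since [V] is integrally closed of dimension one,
    its finitely generated ideals are projective, and so are its finitely
    generated torsion-free modules; in matrix form this is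
    [integral_generalized_inverse].  Therefore a presentation [R^n -> M] of a
    torsion-free [M] splits after extension to [V], and multiplying a splitting by
    [c] in [C] brings it back into [R]: multiplication by [c] on [M] factors
    through a free module ([conductor_factor]).  It is then null-homotopic in
    positive degrees on a free resolution, so it kills all [Ext] and [Tor].

    Annihilators lie in [C].  Let [y] generate [V] with first entry [1].  Inside
    [R^n] the vectors proportional to [y] form a copy of [C], and the quotient is
    torsion-free.  An element [r] killing the second [Ext] of this quotient with
    its second syzygy acts on [C] through a free module; thus [r] is a sum of
    products of elements of [C] with fractions multiplying [C] into [R], and these
    fractions are integral ([conductor_dual]), so [r] is in [C].  For [Tor], let
    [c] generate [C]: the element [\sum_j c_j y ** e_j] of the tensor product of
    the line through [y] with the quotient of [R^l] by the line through [c]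
    vanishes in the free module, so [r] kills it, and a linear map to
    [R^l / { a c | a \in C }] shows that [r] is in [C].

    The equality of [CM] and [CM0] holds because [R] is reduced, so that its
    localizations at non-maximal primes are fields. *)
(** * Ideals of a Noetherian ring *)

Section IdealSets.
Variable R : comNzRingType.
Implicit Types (I J : set R) (s : seq R).

Definition ideal I : Prop :=
  [/\ I 0, forall x y, I x -> I y -> I (x + y) & forall a x, I x -> I (a * x)].

Definition adjoin I z : set R := [set x | exists y a, I y /\ x = y + a * z].

Definition principal (z : R) : set R := [set x | exists a, x = a * z].

Lemma idealB I x y : ideal I -> I x -> I y -> I (x - y).
Proof. by case=> _ ID IM Ix Iy; apply: ID => //; rewrite -mulN1r; apply: IM. Qed.

Lemma principal_ideal z : ideal (principal z).
Proof.
split=> [|x y [a ->] [b ->]|a x [b ->]]; first by exists 0; rewrite mul0r.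
  by exists (a + b); rewrite mulrDl.
by exists (a * b); rewrite mulrA.
Qed.

Lemma adjoin_ideal I z : ideal I -> ideal (adjoin I z).
Proof.
case=> I0 ID IM; split=> [|x y [x' [a [Ix ->]]] [y' [b [Iy ->]]]|b x [x' [a [Ix ->]]]].
- by exists 0, 0; rewrite mul0r addr0.
- by exists (x' + y'), (a + b); split; [apply: ID | ring].
- by exists (b * x'), (b * a); split; [apply: IM | ring].
Qed.

Lemma sub_adjoin I z : I `<=` adjoin I z.
Proof. by move=> x Ix; exists x, 0; rewrite mul0r addr0. Qed.

Lemma mem_adjoin I z : ideal I -> adjoin I z z.
Proof. by case=> I0 _ _; exists 0, 1; rewrite mul1r add0r. Qed.

Lemma idealr_ideal (m : idealr R) : ideal [set x | x \in m].
Proof.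
split=> /= [|x y mx my|a x]; [exact: idealr0 | exact: rpredD | exact: idealMr].
Qed.

Lemma ideal_prime I : ideal I -> ~ I 1 ->
    (forall u v, I (u * v) -> I u \/ I v) ->
  exists p : prime_idealr R, forall x, x \in p <-> I x.
Proof.
case=> I0 ID IM I1 IP; pose S : R -> bool := fun x => `[< I x >].
have cS : idealr_closed S.
  split; [exact/asboolP | exact/asboolP | move=> a u v /asboolP uI /asboolP vI].
  by apply/asboolP/ID => //; apply: IM.
have pS : prime_idealr_closed S.
  by move=> u v /asboolP/IP[] ?; apply/orP; [left|right]; apply/asboolP.
pose h := isIdealr.Build R S cS.
pose h' := isPrimeIdealrClosed.Build R S pS.
pose J : prime_idealr R := HB.pack_for (prime_idealr R) S h h'.
by exists J => x; split=> /asboolP.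
Qed.

Section Noetherian.
Hypothesis noethR : noetherian R.

Lemma noetherian_gen I : ideal I -> exists s, (forall z, z \in s -> I z) /\
  forall J, ideal J -> (forall z, z \in s -> J z) -> I `<=` J.
Proof.
case=> I0 ID IM.
have cI : submod_closed ([pred x | `[< I x >]] : {pred R^o}).
  split=> [|a x y /asboolP Ix /asboolP Iy]; apply/asboolP => //.
  by apply: ID => //; apply: IM.
have [s sI] := noethR (Submod cI); exists s; split=> [z zs|J [J0 JD JM] sJ x Ix].
  apply/asboolP; rewrite -[`[< _ >]]/(z \in Submod cI) sI; apply/asboolP => N; exact.
have cJ : submod_closed ([pred x | `[< J x >]] : {pred R^o}).
  split=> [|a u v /asboolP Ju /asboolP Jv]; apply/asboolP => //.
  by apply: JD => //; apply: JM.
have : x \in (Submod cI : {pred R^o}) by apply/asboolP.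
rewrite sI => /asboolP/(_ (Submod cJ)) xJ.
by apply/asboolP/xJ => z /= zs; apply/asboolP/sJ.
Qed.

Lemma noetherian_max (P : set R -> Prop) I0 : ideal I0 -> P I0 ->
  exists I, [/\ ideal I, P I, I0 `<=` I &
    forall J, ideal J -> P J -> I `<=` J -> J `<=` I].
Proof.
move=> idI0 PI0; apply: contrapT => noMax.
have next I : exists J, ideal I -> P I -> I0 `<=` I ->
    [/\ ideal J, P J, I `<=` J & ~ J `<=` I].
  apply: contrapT => nJ; apply: noMax; exists I.
  have [[] H|H] := pselect ([/\ ideal I, P I & I0 `<=` I]); last first.
    by case: nJ; exists I => *; case: H.
  split=> // J iJ PJ IJ; apply: contrapT => JI.
  by apply: nJ; exists J.
have [f fP] := choice next; pose C n := iter n f I0.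
have CP n : [/\ ideal (C n), P (C n) & I0 `<=` C n].
  elim: n => [|n [iC PC I0C]]; first by split.
  have [iC' PC' CC' _] := fP _ iC PC I0C; split=> //.
  exact: subset_trans CC'.
have CS n : C n `<=` C n.+1 by have [iC PC IC] := CP n; have [] := fP _ iC PC IC.
have Cle n k : (n <= k)%N -> C n `<=` C k.
  move=> /subnK <-; elim: (k - n)%N => // i IH.
  by apply: subset_trans IH _; exact: CS.
pose U : set R := [set x | exists n, C n x].
have iU : ideal U.
  split=> [|x y [n Cx] [k Cy]|a x [n Cx]].
  - by exists 0%N; case: idI0.
  - exists (maxn n k); have [[_ D _] _ _] := CP (maxn n k).
    by apply: D; [apply: (Cle n) Cx|apply: (Cle k) Cy]; rewrite (leq_maxl, leq_maxr).
  - by exists n; have [[_ _ M] _ _] := CP n; apply: M.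
have [s [sU Umin]] := noetherian_gen iU.
have [N sN] : exists N, forall z, z \in s -> C N z.
  elim: s sU {Umin} => [|z s IH] sU; first by exists 0%N.
  have [|N sN] := IH; first by move=> y ys; apply: sU; rewrite inE ys orbT.
  have [k Cz] := sU z (mem_head _ _); exists (maxn N k) => y.
  rewrite inE => /predU1P[->|ys]; first by apply: Cle Cz; exact: leq_maxr.
  by apply: (Cle N); [exact: leq_maxl | exact: sN].
have [iC PC IC] := CP N; have [_ _ _ []] := fP _ iC PC IC.
by apply: subset_trans (Umin _ iC sN) => x Cx; exists N.+1.
Qed.

(** An ideal maximal among those containing [I] and avoiding the multiplicative
    set [S] is prime. *)
Lemma exists_prime (S : set R) I : S 1 ->
    (forall x y, S x -> S y -> S (x * y)) -> ideal I -> (forall x, I x -> ~ S x) ->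
  exists p : prime_idealr R, [/\ forall x, I x -> x \in p, forall x, x \in p -> ~ S x &
    forall J, ideal J -> (forall x, x \in p -> J x) -> (forall x, J x -> ~ S x) ->
      forall x, J x -> x \in p].
Proof.
move=> S1 SM iI IS.
have [J [iJ JS IJ maxJ]] := noetherian_max (P := fun J => forall x, J x -> ~ S x) iI IS.
have [J0 JD JM] := iJ.
have meet z : ~ J z -> exists a y, J y /\ S (y + a * z).
  move=> Jz; apply: contrapT => nS; apply: Jz.
  apply: maxJ (@sub_adjoin J z) _ (mem_adjoin _ iJ); first exact: adjoin_ideal.
  by move=> x [y [a [Jy ->]]] Sx; apply: nS; exists a, y.
have [||p pJ] := ideal_prime iJ; first by move=> /JS.
  move=> u v Juv; apply: contrapT => /not_orP[/meet[a [y [Jy Sy]]] /meet[b [z [Jz Sz]]]].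
  apply: (JS ((y + a * u) * (z + b * v))); last exact: SM.
  rewrite (_ : _ * _ = (z + b * v) * y + a * u * z + a * b * (u * v)); last by ring.
  by apply/JD/JM => //; apply: JD; apply: JM.
exists p; split=> [x Ix|x /pJ/JS //|K iK pK KS x Kx]; first exact/pJ/IJ.
by apply/pJ/(maxJ K) => // y Jy; apply/pK/pJ.
Qed.

End Noetherian.
(** If each member of a sequence has a power carrying [h] into [I], a suitable
    monomial multiple of [h] is a socle element modulo [I].  The scalars range
    over a multiplicative set [S], so that [I] may be an ideal of a subring. *)
Lemma socle_element (S I : set R) s h : S 1 ->
    (forall a b, S a -> S b -> S (a * b)) -> (forall a y, S a -> I y -> I (a * y)) ->
    (forall z, z \in s -> S z) -> ~ I h ->
    (forall z, z \in s -> exists n, I (z ^+ n * h)) ->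
  exists y, [/\ ~ I y, exists a, S a /\ y = a * h & forall z, z \in s -> I (z * y)].
Proof.
move=> S1 SM IM; elim: s => [|z s IH] sS Ih sI.
  by exists h; split=> //; exists 1; rewrite mul1r.
have sub w : w \in s -> w \in z :: s by rewrite inE orbC => ->.
have [|||y [Iy [a [Sa ya]] sy]] := IH; [by move=> w /sub/sS|exact: Ih|by move=> w /sub/sI|].
have [Sz [n zn]] := (sS z (mem_head _ _), sI z (mem_head _ _)).
have Szn k : S (z ^+ k) by elim: k => // k IHk; rewrite exprS; apply: SM.
have zny : exists n, `[< I (z ^+ n * y) >].
  by exists n; apply/asboolP; rewrite ya mulrCA; apply: IM.
have := ex_minnP zny; case=> -[|k] /asboolP kI kmin; first by rewrite mul1r in kI.
exists (z ^+ k * y); split.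
- by move/asboolP/kmin; rewrite ltnn.
- by exists (z ^+ k * a); rewrite ya mulrA; split=> //; apply: SM.
- move=> w; rewrite inE => /predU1P[->|ws]; first by rewrite mulrA -exprS.
  by rewrite mulrCA; apply: IM => //; apply: sy.
Qed.

End IdealSets.

(** * Noetherian local rings *)

Lemma nat_supP (A : set nat) n :
  nat_sup A = Some n <-> A n /\ forall k, A k -> (k <= n)%N.
Proof.
rewrite /nat_sup; split.
  by case: pselect => // h [<-]; case: (cid h).
move=> An; case: pselect => [h|[]]; last by exists n.
case: (cid h) => k /= [Ak kmax]; congr Some; apply/eqP.
by rewrite eqn_leq kmax ?An.2//; case: An.
Qed.

Section LocalRing.
Variables (R : comNzRingType) (m : idealr R).
Hypotheses (noethR : noetherian R) (locR : local_ring m).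

Lemma local_unit x : x \notin m -> exists y, y * x = 1.
Proof.
move=> xm; apply: contrapT => nu.
have [||p [xp _ pmax]] := @exists_prime R noethR [set 1] (principal x) erefl _
    (@principal_ideal R x) _.
- by move=> a b -> ->; rewrite mulr1.
- by move=> a [b ->] ab; apply: nu; exists b.
- have pmx : maximal_ideal p.
    move=> J pJ a aJ; apply: (pmax [set y | y \in J]) => //=; first exact: idealr_ideal.
    by move=> y yJ ye; rewrite ye idealr1 in yJ.
  move/negP: xm; apply; rewrite -(locR.2 _ pmx); apply: xp.
  by exists 1; rewrite mul1r.
Qed.

Lemma idealr_sub_max (p : idealr R) : {subset p <= m}.
Proof.
move=> x xp; apply: contraT => /local_unit[y yx].
by rewrite -(idealr1 p) -yx; apply: idealMr.
Qed.

Lemma one_sub_unit x : x \in m -> exists y, y * (1 - x) = 1.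
Proof.
move=> xm; apply: local_unit; apply: contraFN (idealr1 m) => x1.
by rewrite -(subrK x 1); apply: rpredD.
Qed.

Lemma max_prime : exists p : prime_idealr R, p =i m.
Proof.
have [||u v uv|p pm] := @ideal_prime R [set x | x \in m].
- exact: idealr_ideal.
- by rewrite /= idealr1.
- apply: contrapT => /not_orP[/= /negP um /negP vm].
  have [a au] := local_unit um; have [b bv] := local_unit vm.
  have e1 : 1 = a * b * (u * v) by rewrite mulrACA au bv mulr1.
  by have := idealr1 m; rewrite e1 idealMr.
by exists p => x; apply/idP/idP => /pm.
Qed.

Lemma maximal_eq (p : idealr R) : p =i m -> maximal_ideal p.
Proof. by move=> pm J _ x xJ; rewrite pm; apply: idealr_sub_max xJ. Qed.

(** Modulo an ideal in which every element of [m] is nilpotent, the ring is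
    Artinian: one descends to [I] by adjoining socle elements one at a time. *)
Lemma artinian_ind (P : set R -> Prop) I : ideal I ->
    (forall y, y \in m -> exists n, I (y ^+ n)) ->
    (forall J, ideal J -> J 1 -> P J) ->
    (forall J z, ideal J -> I `<=` J -> ~ J z -> (forall y, y \in m -> J (y * z)) ->
      P (adjoin J z) -> P J) -> P I.
Proof.
move=> iI nilI P1 Pz; apply: contrapT => nPI.
have [J [iJ nPJ IJ maxJ]] := @noetherian_max R noethR (fun J => ~ P J) I iI nPI.
have [s [sm mmin]] := noetherian_gen noethR (idealr_ideal m).
have [J0 JD JM] := iJ.
have [||||||z [Jz _ sz]] := @socle_element R setT J s 1 => //.
- by move=> a y _; apply: JM.
- by move=> J1; apply: nPJ; apply: P1.
- by move=> z /sm/nilI[n zn]; exists n; rewrite mulr1; apply: IJ.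
have mz : [set x | x \in m] `<=` [set y | J (y * z)].
  apply: mmin => //.
  split=> [|a b Ja Jb|a b Jb]; rewrite /= ?mul0r ?mulrDl //; first exact: JD.
  by rewrite -mulrA; apply: JM.
apply/nPJ/(Pz _ z) => //; apply: contrapT => nPz; apply: Jz.
exact: maxJ (adjoin_ideal z iJ) nPz (@sub_adjoin _ J z) _ (mem_adjoin z iJ).
Qed.

Lemma max_power_sub I : ideal I -> (forall y, y \in m -> exists n, I (y ^+ n)) ->
  exists n, forall x, x \in ideal_powS m n -> I x.
Proof.
move=> iI nilI; apply: (artinian_ind (P := fun I => exists n, forall x,
  x \in ideal_powS m n -> I x) iI nilI) => [J [_ _ JM] J1|J z iJ _ _ mz [n mn]].
  by exists 0%N => x _; rewrite -[x]mulr1; apply: JM.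
have [J0 JD JM] := iJ.
have cJ : submod_closed ([pred x | `[< J x >]] : {pred R^o}).
  split=> [|a u v /asboolP Ju /asboolP Jv]; apply/asboolP => //.
  by apply: JD => //; apply: JM.
exists n.+1 => x /asboolP/(_ (Submod cJ)) xJ; apply/asboolP/xJ.
move=> _ [a [b [am bm ->]]]; apply/asboolP.
have [y [c [Jy ->]]] := mn _ bm; rewrite mulrDr mulrCA.
by apply: JD; apply: JM => //; apply: mz.
Qed.

(** The power of [m] lying in an ideal maximal among those missing [x] is
    found by showing that every element of [m] is nilpotent modulo it. *)
Lemma krull_intersection x : (forall n, x \in ideal_powS m n) -> x = 0.
Proof.
move=> xm; apply: contrapT => x0.
have i0 : ideal [set 0 : R].
  by split=> [//|a b -> ->|a b ->]; rewrite ?addr0 ?mulr0.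
have [J [iJ Jx _ maxJ]] := @noetherian_max R noethR (fun J => ~ J x) _ i0 x0.
have [J0 JD JM] := iJ.
have ext z : ~ J z -> exists a, J (x - a * z).
  move=> Jz; apply: contrapT => na; apply: Jz; apply: (maxJ (adjoin J z)).
  - exact: adjoin_ideal.
  - by move=> [y [a [Jy xE]]]; apply: na; exists a; rewrite xE addrK.
  - exact: sub_adjoin.
  - exact: mem_adjoin.
have mx y : y \in m -> J (y * x).
  move=> ym; apply: contrapT => /ext[a Ja]; apply: Jx.
  have [u u1] : exists u, u * (1 - a * y) = 1 by apply/one_sub_unit/idealMr.
  rewrite -[x]mul1r -u1 (_ : _ * x = u * (x - a * (y * x))); last by ring.
  exact: JM.
have mnil y : y \in m -> exists n, J (y ^+ n).
  move=> ym; pose K n := [set r | J (y ^+ n * r)].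
  have iK n : ideal (K n).
    split=> [|a b Ka Kb|a b Kb]; rewrite /K /= ?mulr0 ?mulrDr //; first exact: JD.
    by rewrite mulrCA; apply: JM.
  have [_ [_ [N ->] _ maxK]] := @noetherian_max R noethR
    (fun I => exists n, I = K n) _ (iK 0%N) (ex_intro _ 0%N erefl).
  exists N; apply: contrapT => /ext[a Ja]; apply: Jx.
  have KNa : K N a.
    apply: (maxK (K N.+1)) => //; first by exists N.+1.
      by move=> r Kr; rewrite /K /= exprS -mulrA; apply: JM.
    have := idealB iJ (mx _ ym) (JM y _ Ja).
    by rewrite /K /= (_ : _ - _ = y ^+ N.+1 * a) // exprS; ring.
  by have := JD _ _ Ja KNa; rewrite [_ * a]mulrC subrK.
by have [n mn] := max_power_sub iJ mnil; apply/Jx/mn.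
Qed.

(** By Krull's intersection theorem the ring embeds into its completion. *)
Lemma completion_reduced : reduced (completion m) -> reduced R.
Proof.
move=> redC x n xn.
pose f : prod_mod m := fun k => \pi_({ideal_quot ideal_powS m k}) x.
have cf : f \in @compatible R m by apply/asboolP => k; exact: trans_pi.
pose F := Completion cf.
have Fk k j : completion_val (F ^+ k) j = (f j) ^+ k.
  elim: k => [//|k IH]; rewrite !exprS -IH //.
have F0 : F = 0.
  apply: (redC _ n); apply: val_inj; apply: functional_extensionality_dep => k.
  by rewrite [LHS]Fk /f -rmorphXn /= xn raddf0.
apply: krull_intersection => k; have := congr1 (fun g => completion_val g k) F0.
move=> /= /eqP; rewrite -[X in _ == X](raddf0 (\pi_({ideal_quot ideal_powS m k}))).
by rewrite /f -Quotient.idealrBE subr0.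
Qed.
End LocalRing.

(** * Reduced local rings of dimension one *)

Section DimensionOne.
Variables (R : comNzRingType) (m : idealr R).
Hypotheses (noethR : noetherian R) (locR : local_ring m).
Hypotheses (dimR : krull_dim R = Some 1%N) (redR : reduced R).

Lemma no_prime_chain2 (p q r : prime_idealr R) :
  {subset p <= q} -> ~ {subset q <= p} -> {subset q <= r} -> {subset r <= q}.
Proof.
move=> pq nqp qr; apply: contrapT => nrq.
have /nat_supP[_ max1] := dimR; suff: (2 <= 1)%N by []. apply: max1.
exists (fun i => if i is 0%N then p else if i is 1%N then q else r).
by case=> [|[|]].
Qed.

Lemma proper_prime (p : prime_idealr R) : ~ maximal_ideal p -> ~ {subset m <= p}.
Proof.
move=> pmax mp; apply: pmax; apply: (maximal_eq noethR locR) => x.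
by apply/idP/idP => [/(idealr_sub_max noethR locR)|/mp].
Qed.

(** A non-maximal prime [p] is minimal, and minimal primes of a reduced ring
    have a field as localization: otherwise the multiplicative set of the
    [t * a ^+ n] with [t] outside [p] would avoid [0] and a prime avoiding it
    would sit strictly below [p]. *)
Lemma nonmaximal_kill (p : prime_idealr R) a : ~ maximal_ideal p -> a \in p ->
  exists t, t \notin p /\ t * a = 0.
Proof.
move=> pmax ap; apply: contrapT => nt.
pose S := [set x | exists t n, t \notin p /\ x = t * a ^+ n].
have i0 : ideal [set 0 : R].
  by split=> [//|b c -> ->|b c ->]; rewrite ?addr0 ?mulr0.
have [||x ->|q [_ qS _]] := @exists_prime R noethR S [set 0] _ _ i0 _.
- by exists 1, 0%N; rewrite idealr1 mulr1.
- move=> _ _ [t [n [tp ->]]] [u [k [up ->]]]; exists (t * u), (n + k)%N.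
  by rewrite prime_idealrM negb_or tp up exprD mulrACA.
- move=> [t [n [tp ta]]]; apply: nt; exists t; split=> //.
  apply: (redR (n := n.+1)); rewrite exprMn exprS exprSr.
  by rewrite mulrACA -ta mul0r.
have qp : {subset q <= p}.
  move=> x xq; apply: contraT => xp; case: (qS x xq); exists x, 0%N.
  by rewrite mulr1.
have [r rm] := max_prime noethR locR.
have pq : ~ {subset p <= q}.
  move=> /(_ a ap) /qS; apply; exists 1, 1%N; by rewrite idealr1 mul1r.
case: (proper_prime pmax) => x xm; apply: (no_prime_chain2 qp pq (r := r)).
  by move=> y /(idealr_sub_max noethR locR); rewrite rm.
by rewrite rm.
Qed.

Lemma lreg_prime (p : prime_idealr R) x : GRing.lreg x -> x \in p -> p =i m.
Proof.
move=> regx xp; apply: locR.2; apply: contrapT => pmax.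
have [t [tp tx]] := nonmaximal_kill pmax xp; move: tp.
by rewrite (regx t 0) ?idealr0 // mulr0 mulrC.
Qed.

Lemma power_mem I y : ideal I -> y \in m ->
    (forall p : prime_idealr R, (forall x, I x -> x \in p) -> p =i m) ->
  exists n, I (y ^+ n).
Proof.
move=> iI ym Iprime; apply: contrapT => nI.
pose S := [set x | exists n, x = y ^+ n].
have [|||p [Ip pS _]] := @exists_prime R noethR S I _ _ iI _.
- by exists 0%N.
- by move=> _ _ [n ->] [k ->]; exists (n + k)%N; rewrite exprD.
- by move=> x Ix [n xE]; apply: nI; exists n; rewrite -xE.
by apply: (pS y); [rewrite Iprime | exists 1%N].
Qed.

Lemma lreg_power_mem I x y : ideal I -> I x -> GRing.lreg x -> y \in m ->
  exists n, I (y ^+ n).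
Proof. by move=> iI Ix regx ym; apply: power_mem => // p /(_ x Ix)/lreg_prime; apply. Qed.

Definition annih (I : set R) : set R := [set r | forall a, I a -> r * a = 0].

Lemma annih_ideal I : ideal (annih I).
Proof.
split=> [a _|r s rI sI a Ia|r s sI a Ia]; first by rewrite mul0r.
  by rewrite mulrDl rI // sI // addr0.
by rewrite -mulrA sI // mulr0.
Qed.

(** Among the elements of [m], pick one whose double annihilator is maximal:
    adding to it a nonzero element of its annihilator would enlarge it. *)
Lemma exists_lreg : exists x, x \in m /\ GRing.lreg x.
Proof.
pose D x := annih (annih [set x]).
have [_ [_ [x [xm ->]] _ maxD]] := @noetherian_max R noethR
  (fun I => exists x, x \in m /\ I = D x) _ (annih_ideal _)
  (ex_intro _ 0 (conj (idealr0 m) erefl)).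
suff kill u : u \in m -> u * x = 0 -> u = 0.
  have m1 : exists u, u \in m /\ u <> 0.
    have /nat_supP[[p /(_ 0%N isT)[p01 p10]] _] := dimR.
    apply: contrapT => nu; apply: p10 => u up; apply: contrapT => u0.
    apply: nu; exists u; split; first exact: idealr_sub_max noethR locR _ _ up.
    by move=> ue; apply: u0; rewrite ue idealr0.
  exists x; split=> //; apply: GRing.mulrI0_lreg => y; rewrite mulrC => yx.
  have [/kill/(_ yx) //|/(local_unit noethR locR)[z zy]] := boolP (y \in m).
  have x0 : x = 0 by rewrite -[x]mul1r -zy -mulrA yx mulr0.
  have [u [um u0]] := m1; case: u0; apply: kill => //.
  by rewrite x0 mulr0.
move=> um ux; have Dxu : D x `<=` D (x + u).
  move=> a Da r /(_ _ erefl) rxu; apply: Da => _ ->.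
  apply: (redR (n := 2)); rewrite expr2 (_ : _ * _ = r * x * (r * (x + u)) - r ^+ 2 * (u * x)).
    by rewrite rxu ux !mulr0 subr0.
  by ring.
have := maxD (D (x + u)) (annih_ideal _) _ Dxu (x + u) _ u.
rewrite mulrC mulrDr ux add0r => u2; apply: (redR (n := 2)).
rewrite expr2; apply: u2.
- by exists (x + u); split=> //; apply: rpredD.
- by move=> r /(_ _ erefl); rewrite mulrC.
- by move=> _ ->.
Qed.

End DimensionOne.

(** * The total ring of fractions and the determinant trick *)

Section Fractions.
Variable R : comNzRingType.
Local Notation K := (total_frac R).
Local Notation iota := (to_total R).

Lemma to_total_inj : injective iota.
Proof.
move=> a b /mkfracP[u]; rewrite /GRing.scale /= !mulr1.
by have /asboolP := denomP u; apply.
Qed.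

Lemma total_fracP (q : K) : exists s a, GRing.lreg s /\ iota s * q = iota a.
Proof.
elim/fracW: q => a s; exists (denom_val s), a; split; first by have /asboolP := denomP s.
apply: etrans (fracR_mulE _ _ _ _) _; apply/mkfracP; exists (denom1 (nonzerodiv R)).
by rewrite /GRing.scale /= !mul1r.
Qed.

Lemma to_total_unit s : GRing.lreg s -> exists u, u * iota s = 1.
Proof.
move=> regs; have sS : s \in mulset_pred (nonzerodiv R) by apply/asboolP.
exists (mkfrac (nonzerodiv R) (1 : R^o) (Denom sS)).
apply: etrans (fracR_mulE _ _ _ _) _; apply/mkfracP; exists (denom1 (nonzerodiv R)).
by rewrite /GRing.scale /= !mul1r !mulr1.
Qed.

Lemma to_total_mulI s : GRing.lreg s -> injective ( *%R (iota s)).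
Proof.
move=> /to_total_unit[u us] a b ab; rewrite -[a]mul1r -[b]mul1r -us.
by rewrite -!mulrA ab.
Qed.

(** The determinant trick: multiplication by [v] on a module spanned by [n]
    elements is a root of the characteristic polynomial of its matrix. *)
Lemma integral_of_stable n (g : 'I_n -> K) (v : K) (c : 'I_n -> K) :
    (forall i, exists a : 'I_n -> R, v * g i = \sum_j iota (a j) * g j) ->
    \sum_j c j * g j = 1 ->
  exists p : {poly R}, [/\ p \is monic, size p = n.+1 & root (map_poly iota p) v].
Proof.
move=> /fin_all_exists[a va] cg.
pose A := \matrix_(i, j) a i j; exists (char_poly A).
split; [exact: char_poly_monic | exact: size_char_poly|].
pose B := v%:M - map_mx iota A; pose G := \col_i g i.
have BG : B *m G = 0.
  apply/colP => i; rewrite mulmxBl mul_scalar_mx !mxE va; apply/eqP.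
  by rewrite subr_eq0; apply/eqP/eq_bigr => j _; rewrite !mxE.
have dB i : \det B * g i = 0.
  have /colP/(_ i) : (\adj B *m B) *m G = 0 by rewrite -mulmxA BG mulmx0.
  by rewrite mul_adj_mx mul_scalar_mx !mxE.
have : \det B = 0.
  rewrite -[\det B]mulr1 -cg mulr_sumr big1 // => i _.
  by rewrite mulrCA dB mulr0.
rewrite rootE -horner_evalE => /eqP; rewrite -2!det_map_mx; congr (\det _ == 0).
rewrite raddfB/= map_scalar_mx; apply/matrixP=> i j.
by rewrite !mxE raddfB raddfMn/= map_polyX map_polyC /horner_eval !hornerE.
Qed.

Lemma integral_relation (p : {poly R}) v d : p \is monic -> size p = d.+1 ->
    root (map_poly iota p) v ->
  exists a : 'I_d -> R, v ^+ d = \sum_(i < d) iota (a i) * v ^+ i.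
Proof.
move=> mp sp /eqP pv; exists (fun i => - p`_i); move: pv.
rewrite horner_coef size_map_poly_id0 ?sp; last first.
  by rewrite (monicP mp) rmorph1 oner_neq0.
rewrite big_ord_recr /= !coef_map /= -[d in p`_d]/(d.+1.-1) -sp -lead_coefE (monicP mp).
rewrite rmorph1 mul1r addrC => /eqP; rewrite addr_eq0 => /eqP ->.
by rewrite -sumrN; apply: eq_bigr => i _; rewrite coef_map rmorphN mulNr.
Qed.
End Fractions.

Section StableIdeal.
Variable R : comNzRingType.
Local Notation iota := (to_total R).

Lemma gen_comb (b : set R) s a :
    (forall J, ideal J -> (forall z, z \in s -> J z) -> b `<=` J) -> b a ->
  exists c : 'I_(size s) -> R, a = \sum_i c i * s`_i.
Proof.
move=> gs ba; apply: (gs [set a | exists c : 'I_(size s) -> R, a = \sum_i c i * s`_i])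
  => {a ba} // [|z /(nthP 0)[i si <-]].
  split=> [|a a' [c ->] [c' ->]|a a' [c ->]].
  - by exists (fun=> 0); rewrite big1 // => i _; rewrite mul0r.
  - exists (fun i => c i + c' i); rewrite -big_split; apply: eq_bigr => i _.
    by rewrite mulrDl.
  - exists (fun i => a * c i); rewrite mulr_sumr; apply: eq_bigr => i _.
    by rewrite mulrA.
exists (fun j => (j == Ordinal si)%:R); rewrite (bigD1 (Ordinal si)) //= eqxx.
by rewrite mul1r big1 ?addr0 // => j /negPf ->; rewrite mul0r.
Qed.

Lemma integral_of_stable_ideal (b : set R) s v a : (forall z, z \in s -> b z) ->
    (forall J, ideal J -> (forall z, z \in s -> J z) -> b `<=` J) ->
    (forall z, b z -> exists2 z', b z' & v * iota z = iota z') ->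
    b a -> GRing.lreg a ->
  exists p : {poly R}, [/\ p \is monic, size p = (size s).+1 & root (map_poly iota p) v].
Proof.
move=> sb gs vb ba rega; have [u ua] := to_total_unit rega.
have [c ac] := gen_comb gs ba.
apply: (@integral_of_stable _ _ (fun i => iota s`_i) v (fun i => u * iota (c i))) => [i|].
  have [z' bz' vz] := vb _ (sb _ (mem_nth 0 (ltn_ord i))).
  have [d z'E] := gen_comb gs bz'; exists d; rewrite vz z'E rmorph_sum.
  by apply: eq_bigr => j _; rewrite rmorphM.
rewrite -ua ac rmorph_sum mulr_sumr; apply: eq_bigr => i _.
by rewrite rmorphM mulrA.
Qed.
End StableIdeal.

Section IntegralClosure.
Variable R : comNzRingType.
Local Notation iota := (to_total R).
Local Notation V := (integral_closure R).

Lemma iclD u v : V u -> V v -> V (u + v).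
Proof. exact: integral_add. Qed.
Lemma iclM u v : V u -> V v -> V (u * v).
Proof. exact: integral_mul. Qed.
Lemma iclB u v : V u -> V v -> V (u - v).
Proof. exact: integral_sub. Qed.
Lemma icl_to_total a : V (iota a).
Proof. exact: integral_id. Qed.
Lemma icl0 : V 0.
Proof. exact: integral0. Qed.
Lemma icl1 : V 1.
Proof. exact: integral1. Qed.
Lemma icl_sum (T : finType) (F : T -> total_frac R) :
  (forall i, V (F i)) -> V (\sum_i F i).
Proof.
move=> VF; apply: big_ind; [exact: icl0 | exact: iclD |].
by move=> i _; exact: VF.
Qed.
End IntegralClosure.

(** * Chains of ideals and length *)

Section Length.
Variable R : comNzRingType.
Implicit Types A B C I : set R.

Inductive chain B : set R -> nat -> Prop :=
| chain_nil : ideal B -> chain B B 0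
| chain_cons A A' n : chain B A n -> ideal A' -> A `<=` A' -> ~ A' `<=` A ->
    chain B A' n.+1.

Definition bounded B A n := forall k, chain B A k -> (k <= n)%N.

Lemma chain_ideal B A n : chain B A n -> [/\ ideal B, ideal A & B `<=` A].
Proof.
elim=> [//|{}A A' k _ [iB iA BA] iA' AA' _]; split=> //; exact: subset_trans AA'.
Qed.

Lemma chain_cat B A C n k : chain B A n -> chain A C k -> chain B C (n + k).
Proof.
move=> cBA; elim=> [_|D D' l _ IH iD' DD' D'D]; first by rewrite addn0.
by rewrite addnS; apply: chain_cons IH _ _ _.
Qed.

Lemma chain_exists B A : ideal B -> ideal A -> B `<=` A -> exists n, chain B A n.
Proof.
move=> iB iA BA; have [AB|nAB] := pselect (A `<=` B).
  by exists 0%N; rewrite (_ : A = B); [exact: chain_nil | exact/seteqP].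
by exists 1%N; apply: chain_cons BA nAB => //; exact: chain_nil.
Qed.

Definition isum A I : set R := [set x | exists a b, [/\ A a, I b & x = a + b]].

Lemma isum_ideal A I : ideal A -> ideal I -> ideal (isum A I).
Proof.
move=> [A0 AD AM] [I0 ID IM]; split.
- by exists 0, 0; rewrite addr0.
- move=> _ _ [a [b [Aa Ib ->]]] [c [d [Ac Id ->]]]; exists (a + c), (b + d).
  by split; [exact: AD | exact: ID | exact: addrACA].
- move=> r _ [a [b [Aa Ib ->]]]; exists (r * a), (r * b).
  by split; [exact: AM | exact: IM | exact: mulrDr].
Qed.

Lemma setI_ideal A I : ideal A -> ideal I -> ideal (A `&` I).
Proof.
move=> [A0 AD AM] [I0 ID IM]; split=> // [x y [Ax Ix] [Ay Iy]|a x [Ax Ix]].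
  by split; [exact: AD | exact: ID].
by split; [exact: AM | exact: IM].
Qed.

(** The modular law: each strict step of a chain stays strict either in the
    intersection with [I] or in the sum with [I]. *)
Lemma chain_split B A I n : chain B A n -> ideal I -> B `<=` I ->
  exists k l, [/\ chain B (A `&` I) k, chain I (isum A I) l & (n <= k + l)%N].
Proof.
move=> cBA iI BI; elim: cBA => [iB|{}A A' {}n cBA [k [l [ck cl nkl]]] iA' AA' A'A].
  exists 0%N, 0%N; split=> //.
    by rewrite (_ : B `&` I = B); [exact: chain_nil | exact: setIidl].
  rewrite (_ : isum B I = I); first exact: chain_nil.
  apply/seteqP; split=> [_ [a [b [Ba Ib ->]]]|b Ib].
    by have [_ ID _] := iI; apply: ID => //; apply: BI.
  by exists 0, b; rewrite add0r; split=> //; have [] := iB.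
have [iB iA BA] := chain_ideal cBA.
have sI : A `&` I `<=` A' `&` I by move=> x [/AA']; split.
have sS : isum A I `<=` isum A' I.
  by move=> _ [a [b [/AA' Aa Ib ->]]]; exists a, b.
have iI' : ideal (A' `&` I) by exact: setI_ideal.
have iS' : ideal (isum A' I) by exact: isum_ideal.
have [eI|nI] := pselect (A' `&` I `<=` A `&` I); last first.
  have ck' : chain B (A' `&` I) k.+1 by exact: chain_cons sI nI.
  have [j cj] : exists j, chain I (isum A' I) (l + j).
    have [] := chain_ideal cl => _ iS _.
    have [j cj] := chain_exists iS iS' sS; exists j; exact: chain_cat cj.
  exists k.+1, (l + j)%N; split=> //.
  by rewrite addnA addSn ltnS (leq_trans nkl) ?leq_addr.
have nS : ~ isum A' I `<=` isum A I.
  move=> eS; apply: A'A => x A'x.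
  have /eS [a [b [Aa Ib xE]]] : isum A' I x.
    by exists x, 0; rewrite addr0; split=> //; have [] := iI.
  rewrite xE; have [_ AD _] := iA; apply: AD => //.
  suff /eI[] : (A' `&` I) b by [].
  split=> //; have -> : b = x - a by rewrite xE addrAC subrr add0r.
  exact: (idealB iA' A'x (AA' _ Aa)).
exists k, l.+1; split; [|exact: chain_cons sS nS|by rewrite addnS ltnS].
by rewrite (_ : A' `&` I = A `&` I) //; apply/seteqP.
Qed.

Lemma bounded_cat B I A n k : ideal I -> B `<=` I -> I `<=` A ->
  bounded B I n -> bounded I A k -> bounded B A (n + k).
Proof.
move=> iI BI IA bn bk l cBA; have [_ [_ AD _] _] := chain_ideal cBA.
have [i [j [ci cj lij]]] := chain_split cBA iI BI.
rewrite (setIidr IA) in ci; apply: leq_trans lij (leq_add (bn _ ci) _).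
apply: bk; rewrite (_ : A = isum A I) //; apply/seteqP; split=> [x Ax|].
  by exists x, 0; rewrite addr0; split=> //; have [] := iI.
by move=> _ [a [b [Aa /IA Ab ->]]]; exact: AD.
Qed.

Lemma bounded_simple B A :
    (forall D, ideal D -> B `<=` D -> D `<=` A -> D `<=` B \/ A `<=` D) ->
  bounded B A 1.
Proof.
move=> simpBA k cBA; case: cBA simpBA => // {k A} D A n cBD iA DA AD simpBA.
have [iB iD BD] := chain_ideal cBD; have [DB|//] := simpBA _ iD BD DA.
case: cBD {DA AD iD BD simpBA} DB => // {n D} D D' n cBD _ DD' D'D D'B.
by case: D'D; apply: subset_trans D'B _; have [] := chain_ideal cBD.
Qed.

Definition dilate (x : R) A : set R := [set y | exists2 a, A a & y = x * a].

Lemma dilate_ideal x A : ideal A -> ideal (dilate x A).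
Proof.
case=> A0 AD AM; split; first by exists 0; rewrite ?mulr0.
  by move=> _ _ [a Aa ->] [b Ab ->]; exists (a + b); [exact: AD | rewrite mulrDr].
by move=> r _ [a Aa ->]; exists (r * a); [exact: AM | rewrite mulrCA].
Qed.

Lemma dilate_sub x A : ideal A -> dilate x A `<=` A.
Proof. by case=> _ _ AM _ [a Aa ->]; apply: AM. Qed.

Lemma chain_undilate x B A n : chain B A n -> A `<=` principal x ->
  chain [set a | B (x * a)] [set a | A (x * a)] n.
Proof.
have ipre C : ideal C -> ideal [set a | C (x * a)].
  case=> C0 CD CM; split=> [|a b Ca Cb|a b Cb] /=; first by rewrite mulr0.
    by rewrite mulrDr; apply: CD.
  by rewrite mulrCA; apply: CM.
elim=> [iB _|{}A A' k _ IH iA' AA' A'A A'x]; first exact/chain_nil/ipre.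
apply: chain_cons (IH _) (ipre _ iA') _ _; first exact: subset_trans A'x.
  by move=> a; apply: AA'.
move=> A'Ax; apply: A'A => y A'y; have [a ya] := A'x _ A'y.
by move: A'y; rewrite ya mulrC; apply: A'Ax.
Qed.

Lemma bounded_dilate x B A n : GRing.lreg x -> bounded B A n ->
  bounded (dilate x B) (dilate x A) n.
Proof.
move=> regx bn k /chain_undilate ck.
have pre C : [set a | dilate x C (x * a)] = C.
  by apply/seteqP; split=> [a [b Cb /regx ->]//|a Ca]; exists a.
by apply: bn; rewrite -(pre B) -(pre A); apply: ck => _ [a _ ->]; exists a; rewrite mulrC.
Qed.

Lemma setT_ideal : ideal ([set: R]). Proof. by []. Qed.

Lemma descending_stationary I n (C : nat -> set R) :
    ideal I -> bounded I setT n -> (forall k, ideal (C k)) ->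
    (forall k, I `<=` C k) -> (forall k, C k.+1 `<=` C k) ->
  exists n0, forall k, (n0 <= k)%N -> C n0 `<=` C k.
Proof.
move=> iI bI iC IC CS; apply: contrapT => nst.
have Cle i j : (i <= j)%N -> C j `<=` C i.
  move=> /subnK <-; elim: (j - i)%N => // l IH.
  exact: subset_trans (CS _) IH.
have drop i : exists j, (i <= j)%N /\ ~ C i `<=` C j.
  apply: contrapT => nd; apply: nst; exists i => j ij; apply: contrapT => nC.
  by apply: nd; exists j.
have long l : exists j, chain (C j) (C 0%N) l.
  elim: l => [|l [j cj]]; first by exists 0%N; exact: chain_nil.
  have [k [jk nC]] := drop j; exists k; rewrite -add1n; apply: chain_cat cj.
  apply: chain_cons (Cle _ _ jk) nC => //; exact: chain_nil.
have [j cj] := long n.+1.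
have [a ca] := chain_exists iI (iC j) (IC j).
have [b cb] := chain_exists (iC 0%N) setT_ideal (@subsetT _ _).
have := bI _ (chain_cat (chain_cat ca cj) cb).
by rewrite leqNgt addnS addSn ltnS -addnA addnCA leq_addr.
Qed.

End Length.

Section Colength.
Variables (R : comNzRingType) (m : idealr R).
Hypotheses (noethR : noetherian R) (locR : local_ring m).

(** Each socle element adjoined in [artinian_ind] adds one to the length. *)
Lemma finite_colength (I : set R) : ideal I ->
  (forall y, y \in m -> exists n, I (y ^+ n)) -> exists n, bounded I setT n.
Proof.
move=> iI nilI; apply: (artinian_ind noethR (P := fun I => exists n, bounded I setT n) iI nilI).
  move=> J [_ _ JM] J1; exists 0%N => k; case=> // A A' l cJA _ _; case.
  by have [_ _ JA] := chain_ideal cJA => x _; apply: JA; rewrite -[x]mulr1; apply: JM.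
move=> J z iJ IJ Jz mz [n bn]; exists (1 + n)%N; have [_ JD JM] := iJ.
apply: bounded_cat bn; [exact: adjoin_ideal|exact: sub_adjoin|exact: subsetT|].
apply: bounded_simple => D iD JD' DJz; have [DJ|nDJ] := pselect (D `<=` J); [by left|right].
have [_ DD DM] := iD; suff Dz : D z.
  by move=> _ [y [a [Jy ->]]]; apply: DD; [exact: JD' | exact: DM].
apply: contrapT => nDz; apply: nDJ => w Dw.
have [y [b [Jy wE]]] := DJz _ Dw; rewrite wE.
have [/mz Jbz|/(local_unit noethR locR)[c cb]] := boolP (b \in m); first exact: JD.
case: nDz; rewrite -[z]mul1r -cb -mulrA; apply: DM.
by rewrite -[b * z](addKr y) -wE addrC; apply: idealB Dw (JD' _ Jy).
Qed.

(** The length of [b / x b] equals that of [R / x R] because [R / b] and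
    [x R / x b] have the same finite length; a minimal generating sequence of
    [b] gives a chain from [x b] to [b], so it cannot be longer. *)
Lemma few_generators x e (b : set R) : x \in m -> GRing.lreg x ->
    bounded (principal x) setT e -> ideal b -> (exists n, bounded b setT n) ->
  exists s : seq R, [/\ (size s <= e)%N, forall z, z \in s -> b z &
    forall J, ideal J -> (forall z, z \in s -> J z) -> b `<=` J].
Proof.
move=> xm regx be ib [n bn]; have [_ bD bM] := ib.
pose gens (s : seq R) := (forall z, z \in s -> b z) /\
    forall J, ideal J -> (forall z, z \in s -> J z) -> b `<=` J.
have exs : exists n, `[< exists s, size s = n /\ gens s >].
  have [s gs] := noetherian_gen noethR ib; exists (size s); apply/asboolP.
  by exists s.
have := ex_minnP exs; case=> r /asboolP[s [ss [sb gs]]] rmin.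
exists s; split=> //; rewrite ss.
have [t ct bt] : exists2 t, chain b setT t & bounded b setT t.
  have ext : exists t, `[< chain b setT t >].
    have [t ct] := chain_exists ib (@setT_ideal R) (@subsetT _ _).
    by exists t; apply/asboolP.
  have bdt t : `[< chain b setT t >] -> (t <= n)%N by move=> /asboolP/bn.
  have := ex_maxnP ext bdt; case=> t /asboolP ct tmax; exists t => // k ck.
  by apply: tmax; apply/asboolP.
suff cs : chain (dilate x b) b r.
  have bxb : bounded (dilate x b) setT (t + e).
    apply: bounded_cat (bounded_dilate regx bt) _.
    - exact: dilate_ideal.
    - by move=> _ [a _ ->]; exists a.
    - exact: subsetT.
    - rewrite (_ : dilate x setT = principal x) //.
      by apply/seteqP; split=> [_ [a _ ->]|_ [a ->]]; exists a; rewrite // mulrC.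
  by have := bxb _ (chain_cat cs ct); rewrite addnC leq_add2l.
pose C s1 := foldl (@adjoin R) (dilate x b) s1.
have step s1 : (exists s2, s = s1 ++ s2) ->
    [/\ chain (dilate x b) (C s1) (size s1), C s1 `<=` b, forall z, z \in s1 -> C s1 z
      & forall J, ideal J -> (forall z, z \in s1 -> J z) -> C s1 `<=` isum (dilate x b) J].
  elim/last_ind: s1 => [_|s1 z IH [s2 sE]].
    split=> //; [exact/chain_nil/dilate_ideal | exact: dilate_sub|].
    by move=> J [J0 _ _] _ y Cy; exists y, 0; rewrite addr0.
  have [|c1 C1b sC1 C1s] := IH; first by exists (z :: s2); rewrite sE cat_rcons.
  have CE : C (rcons s1 z) = adjoin (C s1) z by rewrite /C foldl_rcons.
  have [_ iC1 _] := chain_ideal c1.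
  have zs : z \in s by rewrite sE mem_cat mem_rcons inE eqxx.
  rewrite CE size_rcons; split.
  - apply: chain_cons c1 (adjoin_ideal z iC1) (@sub_adjoin _ _ _) _ => Cz.
    suff: (r <= size (s1 ++ s2))%N by rewrite -ss sE cat_rcons !size_cat /= addnS ltnn.
    apply: rmin; apply/asboolP; exists (s1 ++ s2); split=> //; split=> [w ws|J iJ sJ].
      by apply: sb; rewrite sE cat_rcons mem_cat inE orbCA -mem_cat ws orbT.
    apply: (gs J iJ) => w; rewrite sE cat_rcons mem_cat inE orbCA -mem_cat.
    case/predU1P=> [->|]; last exact: sJ.
    have [_ [j [[a ba ->] Jj zE]]] : isum (dilate x b) J z.
      apply: C1s => // [v vs|]; first by apply: sJ; rewrite mem_cat vs.
      exact/Cz/mem_adjoin.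
    have [j' [c [Jj' aE]]] : adjoin J z a.
      apply: gs ba; first exact: adjoin_ideal.
      move=> v; rewrite sE cat_rcons mem_cat inE orbCA -mem_cat.
      case/predU1P=> [->|/sJ]; [exact: mem_adjoin | exact: sub_adjoin].
    have [u u1] : exists u, u * (1 - c * x) = 1.
      by apply: (one_sub_unit noethR locR); apply: idealMr.
    have [_ JD JM] := iJ; rewrite -[z]mul1r -u1 -mulrA; apply: (JM).
    rewrite (_ : _ * z = x * j' + j); first by apply: JD => //; apply: JM.
    by rewrite mulrBl mul1r {1}zE aE; ring.
  - move=> _ [y [a [Cy ->]]]; apply: bD; first exact: C1b.
    exact/bM/sb.
  - move=> w; rewrite mem_rcons inE => /predU1P[->|/sC1]; first exact: mem_adjoin.
    exact: sub_adjoin.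
  - move=> J iJ sJ _ [y [a [Cy ->]]]; have [_ JD JM] := iJ.
    have [|d [j [xd Jj ->]]] := C1s J iJ _ y Cy.
      by move=> w ws; apply: sJ; rewrite mem_rcons inE ws orbT.
    exists d, (j + a * z); split=> //; last by rewrite addrA.
    by apply: JD => //; apply: JM; apply: sJ; rewrite mem_rcons mem_head.
have [|cs Csb sCs _] := step s; first by exists [::]; rewrite cats0.
have [_ iCs _] := chain_ideal cs.
have Cb : C s = b by apply/seteqP; split=> //; apply: gs.
by rewrite Cb ss in cs.
Qed.
End Colength.

(** * The integral closure is a fractional ideal *)

Section Finiteness.
Variables (R : comNzRingType) (m : idealr R).
Hypotheses (noethR : noetherian R) (locR : local_ring m).
Hypotheses (dimR : krull_dim R = Some 1%N) (redR : reduced R).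
Variable x : R.
Hypotheses (xm : x \in m) (regx : GRing.lreg x).
Local Notation K := (total_frac R).
Local Notation iota := (to_total R).
Local Notation V := (integral_closure R).

(** Powers of [x] are universal denominators, as [x] is nilpotent modulo every
    regular element. *)
Lemma power_denominator (q : K) : exists n a, iota (x ^+ n) * q = iota a.
Proof.
have [s [a [regs sq]]] := total_fracP q.
have [n [b xn]] := lreg_power_mem noethR locR dimR redR (principal_ideal s)
  (ex_intro _ 1 (esym (mul1r s))) regs xm.
by exists n, (b * a); rewrite xn rmorphM -mulrA sq -rmorphM.
Qed.

Lemma power_denominatorW k n (q : K) : (k <= n)%N ->
  (exists a, iota (x ^+ k) * q = iota a) -> exists a, iota (x ^+ n) * q = iota a.
Proof.
move=> /subnK <- [a xa]; exists (x ^+ (n - k) * a).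
by rewrite exprD rmorphM -mulrA xa -rmorphM.
Qed.

Lemma common_denominator (T : finType) (q : T -> K) :
  exists N, forall i, exists a, iota (x ^+ N) * q i = iota a.
Proof.
have /fin_all_exists[N xN] i := power_denominator (q i).
exists (\max_i N i)%N => i; apply: power_denominatorW (xN i).
exact: leq_bigmax.
Qed.

Lemma power_sum_denominator (v : K) : V v ->
  exists N, forall p : {poly R}, exists a, iota (x ^+ N) * (map_poly iota p).[v] = iota a.
Proof.
move=> [p mp pv].
have [a va] : exists a : 'I_(size p).-1 -> R,
    v ^+ (size p).-1 = \sum_i iota (a i) * v ^+ i.
  by apply: integral_relation pv => //; rewrite polySpred ?monic_neq0.
have [N xN] := common_denominator (fun i : 'I_(size p).-1 => v ^+ i).
have sumR (n : nat) (c : 'I_n -> R) (w : 'I_n -> K) :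
    (forall i, exists a, iota (x ^+ N) * w i = iota a) ->
  exists a, iota (x ^+ N) * (\sum_i iota (c i) * w i) = iota a.
  move=> /fin_all_exists[b wb]; exists (\sum_i c i * b i).
  rewrite mulr_sumr rmorph_sum; apply: eq_bigr => i _.
  by rewrite mulrCA wb -rmorphM.
have xNk k : exists a, iota (x ^+ N) * v ^+ k = iota a.
  elim/ltn_ind: k => k IH; have [kd|dk] := ltnP k (size p).-1; first exact: xN (Ordinal kd).
  rewrite -(subnK dk) exprD va mulr_sumr.
  under eq_bigr do rewrite mulrCA -exprD.
  apply: sumR => i; apply: IH; rewrite -[X in (_ < X)%N](subnK dk).
  by rewrite ltn_add2l.
exists N => q; rewrite horner_coef; under eq_bigr do rewrite coef_map.
exact: sumR.
Qed.

(** [R[v]] is a fractional ideal, hence spanned by at most [e] elements. *)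
Lemma uniform_degree e v : bounded (principal x) setT e -> V v ->
  exists p : {poly R}, [/\ p \is monic, size p = e.+1 & root (map_poly iota p) v].
Proof.
move=> be Vv; have [N xN] := power_sum_denominator Vv.
pose b : set R := [set a | exists p, iota (x ^+ N) * (map_poly iota p).[v] = iota a].
have ib : ideal b.
  split=> [|a c [p pa] [q qc]|a c [p pc]].
  - by exists 0; rewrite rmorph0 horner0 mulr0 rmorph0.
  - by exists (p + q); rewrite rmorphD hornerD mulrDr pa qc rmorphD.
  - by exists (a *: p); rewrite map_polyZ hornerZ mulrCA pc rmorphM.
have bx : b (x ^+ N) by exists 1; rewrite rmorph1 hornerC mulr1.
have fb : exists n, bounded b setT n.
  apply: (finite_colength noethR locR ib) => y ym.
  apply: (lreg_power_mem noethR locR dimR redR ib bx) ym.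
  exact: GRing.lregX.
have [s [se sb gs]] := few_generators noethR locR xm regx be ib fb.
have [||p [mp sp pv]] := integral_of_stable_ideal (v := v) sb gs _ bx.
- move=> a [p pa]; have [a' xa] := xN ('X * p).
  exists a'; first by exists ('X * p).
  by rewrite -pa mulrCA -xa rmorphM /= map_polyX hornerM hornerX.
- exact: GRing.lregX.
exists (p * 'X^(e - size s)); split.
- by rewrite monicMl ?monicXn.
- by rewrite size_monicM ?monicXn -?size_poly_eq0 ?size_polyXn // sp addnS /= addSn subnKC.
- apply/rootP; rewrite rmorphM hornerM (rootP pv); exact: mul0r.
Qed.

(** In a monic relation of degree [e] for [v], multiplied by [x ^+ (n * e)], every
    term but the leading one is divisible by [x ^+ n].  What matters is that [e]
    depends neither on [v] nor on [n]. *)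
Lemma power_divisible e b n v : (0 < e)%N -> bounded (principal x) setT e -> V v ->
  iota b = iota (x ^+ n) * v -> principal (x ^+ n) (b ^+ e).
Proof.
move=> e0 be Vv bv; have [p [mp sp pv]] := uniform_degree be Vv.
have [a va] := integral_relation mp sp pv.
have bei (i : 'I_e) : exists c, iota (x ^+ n) ^+ e * v ^+ i = iota (x ^+ n * c).
  exists (x ^+ n ^+ (e - i).-1 * b ^+ i).
  rewrite 2!rmorphM [iota (_ ^+ _ ^+ _)]rmorphXn [iota (b ^+ i)]rmorphXn /= bv.
  rewrite exprMn !mulrA -exprS prednK ?subn_gt0 // -exprD subnK //.
  exact: ltnW.
have /fin_all_exists[c bc] := bei.
exists (\sum_i a i * c i); apply: to_total_inj.
rewrite rmorphXn /= bv exprMn va mulr_sumr mulr_suml rmorph_sum.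
apply: eq_bigr => i _; rewrite mulrCA bc -rmorphM; congr (iota _); ring.
Qed.

(** Were the integral closure contained in no [x ^- k R], the ideals
    [x ^+ n * V `&` R] would all leave [x R].  As they are stationary modulo
    each power of [x], one could pick in them a sequence converging to a
    nonzero element of the completion, and its [e]-th power would vanish. *)
Lemma integral_closure_bounded : reduced (completion m) ->
  exists k, forall v, V v -> exists a, iota (x ^+ k) * v = iota a.
Proof.
move=> redC; apply: contrapT => unb.
have nilx n y : y \in m -> exists k, principal (x ^+ n) (y ^+ k).
  apply: (lreg_power_mem noethR locR dimR redR (principal_ideal _)).
    by exists 1; rewrite mul1r.
  exact: GRing.lregX.
have colen n := finite_colength noethR locR (principal_ideal (x ^+ n)) (nilx n).
have [e [e0 be]] : exists e, (0 < e)%N /\ bounded (principal x) setT e.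
  have [e be] := colen 1%N; exists e.+1; split=> // k /be ke; exact: leqW.
pose I n : set R := [set b | exists v, V v /\ iota b = iota (x ^+ n) * v].
have iI n : ideal (I n).
  split=> [|b c [v [Vv bv]] [w [Vw cw]]|a b [v [Vv bv]]].
  - by exists 0; split; [exact: icl0 | rewrite mulr0 rmorph0].
  - by exists (v + w); split; [exact: iclD | rewrite mulrDr -bv -cw rmorphD].
  - exists (iota a * v); split; last by rewrite mulrCA -bv rmorphM.
    by apply: iclM Vv; exact: icl_to_total.
have Ile k n : (k <= n)%N -> I n `<=` I k.
  move=> kn b [v [Vv bv]]; exists (iota (x ^+ (n - k)) * v); split.
    by apply: iclM Vv; exact: icl_to_total.
  by rewrite bv mulrA -rmorphM -exprD subnKC.
have nI n : ~ I n `<=` principal x.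
  move=> In; apply: unb; exists n => v Vv; apply: contrapT => nv.
  have exN : exists N, `[< exists a, iota (x ^+ N) * v = iota a >].
    by have [N [a xa]] := power_denominator v; exists N; apply/asboolP; exists a.
  have := ex_minnP exN; case=> -[|N] /asboolP[a xa] Nmin.
    by apply: nv; apply: power_denominatorW (ex_intro _ a xa).
  have nN : (n <= N.+1)%N.
    rewrite leqNgt; apply/negP => Nn; apply: nv.
    exact: power_denominatorW (ltnW Nn) (ex_intro _ a xa).
  have [|c ac] := In a; first by apply: (Ile _ _ nN); exists v.
  have /Nmin : `[< exists a, iota (x ^+ N) * v = iota a >].
    apply/asboolP; exists c; apply: (to_total_mulI regx).
    by rewrite mulrA -!rmorphM -exprS xa ac mulrC.
  by rewrite ltnn.
pose J i k : set R := isum (I k) (principal (x ^+ i)).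
have iJ i k : ideal (J i k) by apply: isum_ideal => //; exact: principal_ideal.
have /choice[st stP] i : exists n0, forall k, (n0 <= k)%N -> J i n0 `<=` J i k.
  have [n bn] := colen i.
  apply: (descending_stationary (principal_ideal (x ^+ i)) bn (iJ i)).
    by move=> k a xa; exists 0, a; rewrite add0r; split=> //; have [] := iI k.
  by move=> k _ [a [c [/(Ile _ _ (leqnSn k)) Ia xc ->]]]; exists a, c.
(* Cut-off large enough for [I] to be stationary modulo [x ^+ i]. *)
pose ht i := maxn i (\max_(j < i.+1) st j)%N.
have ht_st i : (st i <= ht i)%N.
  by rewrite leq_max (bigmax_sup (inord i)) ?inordK ?orbT.
have ht_i i : (i <= ht i)%N by exact: leq_maxl.
have htS i : (ht i <= ht i.+1)%N.
  rewrite geq_max (leq_trans (leqnSn i)) //=; apply/bigmax_leqP => j _.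
  rewrite leq_max; apply/orP; right.
  exact: (bigmax_sup (widen_ord (leqnSn i.+1) j)).
have next i b : exists c, I (ht i) b -> I (ht i.+1) c /\ principal (x ^+ i) (c - b).
  have [Ib|nIb] := pselect (I (ht i) b); last by exists 0.
  have [c [d [Ic [r dr] bE]]] : J i (ht i.+1) b.
    apply: (stP i); first exact: leq_trans (ht_st i) (htS i).
    have [c [d [Ic xd ->]]] : J i (ht i) b.
      by exists b, 0; rewrite addr0; split=> //; have [] := principal_ideal (x ^+ i).
    by exists c, d; split=> //; apply: Ile Ic; exact: ht_st.
  exists c => _; split=> //; exists (- r); rewrite bE dr; ring.
have [b0 Ib0 xb0] : exists2 b0, I (ht 1%N) b0 & ~ principal x b0.
  apply: contrapT => nb; apply: (nI (ht 1%N)) => b Ib; apply: contrapT => xb.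
  by apply: nb; exists b.
have /choice[nx nxP] (ib : nat * R) : exists c, I (ht ib.1) ib.2 ->
   I (ht ib.1.+1) c /\ principal (x ^+ ib.1) (c - ib.2) by exact: next.
pose F := fix F n := if n is k.+1 then nx (k.+1, F k) else b0.
have FI n : I (ht n.+1) (F n).
  by elim: n => [//|n IH]; have [] := nxP (n.+1, F n) IH.
have Fdiff n : principal (x ^+ n.+1) (F n.+1 - F n).
  by have [] := nxP (n.+1, F n) (FI n).
have xpow n : x ^+ n.+1 \in ideal_powS m n.
  elim: n => [|n IH]; first by rewrite expr1.
  by apply/asboolP => N; apply; exists x, (x ^+ n.+1); split=> //; exact: exprS.
have prin_pow n y : principal (x ^+ n.+1) y -> y \in ideal_powS m n.
  by move=> [a ->]; apply: idealMr.
pose f : prod_mod m := fun n => \pi_({ideal_quot ideal_powS m n}) (F n).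
have cf : f \in @compatible R m.
  apply/asboolP => n; rewrite /f trans_pi; apply/eqP.
  by rewrite -Quotient.idealrBE; apply: prin_pow; exact: Fdiff.
pose G := Completion cf.
have Gk k n : completion_val (G ^+ k) n = (f n) ^+ k.
  by elim: k => [//|k IH]; rewrite !exprS -IH.
have G0 : G = 0.
  apply: (redC _ e); apply: val_inj; apply: functional_extensionality_dep => n.
  rewrite [LHS]Gk /f -rmorphXn /=.
  apply: etrans (_ : _ = \pi_({ideal_quot ideal_powS m n}) 0) _; last exact: raddf0.
  apply/eqP; rewrite -Quotient.idealrBE subr0; apply: prin_pow.
  have [v [Vv Fv]] := Ile _ _ (ht_i n.+1) _ (FI n).
  exact: power_divisible e0 be Vv Fv.
have [|n mx] := max_power_sub (m := m) noethR (principal_ideal x).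
  by move=> y ym; have := nilx 1%N y ym; rewrite expr1.
have Fx k : principal x (F k) -> principal x b0.
  elim: k => [//|k IH] xF; apply: IH; have [a Fa] := Fdiff k.
  have [c xc] := xF; exists (c - a * x ^+ k).
  by rewrite mulrBl -xc -mulrA -exprSr -Fa; ring.
apply: xb0; apply: (Fx n); apply: mx.
have /eqP := congr1 (fun g => completion_val g n) G0.
rewrite -[X in _ == X](raddf0 (\pi_({ideal_quot ideal_powS m n}))) /=.
by rewrite /f -Quotient.idealrBE subr0.
Qed.
End Finiteness.

(** * Generalized inverses over the integral closure *)

Section Invertible.
Variables (R : comNzRingType) (m : idealr R).
Hypotheses (noethR : noetherian R) (locR : local_ring m).
Hypotheses (dimR : krull_dim R = Some 1%N) (redR : reduced R).
Variables (x : R) (k : nat).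
Hypotheses (xm : x \in m) (regx : GRing.lreg x).
Local Notation K := (total_frac R).
Local Notation iota := (to_total R).
Local Notation V := (integral_closure R).
Hypothesis boundV : forall v, V v -> exists a, iota (x ^+ k) * v = iota a.

Let regX n : GRing.lreg (x ^+ n). Proof. exact: GRing.lregX. Qed.

Let colength_power n : exists e, bounded (principal (x ^+ n)) setT e.
Proof.
apply: (finite_colength noethR locR (principal_ideal _)) => y.
apply: (lreg_power_mem noethR locR dimR redR (principal_ideal _) _ (@regX n)).
by exists 1; rewrite mul1r.
Qed.

(** This is the Artinian property of [V / x ^+ N V], read off in [R] through
    multiplication by [x ^+ k]. *)
Lemma integral_power_stationary N z : V z ->
  exists n g h, [/\ V g, V h & z ^+ n = z ^+ n.+1 * g + iota (x ^+ N) * h].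
Proof.
move=> Vz; have Vzn n : V (z ^+ n).
  by elim: n => [|n IH]; [exact: icl1 | rewrite exprS; exact: iclM].
have ViN (c : R) h : V h -> V (iota c * h).
  by apply: iclM; exact: icl_to_total.
pose C n : set R := [set r | exists g h, [/\ V g, V h &
  iota r = iota (x ^+ k) * (z ^+ n * g + iota (x ^+ N) * h)]].
have [e be] := colength_power (k + N).
have [|||n0 Cn] := descending_stationary (principal_ideal _) be (C := C).
- move=> n; split.
  + exists 0, 0; split; [exact: icl0 | exact: icl0 | by rewrite !mulr0 addr0 mulr0 rmorph0].
  + move=> a b [g [h [Vg Vh aE]]] [g' [h' [Vg' Vh' bE]]]; exists (g + g'), (h + h').
    split; [exact: iclD | exact: iclD | rewrite rmorphD aE bE; ring].
  + move=> a b [g [h [Vg Vh bE]]]; exists (iota a * g), (iota a * h).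
    split; [exact: ViN | exact: ViN | rewrite rmorphM bE; ring].
- move=> n _ [t ->]; exists 0, (iota t); split; [exact: icl0 | exact: icl_to_total |].
  by rewrite mulr0 add0r exprD !rmorphM; ring.
- move=> n r [g [h [Vg Vh rE]]]; exists (z * g), h; split; [exact: iclM | by [] |].
  by rewrite rE exprSr; ring.
have [r rE] := boundV (Vzn n0).
have /(Cn _ (leqnSn n0))[g [h [Vg Vh rE']]] : C n0 r.
  exists 1, 0; split; [exact: icl1 | exact: icl0 |].
  by rewrite mulr1 mulr0 addr0 rE.
exists n0, g, h; split=> //; apply: (to_total_mulI (@regX k)).
by rewrite -rE' rE.
Qed.

Definition span_of n (a : 'I_n -> R) : set R := [set r | exists c, r = \sum_i c i * a i].

Lemma span_of_ideal n (a : 'I_n -> R) : ideal (span_of a).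
Proof.
split=> [|b d [c ->] [c' ->]|b d [c ->]].
- by exists (fun=> 0); rewrite big1 // => i _; rewrite mul0r.
- exists (fun i => c i + c' i); rewrite -big_split; apply: eq_bigr => i _.
  by rewrite mulrDl.
- exists (fun i => b * c i); rewrite mulr_sumr; apply: eq_bigr => i _.
  by rewrite mulrA.
Qed.

Lemma mem_span_of n (a : 'I_n -> R) i : span_of a (a i).
Proof.
exists (fun j => (j == i)%:R); rewrite (bigD1 i) //= eqxx mul1r big1 ?addr0 //.
by move=> j /negPf ->; rewrite mul0r.
Qed.

(** Let [J] be the product of the ideal generated by [a] with its inverse
    fractional ideal.  Integrality gives [(V : J) = V]; if [J] were proper, a
    socle element of [V / x ^+ N V] modulo [J] would contradict this. *)
Lemma invertible_ideal n (a : 'I_n -> R) N : span_of a (x ^+ N) ->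
  exists b : 'I_n -> K,
    (forall i j, V (iota (a i) * b j)) /\ \sum_i iota (a i) * b i = 1.
Proof.
move=> [c xN]; pose inv q := forall i, V (iota (a i) * q).
pose J v := exists b : 'I_n -> K, (forall j, inv (b j)) /\ v = \sum_i iota (a i) * b i.
suff [b [ib b1]] : J 1.
  by exists b; split; [move=> i j; exact: ib | exact: esym b1].
have invD p q : inv p -> inv q -> inv (p + q).
  by move=> ip iq i; rewrite mulrDr; apply: iclD; [exact: ip | exact: iq].
have invM v q : V v -> inv q -> inv (v * q).
  by move=> Vv iq i; rewrite mulrCA; apply: iclM Vv _; exact: iq.
have invi r : inv (iota r).
  by move=> i; apply: iclM; exact: icl_to_total.
have J0 : J 0.
  exists (fun=> 0); split; last by rewrite big1 // => i _; rewrite mulr0.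
  by move=> _ i; rewrite mulr0; exact: icl0.
have JD v w : J v -> J w -> J (v + w).
  move=> [b [ib ->]] [d [id ->]]; exists (fun i => b i + d i); split.
    by move=> j; apply: invD.
  by rewrite -big_split; apply: eq_bigr => i _; rewrite mulrDr.
have JM v w : V v -> J w -> J (v * w).
  move=> Vv [b [ib ->]]; exists (fun i => v * b i); split.
    by move=> j; apply: invM.
  by rewrite mulr_sumr; apply: eq_bigr => i _; rewrite mulrCA.
have JV v : J v -> V v.
  by move=> [b [ib ->]]; apply: icl_sum => i; exact: ib.
have JxN : J (iota (x ^+ N)).
  exists (fun i => iota (c i)); split; first by move=> j; exact: invi.
  by rewrite xN rmorph_sum; apply: eq_bigr => i _; rewrite rmorphM mulrC.
have Ja i q : inv q -> J (iota (a i) * q).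
  move=> iq; exists (fun j => (j == i)%:R * q); split.
    move=> j; case: (j == i); first by rewrite mul1r; exact: iq.
    by move=> l; rewrite mul0r mulr0; exact: icl0.
  rewrite (bigD1 i) //= eqxx mul1r big1 ?addr0 // => j /negPf ->.
  by rewrite mul0r mulr0.
have colonJ q : (forall v, J v -> V (q * v)) -> V q.
  move=> qJ; pose b : set R := [set r | exists p, inv p /\ iota r = iota (x ^+ (k + N)) * p].
  have ib : ideal b.
    split=> [|r s [p [ip rE]] [p' [ip' sE]]|r s [p [ip sE]]].
    - exists 0; split; first by rewrite -(rmorph0 iota); exact: invi.
      by rewrite mulr0 rmorph0.
    - by exists (p + p'); split; [exact: invD | rewrite mulrDr rmorphD rE sE].
    - exists (iota r * p); split; last by rewrite mulrCA rmorphM sE.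
      by apply: invM ip; exact: icl_to_total.
  have [s [sb gs]] := noetherian_gen noethR ib.
  have [|||p [mp _ pq]] := integral_of_stable_ideal (v := q) (a := x ^+ (k + N)) sb gs.
  - move=> r [p [ip rE]].
    have iqp : inv (q * p) by move=> i; rewrite mulrCA; apply: qJ; exact: Ja.
    have VxN : V (iota (x ^+ N) * (q * p)).
      rewrite xN rmorph_sum mulr_suml; apply: icl_sum => i.
      rewrite rmorphM -mulrA; apply: iclM; [exact: icl_to_total | exact: iqp].
    have [t tE] := boundV VxN; exists t; last first.
      by rewrite rE mulrCA -tE exprD rmorphM -!mulrA.
    by exists (q * p); split=> //; rewrite -tE exprD rmorphM -!mulrA.
  - by exists 1; split; [rewrite -(rmorph1 iota); exact: invi | rewrite mulr1].
  - exact: regX.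
  by exists p.
apply: contrapT => nJ1.
have [uk ukE] := to_total_unit (@regX k).
have [uN uNE] := to_total_unit (@regX N).
(* [J] is finitely generated, being contained in [x ^- k R]. *)
have [s sJ gs] : exists2 s : seq K, forall z, z \in s -> J z &
    forall y, (forall z, z \in s -> exists h, V h /\ z * y = iota (x ^+ N) * h) ->
      forall v, J v -> exists h, V h /\ v * y = iota (x ^+ N) * h.
  pose b : set R := [set r | J (uk * iota r)].
  have ib : ideal b.
    split=> [|r s|r s]; rewrite /b /= ?rmorph0 ?mulr0 //.
      by rewrite rmorphD mulrDr; exact: JD.
    by rewrite rmorphM mulrCA; apply: JM; exact: icl_to_total.
  have [s [sb gs]] := noetherian_gen noethR ib.
  exists [seq uk * iota r | r <- s] => [z /mapP[r /sb br ->] //|y sy v Jv].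
  have [r rE] := boundV (JV v Jv).
  have vE : v = uk * iota r by rewrite -rE mulrA ukE mul1r.
  rewrite vE; apply: (gs [set r | exists h, V h /\ uk * iota r * y = iota (x ^+ N) * h]).
  - split=> [|p q [h [Vh pE]] [h' [Vh' qE]]|p q [h [Vh qE]]].
    + by exists 0; split; [exact: icl0 | rewrite rmorph0 !mulr0 mul0r].
    + exists (h + h'); split; first exact: iclD.
      by rewrite rmorphD mulrDr mulrDl pE qE mulrDr.
    + exists (iota p * h); split; first by apply: iclM Vh; exact: icl_to_total.
      by rewrite rmorphM mulrCA -mulrA qE mulrCA.
  - by move=> z zs; apply: sy; apply/mapP; exists z.
  - by rewrite /b /= -vE.
pose I y := exists h, V h /\ y = iota (x ^+ N) * h.
have IM v y : V v -> I y -> I (v * y).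
  by move=> Vv [h [Vh ->]]; exists (v * h); split; [exact: iclM | rewrite mulrCA].
have [h [Vh Jh sh]] : exists h, [/\ V h, J (1 - h) &
    forall z, z \in s -> exists n, I (z ^+ n * h)].
  elim: s sJ {gs} => [|z s IH] sJ.
    by exists 1; split; rewrite ?subrr //; exact: icl1.
  have [|h [Vh Jh sh]] := IH; first by move=> w ws; apply: sJ; rewrite inE ws orbT.
  have Jz := sJ z (mem_head _ _); have Vz := JV _ Jz.
  have [l [g [d [Vg Vd zE]]]] := integral_power_stationary N Vz.
  have V1 : V (1 - z * g) by apply: iclB; [exact: icl1 | exact: iclM].
  exists ((1 - z * g) * h); split; first exact: iclM.
    rewrite (_ : 1 - _ = 1 - h + (g * h) * z); last by ring.
    by apply: JD Jh _; apply: JM Jz; exact: iclM.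
  move=> w; rewrite inE => /predU1P[->|/sh[n' wh]]; last first.
    by exists n'; rewrite mulrCA; exact: IM.
  exists l; exists (d * h); split; first exact: iclM.
  rewrite (_ : _ * _ = (z ^+ l - z ^+ l.+1 * g) * h); last by rewrite exprS; ring.
  by rewrite {1}zE addrAC subrr add0r mulrA.
have [|||||y [Iy [v [Vv yE]] sy]] := socle_element (S := V) (I := I) (s := s) (h := h) _ _ IM.
- exact: icl1.
- exact: iclM.
- by move=> z /sJ/JV.
- move=> [d [Vd hE]]; apply: nJ1; rewrite -(subrK h 1).
  by apply: JD Jh _; rewrite hE mulrC; exact: JM.
- exact: sh.
have Vq : V (uN * y).
  apply: colonJ => w Jw; have [d [Vd wy]] := gs y sy w Jw.
  by rewrite -mulrA [y * w]mulrC wy mulrA uNE mul1r.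
by apply: Iy; exists (uN * y); split=> //; rewrite mulrA [_ * uN]mulrC uNE mul1r.
Qed.

(** After clearing denominators [a] generates an ideal of [R] that need not be
    regular.  Its sum with its annihilator contains a power of [x]; inverting
    that sum and forgetting the annihilator leaves an inverse on the support. *)
Lemma quasi_invertible n (a : 'I_n -> K) : exists b : 'I_n -> K,
  (forall i j, V (a i * b j)) /\ forall i, (\sum_j a j * b j) * a i = a i.
Proof.
have [N0 /fin_all_exists[al aE]] := common_denominator noethR locR dimR redR xm a.
have iS := span_of_ideal al; pose A := annih (span_of al).
have iSA : ideal (isum (span_of al) A) by apply: isum_ideal => //; exact: annih_ideal.
have [N [r [u [[c rE] Au xN]]]] : exists N, isum (span_of al) A (x ^+ N).
  apply: (power_mem noethR iSA xm) => p pSA; apply: locR.2; apply: contrapT => npm.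
  have aSA i : isum (span_of al) A (al i).
    exists (al i), 0; split; [exact: mem_span_of | | by rewrite addr0].
    by move=> ? _; rewrite mul0r.
  have /fin_all_exists[t /all_and2[tp ta]] i :=
    nonmaximal_kill noethR locR dimR redR npm (pSA _ (aSA i)).
  have : \prod_i t i \in p.
    apply: pSA; exists 0, (\prod_i t i); split; [by case: iS | | by rewrite add0r].
    move=> _ [d ->]; rewrite mulr_sumr big1 // => i _.
    by rewrite mulrCA (bigD1 i) //= [t i * _]mulrC -mulrA ta !mulr0.
  apply/negP; elim/big_ind: _ => [|y z|i _]; first by rewrite idealr1.
    by rewrite prime_idealrM negb_or => -> ->.
  exact: tp.
have ua i : u * al i = 0 by apply/Au/mem_span_of.
pose a' (i : 'I_n.+1) := if unlift ord0 i is Some j then al j else u.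
have [|b [Vb b1]] := @invertible_ideal n.+1 a' N.
  exists (fun i => if unlift ord0 i is Some j then c j else 1).
  rewrite big_ord_recl /a' unlift_none mul1r xN rE addrC; congr (_ + _).
  by apply: eq_bigr => i _; rewrite liftK.
have [v vE] := to_total_unit (@regX N0).
have aE' i : a i = v * iota (al i) by rewrite -aE mulrA vE mul1r.
exists (fun j => iota (x ^+ N0) * b (fintype.lift ord0 j)).
have vb i j : a i * (iota (x ^+ N0) * b (fintype.lift ord0 j)) = iota (al i) * b (fintype.lift ord0 j).
  by rewrite mulrA [a i * _]mulrC aE.
split=> [i j|i].
  by rewrite vb; have := Vb (fintype.lift ord0 i) (fintype.lift ord0 j); rewrite /a' liftK.
have <- : \sum_j iota (a' (fintype.lift ord0 j)) * b (fintype.lift ord0 j) =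
    \sum_j a j * (iota (x ^+ N0) * b (fintype.lift ord0 j)).
  by apply: eq_bigr => j _; rewrite vb /a' liftK.
move: b1; rewrite big_ord_recl {1}/a' unlift_none => /(canRL (addKr _)) ->.
rewrite mulrDl mul1r aE' mulrCA mulNr.
by rewrite [_ * b _ * _]mulrAC -rmorphM ua rmorph0 mul0r oppr0 mulr0 add0r.
Qed.

(** This is the splitting of finitely generated torsion-free [V]-modules, written
    with matrices.  The projection is built one column at a time: the first column
    is handled by [quasi_invertible], and the other columns after projecting them
    to the complement. *)
Lemma integral_generalized_inverse l n (A : 'M[K]_(l, n)) : exists N : 'M[K]_(n, l),
  (forall i j, V ((A *m N) i j)) /\ A *m N *m A = A.
Proof.
elim: n A => [A|n IH].
  exists 0; split; last by apply/matrixP => i [].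
  by move=> i j; rewrite mulmx0 mxE; exact: icl0.
rewrite -[n.+1]/(1 + n)%N => A; rewrite -[A]hsubmxK.
move: (lsubmx A) (rsubmx A) => a A' {A}.
have [b [Vb bE]] := quasi_invertible (fun i => a i 0).
pose B : 'rV_l := \row_j b j; pose E := a *m B.
have VE i j : V (E i j) by rewrite /E mxE big_ord1 [B _ _]mxE; exact: Vb.
have Ea : E *m a = a.
  rewrite /E -mulmxA; apply/colP => i; rewrite !mxE big_ord1 [X in a i 0 * X]mxE.
  rewrite -[RHS]bE mulrC; congr (_ * _); apply: eq_bigr => j _.
  by rewrite mxE mulrC.
pose A2 := (1%:M - E) *m A'; have [N2 [VG GE]] := IH A2.
set G := A2 *m N2 in VG GE.
pose P := N2 *m (1%:M - E).
exists (col_mx (B - B *m A' *m P) P).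
have AN : row_mx a A' *m col_mx (B - B *m A' *m P) P = E + G *m (1%:M - E).
  have -> : G *m (1%:M - E) = A' *m P - E *m A' *m P.
    by rewrite /G -mulmxA -/P -mulmxBl /A2 (mulmxBl 1%:M) mul1mx.
  by rewrite mul_row_col mulmxBr !mulmxA -/E -addrA [X in _ + X]addrC.
rewrite AN; split.
  move=> i j; rewrite mxE; apply: iclD (VE i j) _; rewrite mxE.
  apply: icl_sum => t; apply: iclM (VG i t) _.
  rewrite mxE [(- E) t j]mxE [1%:M t j]mxE; apply: iclB (VE t j).
  case: (t == j); [exact: icl1 | exact: icl0].
rewrite mul_mx_row; congr row_mx; rewrite mulmxDl -(mulmxA G).
  by rewrite (mulmxBl 1%:M) mul1mx Ea subrr mulmx0 addr0.
by rewrite -/A2 GE /A2 (mulmxBl 1%:M) mul1mx addrC subrK.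
Qed.
End Invertible.

(** * Linear maps and finitely generated modules *)

Section LinearMaps.
Variable R : comNzRingType.
Implicit Types U V W : lmodType R.

Lemma exists_linear U V (f : U -> V) : linear f -> exists g : {linear U -> V}, g =1 f.
Proof.
move=> lf; pose h := GRing.isLinear.Build R U V *:%R f lf.
by exists (HB.pack_for {linear U -> V} f h).
Qed.

Lemma corestrict U V (N : submod V) (f : {linear U -> V}) :
  (forall u, f u \in submod_pred N) ->
  exists g : {linear U -> subm N}, forall u, val (g u) = f u.
Proof.
move=> fN; have [|g gE] := @exists_linear U (subm N) (fun u => Subm (fN u)).
  by move=> a u v; apply: val_inj; rewrite /= linearP.
by exists g => u; rewrite gE.
Qed.

Lemma descend U V W (c : {linear U -> V}) (e : {linear U -> W}) :
    (forall v, exists u, c u = v) -> (forall u, c u = 0 -> e u = 0) ->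
  exists f : {linear V -> W}, forall u, f (c u) = e u.
Proof.
move=> /choice[s cs] ce.
have eq_e u v : c u = c v -> e u = e v.
  move=> cuv; apply/eqP; rewrite -subr_eq0 -raddfB; apply/eqP/ce.
  by rewrite raddfB /= cuv subrr.
have [|f fE] := @exists_linear V W (fun v => e (s v)).
  by move=> a u v; rewrite -linearP; apply: eq_e; rewrite linearP !cs.
by exists f => u; rewrite fE; apply: eq_e; rewrite cs.
Qed.

Lemma free_lifting (T : choiceType) V W (f : {linear {freeg T / R} -> W})
    (g : {linear V -> W}) : (forall t, exists v, g v = f << t >>) ->
  exists h : {linear {freeg T / R} -> V}, forall z, g (h z) = f z.
Proof.
move=> /choice[s gs]; exists (free_lift s) => z.
rewrite [RHS]free_lift_uniq [LHS](free_lift_uniq (g \o free_lift s)).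
by congr (free_lift _ z); apply/funext => t; rewrite /= free_liftU.
Qed.

Definition row_comb V n (g : 'I_n -> V) (r : 'rV[R]_n) : V := \sum_i r 0 i *: g i.

Lemma row_comb_is_linear V n (g : 'I_n -> V) : linear (row_comb g).
Proof.
move=> a r s; rewrite /row_comb scaler_sumr -big_split; apply: eq_bigr => i _.
by rewrite !mxE scalerDl scalerA.
Qed.
HB.instance Definition _ V n (g : 'I_n -> V) :=
  GRing.isLinear.Build R 'rV[R]_n V *:%R (row_comb g) (row_comb_is_linear g).

Lemma row_combZ V n (g : 'I_n -> V) a r : row_comb g (a *: r) = a *: row_comb g r.
Proof. exact: linearZ. Qed.

Lemma row_combD V n (g : 'I_n -> V) r s : row_comb g (r + s) = row_comb g r + row_comb g s.
Proof. exact: linearD. Qed.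

Lemma row_comb_delta V n (g : 'I_n -> V) i : row_comb g (delta_mx 0 i) = g i.
Proof.
rewrite /row_comb (bigD1 i) //= mxE !eqxx scale1r big1 ?addr0 // => j /negPf ji.
by rewrite mxE ji andbF scale0r.
Qed.

Lemma row_linearE V n (f : {linear 'rV[R]_n -> V}) r :
  f r = row_comb (fun i => f (delta_mx 0 i)) r.
Proof.
rewrite {1}[r](row_sum_delta r) linear_sum; apply: eq_bigr => i _.
by rewrite linearZ_LR.
Qed.

Lemma row_projective n : projective ('rV[R]_n : lmodType R).
Proof.
move=> M N g f gs; have [h gh] := choice (fun i => gs (f (delta_mx 0 i))).
exists (row_comb h) => r; rewrite [RHS]row_linearE /= linear_sum.
by apply: eq_bigr => i _; rewrite linearZ /= gh.
Qed.
End LinearMaps.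

Section FinitelyGenerated.
Variable R : comNzRingType.
Implicit Types M N : lmodType R.

Lemma fin_genP M : fin_gen M <->
  exists n (g : 'I_n -> M), forall y, exists r, y = row_comb g r.
Proof.
split=> [[s sM]|[n [g gM]]]; last first.
  exists [seq g i | i : 'I_n] => y; have [r ->] := gM y; apply/asboolP => N gN.
  rewrite rpred_sum // => i _; apply/rpredZ/gN/mapP.
  by exists i; rewrite ?mem_enum.
exists (size s), (fun i => s`_i) => y.
have cS : submod_closed [pred z : M | `[< exists r : 'rV[R]_(size s), z = row_comb (fun i : 'I_(size s) => s`_i) r >]].
  split=> [|a u v /asboolP[r ->] /asboolP[q ->]]; apply/asboolP.
    by exists 0; rewrite raddf0.
  by exists (a *: r + q); rewrite linearP.
have /asboolP/(_ (Submod cS)) ys := sM y.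
apply/asboolP/ys => z /(nthP 0)[i si <-]; apply/asboolP.
by exists (delta_mx 0 (Ordinal si)); rewrite row_comb_delta.
Qed.

Lemma fin_gen_image M N (f : {linear M -> N}) : (forall y, exists z, f z = y) ->
  fin_gen M -> fin_gen N.
Proof.
move=> fs /fin_genP[n [g gM]]; apply/fin_genP; exists n, (f \o g) => y.
have [z <-] := fs y; have [r ->] := gM z; exists r.
by rewrite linear_sum; apply: eq_bigr => i _; rewrite linearZ.
Qed.

Lemma fin_gen_row n : fin_gen ('rV[R]_n : lmodType R).
Proof.
apply/fin_genP; exists n, (fun i => delta_mx 0 i) => r; exists r.
exact: row_sum_delta.
Qed.

Hypothesis noethR : noetherian R.

Lemma noetherian_rows n (P : 'rV[R]_n -> Prop) : P 0 ->
    (forall r s, P r -> P s -> P (r + s)) -> (forall a r, P r -> P (a *: r)) ->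
  exists l (B : 'M[R]_(l, n)), forall r, P r <-> exists t, r = t *m B.
Proof.
elim: n P => [|n IH] P P0 PD PZ.
  exists 0%N, 0 => r; split=> [_|_]; last by rewrite [r]thinmx0.
  by exists 0; rewrite [r]thinmx0 [RHS]thinmx0.
move: P P0 PD PZ; rewrite -[n.+1]/(1 + n)%N => P P0 PD PZ.
have [|||l2 [B2 B2P]] := IH (fun r => P (row_mx 0 r)).
- by rewrite row_mx0.
- by move=> r s Pr Ps; have := PD _ _ Pr Ps; rewrite add_row_mx addr0.
- by move=> a r Pr; have := PZ a _ Pr; rewrite scale_row_mx scaler0.
pose I : set R := [set c | exists r, P r /\ r 0 (lshift n 0) = c].
have iI : ideal I.
  split=> [|a b [r [Pr <-]] [s [Ps <-]]|a b [r [Pr <-]]].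
  - by exists 0; rewrite mxE.
  - by exists (r + s); rewrite mxE; split=> //; exact: PD.
  - by exists (a *: r); rewrite mxE; split=> //; exact: PZ.
have [s [sI gs]] := noetherian_gen noethR iI.
have /fin_all_exists[b /all_and2[Pb b0]] (i : 'I_(size s)) := sI _ (mem_nth 0 (ltn_ord i)).
pose B1 := \matrix_i b i.
have PB1 t : P (t *m B1).
  rewrite mulmx_sum_row; elim/big_ind: _ => // i _; apply: PZ.
  by rewrite rowK.
exists (size s + l2)%N, (col_mx B1 (row_mx 0 B2)) => r; split; last first.
  move=> [t ->]; rewrite -[t]hsubmxK mul_row_col; apply: PD => //.
  by rewrite mul_mx_row mulmx0; apply/B2P; eexists.
move=> Pr; have [t1 r0] : exists t1 : 'rV_(size s), r 0 (lshift n 0) = (t1 *m B1) 0 (lshift n 0).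
  apply: (gs [set c | exists t1 : 'rV_(size s), c = (t1 *m B1) 0 (lshift n 0)]).
  - split=> [|_ _ [t ->] [t' ->]|a _ [t ->]].
    + by exists 0; rewrite mul0mx mxE.
    + by exists (t + t'); rewrite mulmxDl [RHS]mxE.
    + by exists (a *: t); rewrite -scalemxAl [RHS]mxE.
  - move=> z /(nthP 0)[i si <-]; exists (delta_mx 0 (Ordinal si)).
    by rewrite -rowE rowK b0.
  - by exists r.
have [t2 t2E] : exists t2, rsubmx (r - t1 *m B1) = t2 *m B2.
  apply/B2P; rewrite (_ : 0 = lsubmx (r - t1 *m B1)).
    by rewrite hsubmxK -scaleN1r; apply: PD => //; exact: PZ.
  by apply/rowP => j; rewrite !ord1 !mxE r0 mxE subrr.
exists (row_mx t1 t2); rewrite mul_row_col mul_mx_row mulmx0 -t2E.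
rewrite (_ : 0 = lsubmx (r - t1 *m B1)); last first.
  by apply/rowP => j; rewrite !ord1 !mxE r0 mxE subrr.
by rewrite hsubmxK addrC subrK.
Qed.

Lemma fin_gen_subm M (N : submod M) : fin_gen M -> fin_gen (subm N).
Proof.
move=> /fin_genP[n [g gM]].
have [|||l [B BP]] := @noetherian_rows n (fun r => row_comb g r \in submod_pred N).
- by rewrite raddf0; apply: rpred0.
- by move=> r s rN sN; rewrite raddfD; apply: rpredD.
- by move=> a r rN; rewrite linearZ; apply: rpredZ.
have BN i : row_comb g (row i B) \in submod_pred N.
  by apply/BP; exists (delta_mx 0 i); rewrite rowE.
apply/fin_genP; exists l, (fun i => Subm (BN i)) => -[y yN].
have [r yr] := gM y; have [t rt] : exists t, r = t *m B by apply/BP; rewrite -yr.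
exists t; apply: val_inj; rewrite [RHS]linear_sum /= yr rt mulmx_sum_row linear_sum.
by apply: eq_bigr => i _; rewrite linearZ.
Qed.
End FinitelyGenerated.

(** * Annihilators of Ext and Tor via the standard resolution *)

Section Homology.
Variable R : comNzRingType.
Implicit Types U V W : lmodType R.

Lemma homology_annP U V W (f : {linear U -> V}) (g : {linear V -> W}) r :
  ann (homology f g) r <-> forall v, g v = 0 -> exists u, f u = r *: v.
Proof.
split=> [fg v /eqP gv|fg q].
  pose v' : subm (ker g) := Subm (gv : v \in submod_pred (ker g)).
  have /= := fg (proj (Submod (bound_submod f g)) v').
  rewrite -linearZ_LR -[X in _ = X](raddf0 (proj (Submod (bound_submod f g)))).
  by move=> /proj_eq; rewrite subr0 => /asboolP.
rewrite -[q]lift_reprK; case: (lift_repr q) => v gv.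
have [u fu] := fg v (eqP gv); rewrite -linearZ_LR.
apply: etrans (_ : _ = proj (Submod (bound_submod f g)) 0) _; last exact: raddf0.
by apply/proj_eq; rewrite subr0; apply/asboolP; exists u.
Qed.

Lemma ann_ExtP (A B : lmodType R) i r : ann (Ext i.+1 A B) r <->
  forall v : {linear res A i.+1 -> B}, (forall z, v (res_diff A i.+1 z) = 0) ->
    exists u : {linear res A i -> B}, forall z, u (res_diff A i z) = r *: v z.
Proof.
split=> [/homology_annP rA v v0|rA].
  have [|u uv] := rA (v : Hom (res A i.+1) B); first by apply: hom_ext => z; exact: v0.
  exists (u : {linear _ -> _}) => z; have := congr1 (fun h : Hom _ _ => hom_fun h z) uv; exact.
apply/homology_annP => v v0; have [|u uv] := rA v.
  move=> z; have := congr1 (fun h : Hom _ _ => hom_fun h z) v0; exact.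
by exists u; apply: hom_ext => z; exact: uv.
Qed.

Lemma ann_TorP (A B : lmodType R) i r : ann (Tor i.+1 A B) r <->
  forall t, tensor_map (res_diff A i) B t = 0 ->
    exists u, tensor_map (res_diff A i.+1) B u = r *: t.
Proof. exact: homology_annP. Qed.

Section TensorTheory.
Variables U V : lmodType R.

Lemma tensDl (u u' : U) (v : V) : tens (u + u') v = tens u v + tens u' v.
Proof.
rewrite /tens -raddfD; apply/proj_eq/asboolP => N; rewrite opprD addrA.
by apply; exact: tensor_relDl.
Qed.

Lemma tensDr (u : U) (v v' : V) : tens u (v + v') = tens u v + tens u v'.
Proof.
rewrite /tens -raddfD; apply/proj_eq/asboolP => N; rewrite opprD addrA.
by apply; exact: tensor_relDr.
Qed.

Lemma tensZl a (u : U) (v : V) : tens (a *: u) v = a *: tens u v.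
Proof.
rewrite /tens -linearZ_LR; apply/proj_eq/asboolP => N.
by apply; exact: tensor_relZl.
Qed.

Lemma tensZr a (u : U) (v : V) : tens u (a *: v) = a *: tens u v.
Proof.
rewrite /tens -linearZ_LR; apply/proj_eq/asboolP => N.
by apply; exact: tensor_relZr.
Qed.

Lemma tens0r (u : U) : tens u (0 : V) = 0.
Proof. by rewrite -(scale0r (0 : V)) tensZr scale0r. Qed.

Lemma tens_suml (T : finType) (F : T -> U) (v : V) : tens (\sum_i F i) v = \sum_i tens (F i) v.
Proof.
apply: (big_morph (fun u => tens u v)) => [u u'|]; first exact: tensDl.
by rewrite -(scale0r (0 : U)) tensZl scale0r.
Qed.

Lemma tens_sumr (T : finType) (u : U) (F : T -> V) : tens u (\sum_i F i) = \sum_i tens u (F i).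
Proof. by apply: (big_morph (fun v => tens u v)) => [v v'|]; [exact: tensDr|exact: tens0r]. Qed.

Lemma tensor_ind (P : tensor U V -> Prop) : P 0 ->
  (forall a u v t, P t -> P (a *: tens u v + t)) -> forall t, P t.
Proof.
move=> P0 PD t; rewrite -[t]lift_reprK -[lift_repr t]freeg_sumE raddf_sum.
elim: (dom _) => [|[u v] s IH]; first by rewrite big_nil.
rewrite big_cons (_ : << coeff (u, v) (lift_repr t) *g (u, v) >> =
  coeff (u, v) (lift_repr t) *: << (u, v) >>); last first.
  by apply/eqP/freeg_eqP => l; rewrite coeffZ !coeffU mulrA mulr1.
by rewrite /= linearZ_LR; apply: PD.
Qed.

Lemma tensor_lift W (h : U -> V -> W) : (forall v, linear (h^~ v)) -> (forall u, linear (h u)) ->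
  exists H : {linear tensor U V -> W}, forall u v, H (tens u v) = h u v.
Proof.
move=> hl hr; pose p : {linear {freeg (U * V)%type / R} -> W} :=
  free_lift (fun uv : U * V => h uv.1 uv.2).
have pE u v : p << (u, v) >> = h u v by rewrite /p /= free_liftU.
clearbody p.
have hDl u u' v : h (u + u') v = h u v + h u' v.
  by have := hl v 1 u u'; rewrite !scale1r.
have hDr u v v' : h u (v + v') = h u v + h u v'.
  by have := hr u 1 v v'; rewrite !scale1r.
have h0l v : h 0 v = 0 by apply: (addrI (h 0 v)); rewrite -hDl !addr0.
have h0r u : h u 0 = 0 by apply: (addrI (h u 0)); rewrite -hDr !addr0.
have hZl a u v : h (a *: u) v = a *: h u v by have := hl v a u 0; rewrite !addr0 h0l addr0.
have hZr a u v : h u (a *: v) = a *: h u v by have := hr u a v 0; rewrite !addr0 h0r addr0.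
have p0 x : x \in submod_pred (spanm (@tensor_rel R U V)) -> p x = 0.
  move=> /asboolP/(_ (ker p)) px; apply/eqP/px => {px} _ [u u' v|u v v'|a u v|a u v];
    apply/eqP; rewrite !raddfB /= ?linearZ_LR !pE ?hDl ?hDr ?hZl ?hZr ?subrr //.
  - by rewrite addrAC addrK subrr.
  - by rewrite addrAC addrK subrr.
  - by rewrite /= scalerN subrr.
  - by rewrite /= scalerN subrr.
have [||H HE] := descend (c := proj (spanm (@tensor_rel R U V))) (e := p).
- by move=> q; exists (lift_repr q); exact: lift_reprK.
- move=> y y0; apply: p0.
  have /proj_eq : proj (spanm (@tensor_rel R U V)) y = proj (spanm (@tensor_rel R U V)) 0.
    by rewrite raddf0.
  by rewrite subr0.
by exists H => u v; rewrite -pE; exact: HE.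
Qed.
End TensorTheory.

Lemma tensor_mapP U V W (f : {linear U -> V}) a u w t :
  tensor_map f W (a *: tens u w + t) = a *: tens (f u) w + tensor_map f W t.
Proof.
have -> : tensor_map f W (a *: tens u w + t) =
    a *: tensor_map f W (tens u w) + tensor_map f W t by exact: linearP.
by rewrite tensor_mapE.
Qed.

Lemma tensor_mapZ U V W (f : {linear U -> V}) a (t : tensor U W) :
  tensor_map f W (a *: t) = a *: tensor_map f W t.
Proof. exact: linearZ. Qed.

Lemma tensor_map_surj U V W (f : {linear U -> V}) : (forall v, exists u, f u = v) ->
  forall t : tensor V W, exists s, tensor_map f W s = t.
Proof.
move=> fs; elim/tensor_ind=> [|a v w t [s <-]]; first by exists 0; rewrite raddf0.
have [u <-] := fs v; exists (a *: tens u w + s).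
by rewrite tensor_mapP.
Qed.

Lemma tensor_map_square U1 U2 U3 U4 W (f1 : {linear U2 -> U4}) (f2 : {linear U1 -> U2})
    (f3 : {linear U3 -> U4}) (f4 : {linear U1 -> U3}) :
    (forall u, f1 (f2 u) = f3 (f4 u)) ->
  forall t, tensor_map f1 W (tensor_map f2 W t) = tensor_map f3 W (tensor_map f4 W t).
Proof.
move=> f1234; elim/tensor_ind=> [|a u w t IH]; first by rewrite !raddf0.
by rewrite !tensor_mapP IH f1234.
Qed.

Lemma tensor_map_comp U V W X (f : {linear V -> W}) (g : {linear U -> V})
    (h : {linear U -> W}) : (forall u, f (g u) = h u) ->
  forall t, tensor_map f X (tensor_map g X t) = tensor_map h X t.
Proof.
move=> fgh; elim/tensor_ind=> [|a u w t IH]; first by rewrite !raddf0.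
by rewrite !tensor_mapP IH fgh.
Qed.

Lemma tensor_map_comp0 U V W X (f : {linear V -> W}) (g : {linear U -> V}) :
  (forall u, f (g u) = 0) -> forall t, tensor_map f X (tensor_map g X t) = 0.
Proof.
move=> fg; elim/tensor_ind=> [|a u w t IH]; first by rewrite !raddf0.
rewrite !tensor_mapP IH fg addr0.
by rewrite -(scale0r (0 : W)) tensZl scale0r scaler0.
Qed.
End Homology.

Section StandardResolution.
Variable R : comNzRingType.
Implicit Types L M N F P : lmodType R.

Lemma cover_surj M y : exists z, cover M z = y.
Proof. by exists << y >>; exact: coverU. Qed.

Lemma cover_diff M n z : cover (syz M n) (val (cover (syz M n.+1) z)) = 0.
Proof. exact/eqP/(valP (cover (syz M n.+1) z)). Qed.

(** On [F_0] the difference between [r] and a lift of its factorization maps to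
    the first syzygy, hence lifts to [F_1]; the later terms of the homotopy lift
    the remaining cycles by exactness.  The factorization enters in degree [0]
    only, so that [r] is homotopic to zero in positive degrees. *)
Lemma null_homotopy M P (phi : {linear M -> P}) (psi : {linear P -> M}) r i :
    projective P -> (forall y, psi (phi y) = r *: y) ->
  exists (s : {linear res M i -> res M i.+1}) (s' : {linear res M i.+1 -> res M i.+2}),
    forall z, r *: z = res_diff M i.+1 (s' z) + s (res_diff M i z).
Proof.
move=> projP pp.
have lift_cycle n (X : choiceType) (h : {linear {freeg X / R} -> res M n.+1}) :
    (forall z, res_diff M n (h z) = 0) ->
  exists s : {linear {freeg X / R} -> res M n.+2}, forall z, res_diff M n.+1 (s z) = h z.
  by move=> h0; apply: free_lifting => x; apply/res_exact.
have step n (s : {linear res M n -> res M n.+1}) :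
    (forall z, res_diff M n (s (res_diff M n z)) = r *: res_diff M n z) ->
  exists s' : {linear res M n.+1 -> res M n.+2},
    forall z, r *: z = res_diff M n.+1 (s' z) + s (res_diff M n z).
  move=> sE; pose h : {linear res M n.+1 -> res M n.+1} :=
    (r \*: idfun) \- (s \o res_diff M n).
  have hE z : h z = r *: z - s (res_diff M n z) by [].
  have [z|s' s'E] := lift_cycle n _ h; first by rewrite hE linearB linearZ_LR sE subrr.
  by exists s' => z; rewrite s'E hE subrK.
suff [s sE] : exists s : {linear res M i -> res M i.+1},
    forall z, res_diff M i (s (res_diff M i z)) = r *: res_diff M i z.
  by have [s' s'E] := step _ _ sE; exists s, s'.
elim: i => [|i [s sE]].
  have [psi' psiE] := projP _ _ (res_aug M) psi (@res_aug_surj R M).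
  pose h : {linear res M 0 -> res M 0} :=
    (r \*: idfun) \- (psi' \o (phi \o res_aug M)).
  have hE z : h z = r *: z - psi' (phi (res_aug M z)) by [].
  have [|s sE] := @free_lifting R _ _ _ h (res_diff M 0).
    move=> x; apply/res_exact0; rewrite hE linearB linearZ_LR.
    by rewrite [X in _ - X]psiE pp subrr.
  exists s => z; have aug0 : res_aug M (res_diff M 0 z) = 0.
    by apply/res_exact0; exists z.
  by rewrite sE hE aug0 !raddf0 addr0.
have [s' s'E] := step _ _ sE; exists s' => z.
have d0 : res_diff M i (res_diff M i.+1 z) = 0 by apply/res_exact; exists z.
by rewrite [RHS]s'E d0 raddf0 addr0.
Qed.

Lemma ann_Ext_of_factor M P N (phi : {linear M -> P}) (psi : {linear P -> M}) r i :
    projective P -> (forall y, psi (phi y) = r *: y) -> ann (Ext i.+1 M N) r.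
Proof.
move=> projP pp; apply/ann_ExtP => v v0.
have [s [s' sE]] := null_homotopy i projP pp.
exists (v \o s) => z; rewrite -linearZ_LR sE linearD.
by rewrite [X in X + _]v0 add0r.
Qed.

Lemma ann_Tor_of_factor M P N (phi : {linear M -> P}) (psi : {linear P -> M}) r i :
    projective P -> (forall y, psi (phi y) = r *: y) -> ann (Tor i.+1 M N) r.
Proof.
move=> projP pp; apply/ann_TorP => t t0.
have [s [s' sE]] := null_homotopy i projP pp.
exists (tensor_map s' N t).
have : forall t, r *: t = tensor_map (res_diff M i.+1) N (tensor_map s' N t) +
    tensor_map s N (tensor_map (res_diff M i) N t).
  elim/tensor_ind=> [|a u w t' IH]; first by rewrite scaler0 !raddf0 addr0.
  rewrite scalerDr IH !tensor_mapP addrACA -scalerDr -tensDl -sE tensZl.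
  by rewrite !scalerA mulrC.
by move=> ->; rewrite t0 raddf0 addr0.
Qed.

(** The comparison of the standard resolution with a presentation of [L] by a
    projective module is the identity on the first syzygy up to a map that
    extends to [F]; such a map is invisible to [Tor] and [Ext]. *)
Lemma compare_resolution L F (p : {linear F -> L}) : projective F ->
    (forall y, exists z, p z = y) ->
  exists (f : {linear res L 0 -> F}) (g : {linear F -> res L 0})
    (fK : {linear syz L 1 -> subm (ker p)}) (gK : {linear subm (ker p) -> syz L 1})
    (th : {linear F -> subm (ker p)}),
  [/\ forall z, p (f z) = res_aug L z, forall k, val (fK k) = f (val k),
      forall k, val (gK k) = g (val k) & forall k, fK (gK k) = k + th (val k)].
Proof.
move=> projF ps.
have [f fE] := @freeg_projective R _ _ _ p (res_aug L) ps.
have [g gE] := projF _ _ (res_aug L) p (@res_aug_surj R L).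
have [|fK fKE] := @corestrict R (syz L 1) F (ker p) (f \o val).
  by move=> k; apply/eqP; rewrite [LHS]fE; exact/eqP/(valP k).
have [|gK gKE] := @corestrict R (subm (ker p)) (res L 0) (ker (cover L)) (g \o val).
  by move=> k; apply/eqP; rewrite [LHS]gE; exact/eqP/(valP k).
have [|th thE] := @corestrict R F F (ker p) ((f \o g) \- idfun).
  by move=> y; apply/eqP; rewrite /= raddfB /= [X in X - _]fE [X in X - _]gE subrr.
exists f, g, fK, gK, th; split=> // k.
apply: val_inj; apply: etrans (fKE _) (etrans (congr1 f (gKE k)) _).
apply: etrans (_ : val k + val (th (val k)) = _); last by [].
by rewrite thE /= addrC subrK.
Qed.

(** For a presentation [0 -> K -> F -> L -> 0] with [F] projective, [Tor 1 L N]
    is the kernel of [K ** N -> F ** N]. *)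
Lemma ann_Tor1_kernel L F N (p : {linear F -> L}) r : projective F ->
    (forall y, exists z, p z = y) -> ann (Tor 1 L N) r ->
  forall t, tensor_map (val : subm (ker p) -> F) N t = 0 -> r *: t = 0.
Proof.
move=> projF ps /ann_TorP rTor t t0.
have [f [g [fK [gK [th [fE fKE gKE fgK]]]]]] := compare_resolution projF ps.
have [z zE] := tensor_map_surj (@cover_surj (syz L 1)) (tensor_map gK N t).
have [|u uE] := rTor z.
  rewrite -(@tensor_map_comp R _ _ _ _ val (cover (syz L 1))) // zE.
  by rewrite (tensor_map_square (f3 := g) (f4 := val) gKE) t0 raddf0.
have fgt : tensor_map fK N (tensor_map gK N t) = t + tensor_map th N (tensor_map val N t).
  elim/tensor_ind: t {t0 zE} => [|a k n t IH]; first by rewrite !raddf0 addr0.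
  by rewrite !tensor_mapP IH fgK tensDl scalerDr addrACA.
have rt : r *: t = tensor_map fK N (r *: tensor_map gK N t).
  by rewrite tensor_mapZ fgt t0 raddf0 addr0.
rewrite rt -zE -tensor_mapZ -uE (_ : tensor_map (cover _) N _ = 0) ?raddf0 //.
by apply: tensor_map_comp0 => y; exact: (cover_diff (M := L) (n := 1)).
Qed.

(** The hypothesis is applied to the class of [0 -> N -> P -> F -> L -> 0], given
    by a map [f2] lifting the identity of [L].  Subtracting from [r f1] a cochain
    with coboundary [r f2] yields a map that descends to the first syzygy; the
    map to [F] comes from [compare_resolution]. *)
Lemma ann_Ext2_syzygy L F P (p : {linear F -> L}) (q : {linear P -> subm (ker p)}) r :
    projective F -> (forall y, exists z, p z = y) ->
    (forall y, exists z, q z = y) ->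
    ann (Ext 2 L (subm (ker q))) r ->
  exists (u : {linear subm (ker p) -> P}) (v : {linear F -> subm (ker p)}),
    forall k, r *: k = q (u k) + v (val k).
Proof.
move=> projF ps qs /ann_ExtP rExt.
have [f [g [fK [gK [th [fE fKE gKE fgK]]]]]] := compare_resolution projF ps.
have [|f1 f1E] := @free_lifting R _ _ _ (fK \o cover (syz L 1)) q.
  by move=> t; exact: qs.
have [|f2 f2E] := @corestrict R (syz L 2) P (ker q) (f1 \o val).
  by move=> k; apply/eqP; rewrite /= f1E /= (eqP (valP k)) raddf0.
have [|h hE] := rExt (f2 \o cover (syz L 2)).
  move=> z; rewrite /= (_ : cover (syz L 2) _ = 0) ?raddf0 //.
  exact: (cover_diff (M := L) (n := 2)).
have [||w wE] := @descend R _ _ P (cover (syz L 1)) ((r \*: f1) \- (val \o h)).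
- exact: cover_surj.
- move=> z /eqP z0.
  have [y yE] := cover_surj (M := syz L 2) (Subm (z0 : z \in submod_pred (ker (cover (syz L 1))))).
  have dy : res_diff L 1 y = z by rewrite /= yE.
  have hz : val (h z) = r *: f1 z.
    rewrite -dy hE; apply: etrans (congr1 (fun w => r *: w) (f2E _)) _.
    by [].
  by apply/eqP; rewrite subr_eq0; apply/eqP/esym.
pose v : {linear F -> subm (ker p)} := (- r) \*: th.
have vE y : v y = - (r *: th y) by rewrite -scaleNr.
exists (w \o gK), v => k.
have qw y : q (w y) = r *: fK y.
  have [z <-] := cover_surj y; rewrite wE raddfB /= linearZ_LR f1E /=.
  by rewrite (eqP (valP (h z))) subr0.
by rewrite [X in X + _]qw fgK vE scalerDr addrK.
Qed.
End StandardResolution.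

(** * Conductor elements factor through free modules *)

Section Conductor.
Variable R : comNzRingType.
Local Notation K := (total_frac R).
Local Notation iota := (to_total R).
Local Notation V := (integral_closure R).

Definition torsion_free (M : lmodType R) : Prop :=
  forall s (y : M), GRing.lreg s -> s *: y = 0 -> y = 0.

Lemma conductorP c : conductor R c <-> forall v, V v -> exists a, iota c * v = iota a.
Proof.
split=> [cC v Vv|cV v Vv]; first by have [a _ aE] := cC v Vv; exists a.
by have [a aE] := cV v Vv; exists a.
Qed.

Variable m : idealr R.
Hypotheses (noethR : noetherian R) (locR : local_ring m).
Hypotheses (dimR : krull_dim R = Some 1%N) (redR : reduced R).
Variables (x : R) (k : nat).
Hypotheses (xm : x \in m) (regx : GRing.lreg x).
Hypothesis boundV : forall v, V v -> exists a, iota (x ^+ k) * v = iota a.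

Lemma matrix_denominator l n (A : 'M[K]_(l, n)) :
  exists N (B : 'M[R]_(l, n)), iota (x ^+ N) *: A = map_mx iota B.
Proof.
have [N AN] := common_denominator noethR locR dimR redR xm
  (fun ij : 'I_l * 'I_n => A ij.1 ij.2).
have [b bE] := fin_all_exists AN; exists N, (\matrix_(i, j) b (i, j)).
by apply/matrixP => i j; rewrite !mxE -bE.
Qed.

(** Present [M] by a matrix [B] over [R].  A generalized inverse
    [S] of [B] splits the presentation after extension to [V]: [1 - S *m B] is a
    projection onto a complement of the relations, and it has integral entries.
    Multiplying it by [c] gives a matrix over [R], through which multiplication
    by [c] on [M] factors: this is checked after multiplication by a common
    denominator of [S], as [M] is torsion-free. *)
Lemma conductor_factor (M : lmodType R) c : fin_gen M -> torsion_free M -> conductor R c ->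
  exists n (phi : {linear M -> 'rV[R]_n}) (psi : {linear 'rV[R]_n -> M}),
    forall y, psi (phi y) = c *: y.
Proof.
move=> /fin_genP[n [g gM]] tfM /conductorP cV.
have [|||l [B BP]] := noetherian_rows noethR (P := fun r : 'rV_n => row_comb g r = 0).
- exact: raddf0.
- by move=> r s r0 s0; rewrite raddfD /= r0 s0 addr0.
- by move=> a r r0; rewrite linearZ_LR /= r0 scaler0.
pose BK := map_mx iota B.
have [N [VN NE]] := integral_generalized_inverse noethR locR dimR redR xm regx boundV BK^T.
pose S := N^T.
have VS i j : V ((1%:M - S *m BK) i j).
  rewrite mxE [(- (S *m BK)) i j]mxE [1%:M i j]mxE; apply: iclB.
    by case: (i == j); [exact: icl1 | exact: icl0].
  by have := VN j i; rewrite -[BK^T *m N]trmxK trmx_mul trmxK [_^T j i]mxE.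
have SE : BK *m S *m BK = BK.
  by have := congr1 trmx NE; rewrite !trmx_mul !trmxK mulmxA.
have [P PE] : exists P : 'M[R]_n, map_mx iota P = iota c *: (1%:M - S *m BK).
  have cS (ij : 'I_n * 'I_n) : exists a, iota c * (1%:M - S *m BK) ij.1 ij.2 = iota a.
    by apply: cV; exact: VS.
  have [p pE] := fin_all_exists cS.
  exists (\matrix_(i, j) p (i, j)); apply/matrixP => i j.
  by rewrite [LHS]mxE [_ i j in LHS]mxE -pE [RHS]mxE.
have inj_map l' n' : injective (map_mx iota : 'M_(l', n') -> 'M_(l', n')).
  move=> A A' /matrixP AA'; apply/matrixP => i j; apply: to_total_inj.
  by have := AA' i j; rewrite !mxE.
have BP0 : B *m P = 0.
  apply: inj_map; rewrite map_mxM PE map_mx0 -scalemxAr mulmxBr mulmx1 mulmxA.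
  by rewrite SE subrr scaler0.
have [N0 [T TE]] := matrix_denominator S.
have xP : x ^+ N0 *: (P - c%:M) = - (c *: (T *m B)).
  apply: inj_map; rewrite map_mxZ map_mxB PE map_scalar_mx map_mxN map_mxZ map_mxM -TE.
  have -> : iota c *: (1%:M - S *m BK) - (iota c)%:M = - (iota c *: (S *m BK)).
    by rewrite scalerBr scalemx1 addrAC subrr add0r.
  by rewrite scalerN -scalemxAl !scalerA mulrC.
have [||phi phiE] := @descend R _ _ _ (row_comb g) (mulmxr P : {linear 'rV_n -> 'rV_n}).
- by move=> y; have [r ->] := gM y; exists r.
- by move=> r /BP[t ->]; rewrite /= -mulmxA BP0 mulmx0.
exists n, phi, (row_comb g) => y; have [r ->] := gM y; rewrite phiE /=.
apply/eqP; rewrite -subr_eq0; apply/eqP; apply: (tfM (x ^+ N0)); first exact: GRing.lregX.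
rewrite -linearZ_LR -linearB -linearZ_LR (_ : _ *: _ = - (c *: (r *m T)) *m B).
  by apply/BP; eexists.
have -> : r *m P - c *: r = r *m (P - c%:M) by rewrite mulmxBr mul_mx_scalar.
by rewrite scalemxAr xP mulmxN -scalemxAr mulNmx -scalemxAl mulmxA.
Qed.
End Conductor.

(** * Maximal Cohen--Macaulay modules are the torsion-free ones *)

Section Localization.
Variables (R : comNzRingType) (p : prime_idealr R).
Local Notation A := (ring_at p).
Local Notation S := (at_prime p).

Lemma denom_notin (s : denom S) : (s : R) \notin p.
Proof. by have := denomP s; rewrite inE. Qed.

Lemma exists_denom s : s \notin p -> exists d : denom S, (d : R) = s.
Proof. by move=> sp; exists (Denom (sp : s \in mulset_pred S)). Qed.

Lemma scale_frac (M : lmodType R) a s (y : M) t :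
  (mkfrac S (a : R^o) s : A) *: (mkfrac S y t : localize M p) = mkfrac S (a *: y) (denomM s t).
Proof. exact: frac_scaleE. Qed.

Lemma scale_to_frac (M : lmodType R) a (y : M) t :
  (to_frac S a : A) *: (mkfrac S y t : localize M p) = mkfrac S (a *: y) t.
Proof.
apply: etrans (scale_frac _ _ _ _) _; congr (mkfrac S _ _).
by apply/denom_eq; rewrite /= mul1r.
Qed.

Lemma mkfrac_eq0 (M : lmodType R) (y : M) s :
  mkfrac S y s = (0 : localize M p) <-> exists u, u \notin p /\ u *: y = 0.
Proof.
split=> [/mkfracP[u]|[u [up uy]]].
  rewrite scaler0 /= mulr1 => uy.
  by exists u; split=> //; exact: denom_notin.
have [d dE] := exists_denom up.
by apply/mkfracP; exists d; rewrite scaler0 /= mulr1 dE.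
Qed.

Lemma to_frac_unit s : s \notin p -> exists w : A, w * to_frac S s = 1.
Proof.
move=> /exists_denom[d <-]; exists (mkfrac S (1 : R^o) d : A).
apply: etrans (fracR_mulE _ _ _ _) _; apply/mkfracP; exists (denom1 S).
by rewrite /GRing.scale /= !mul1r !mulr1.
Qed.

Lemma mkfrac_split a (s : denom S) :
  (mkfrac S (a : R^o) s : A) = (mkfrac S (1 : R^o) s : A) * to_frac S a.
Proof.
apply/esym; apply: etrans (fracR_mulE _ _ _ _) _; congr (mkfrac S _ _).
  exact: mul1r.
by apply/denom_eq; rewrite /= mulr1.
Qed.

Lemma to_frac_mkfrac a (s : denom S) :
  (to_frac S a : A) = to_frac S (s : R) * (mkfrac S (a : R^o) s : A).
Proof.
apply/esym; apply: etrans (fracR_mulE _ _ _ _) _; apply/mkfracP; exists (denom1 S).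
by rewrite /GRing.scale /= !mul1r.
Qed.

Lemma contract_prime (P : prime_idealr A) : exists q : prime_idealr R,
  (forall a, a \in q <-> to_frac S a \in P) /\ {subset q <= p}.
Proof.
have [||u v|q qP] := @ideal_prime R [set a | (to_frac S a : A) \in P].
- split=> /= [|a b aP bP|a b bP].
  + by rewrite rmorph0 idealr0.
  + by rewrite rmorphD rpredD.
  + by rewrite rmorphM idealMr.
- by rewrite /= rmorph1 idealr1.
- by rewrite /= rmorphM prime_idealrM => /orP.
exists q; split=> // a /qP /= aP; apply: contraT => /to_frac_unit[w wa].
by have := idealr1 P; rewrite -{1}wa idealMr.
Qed.

Lemma extend_prime (q : prime_idealr R) : {subset q <= p} ->
  exists P : prime_idealr A, forall a s, (mkfrac S (a : R^o) s : A) \in P <-> a \in q.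
Proof.
move=> qp; pose I : set A := [set z | exists (a : R) (s : denom S), z = mkfrac S (a : R^o) s /\ a \in q].
have IE a s : I (mkfrac S (a : R^o) s) <-> a \in q.
  split=> [[b [t [/mkfracP[u] ab bq]]]|aq]; last by exists a, s.
  rewrite /GRing.scale /= in ab.
  have : (u : R) * (t : R) * a \in q by rewrite ab idealMr.
  rewrite !prime_idealrM; case/orP => // /orP[] /qp; by rewrite (negPf (denom_notin _)).
have [||z w|P PE] := @ideal_prime A I.
- split.
  + by exists 0, (denom1 S); rewrite idealr0.
  + move=> _ _ [a [s [-> aq]]] [b [t [-> bq]]]; rewrite fracRD; apply/IE.
    by rewrite rpredD // idealMr.
  + move=> z _ [b [t [-> bq]]]; elim/fracW: z => a s.
    rewrite [_ * _]fracR_mulE; apply/IE; exact: idealMr.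
- by move=> /IE; rewrite idealr1.
- elim/fracW: z => a s; elim/fracW: w => b t.
  by rewrite [_ * _]fracR_mulE => /IE; rewrite prime_idealrM => /orP[] /IE; [left|right].
by exists P => a s; rewrite -IE; exact: PE.
Qed.

Lemma fin_gen_localize (M : lmodType R) : fin_gen M -> fin_gen (localize M p).
Proof.
move=> [s sM]; exists [seq mkfrac S y (denom1 S) | y <- s] => z; apply/asboolP => N sN.
elim/fracW: z => y t.
have cN : submod_closed [pred y : M | `[< (mkfrac S y (denom1 S) : localize M p) \in N >]].
  split=> [|a u v /asboolP uN /asboolP vN]; apply/asboolP; first exact: (rpred0 N).
  have -> : (mkfrac S (a *: u + v) (denom1 S) : localize M p) =
      (to_frac S a : A) *: (mkfrac S u (denom1 S) : localize M p) + mkfrac S v (denom1 S).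
    rewrite scale_to_frac fracD; apply/mkfracP; exists (denom1 S).
    by rewrite /= !mul1r !scale1r.
  by rewrite rpredD // rpredZ.
have /asboolP/(_ (Submod cN)) yN := sM y.
have -> : (mkfrac S y t : localize M p) =
    (mkfrac S (1 : R^o) t : A) *: (mkfrac S y (denom1 S) : localize M p).
  rewrite scale_frac scale1r; congr (mkfrac S _ _).
  by apply/denom_eq; rewrite /= mulr1.
apply: rpredZ; apply/asboolP/yN => w ws; apply/asboolP/sN/mapP.
by exists w.
Qed.
End Localization.

Section RegularSequences.
Variables (A : comNzRingType) (W : lmodType A).

Lemma ideal_mul_nil (z : W) : z \in submod_pred (ideal_mul W [::]) -> z = 0.
Proof.
have c0 : submod_closed (pred1 (0 : W)).
  by split=> [|a u v /eqP-> /eqP->]; rewrite inE ?scaler0 ?addr0.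
by move=> /asboolP/(_ (Submod c0)) H; apply/eqP/H => z' [a [y [aN]]]; rewrite in_nil in aN.
Qed.

Lemma ideal_mul_mem s a (z : W) : a \in s -> a *: z \in submod_pred (ideal_mul W s).
Proof. by move=> sa; apply/asboolP => N; apply; exists a, z. Qed.

Lemma ideal_mul_sub s s' : {subset s <= s'} ->
  {subset submod_pred (ideal_mul W s) <= submod_pred (ideal_mul W s')}.
Proof.
move=> ss z /asboolP zs; apply/asboolP => N s'N; apply: zs => _ [a [y [sa ->]]].
by apply: s'N; exists a, y; split=> //; exact: ss.
Qed.

Lemma ideal_mul1 a (z : W) : z \in submod_pred (ideal_mul W [:: a]) -> exists w, z = a *: w.
Proof.
have c0 : submod_closed [pred z : W | `[< exists w, z = a *: w >]].
  split=> [|b u v /asboolP[u' ->] /asboolP[v' ->]]; apply/asboolP.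
    by exists 0; rewrite scaler0.
  by exists (b *: u' + v'); rewrite scalerDr !scalerA mulrC.
move=> /asboolP/(_ (Submod c0)) H; apply/asboolP/H => _ [b [y [ba ->]]].
by move: ba; rewrite inE => /eqP ->; apply/asboolP; exists y.
Qed.

Lemma proj_eq0 (N : submod W) z : proj N z = 0 <-> z \in submod_pred N.
Proof. by rewrite -[z in X in _ <-> X]subr0 -proj_eq (raddf0 (proj N)). Qed.

Lemma quotm_neq0 (N : submod W) :
  (exists q : quotm N, q != 0) <-> exists z, z \notin submod_pred N.
Proof.
split=> [[q q0]|[z zN]].
  exists (lift_repr q); apply: contraNN q0 => /proj_eq0; rewrite lift_reprK => ->.
  exact: eqxx.
by exists (proj N z); apply: contraNN zN => /eqP/proj_eq0.
Qed.

Lemma regular_seq_head a s (z : W) : regular_seq W (a :: s) -> a *: z = 0 -> z = 0.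
Proof.
move=> [/(_ 0%N isT) reg _] az; apply/ideal_mul_nil/proj_eq0/reg.
rewrite -linearZ_LR /= az; exact: raddf0.
Qed.
End RegularSequences.

Section CohenMacaulay.
Variables (R : comNzRingType) (m : idealr R).
Hypotheses (noethR : noetherian R) (locR : local_ring m).
Hypotheses (dimR : krull_dim R = Some 1%N) (redR : reduced R).
Implicit Types M : lmodType R.

Lemma supp_witness M (p : prime_idealr R) : supp M p ->
  exists y : M, forall u, u \notin p -> u *: y <> 0.
Proof.
move=> [z]; elim/fracW: z => y s /eqP y0; exists y => u up uy; apply: y0.
by apply/mkfrac_eq0; exists u.
Qed.

Lemma maximal_local_eq0 (p : prime_idealr R) M (y : M) u : p =i m -> u \notin p ->
  u *: y = 0 -> y = 0.
Proof.
move=> pm; rewrite pm => /(local_unit noethR locR)[v vu] uy.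
by rewrite -[y]scale1r -vu -scalerA uy scaler0.
Qed.

Lemma krull_dim_maximal (p : prime_idealr R) : p =i m -> krull_dim (ring_at p) = Some 1%N.
Proof.
move=> pm; have /nat_supP[[P PE] max1] := dimR; apply/nat_supP; split.
  have Pp i : {subset P i <= p}.
    by move=> a /(idealr_sub_max noethR locR); rewrite pm.
  have [Q QE] := choice (fun i => extend_prime (@Pp i)).
  exists Q => i /PE[sub nsub]; split=> [z|QQ].
    by elim/fracW: z => a s /QE/sub aP; apply/QE.
  by apply: nsub => a aP; have /QE/QQ/QE := aP; apply; exact: denom1.
move=> n [Q QE]; apply: max1; have [q qE] := choice (fun i => contract_prime (Q i)).
have QqE i (a : R) s : (mkfrac (at_prime p) (a : R^o) s : ring_at p) \in Q i <-> a \in q i.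
  rewrite (qE i).1; split=> aQ; first by rewrite (to_frac_mkfrac a s) /= idealMr.
  by rewrite mkfrac_split /= idealMr.
exists q => i /QE[sub nsub]; split=> [a|qq]; first by rewrite !(qE _).1; exact: sub.
by apply: nsub => z; elim/fracW: z => a s /QqE/qq aq; apply/QqE.
Qed.

Lemma nonmaximal_mkfrac0 (p : prime_idealr R) a s : ~ maximal_ideal p -> a \in p ->
  (mkfrac (at_prime p) (a : R^o) s : ring_at p) = 0.
Proof.
move=> npm ap; have [t [tp ta]] := nonmaximal_kill noethR locR dimR redR npm ap.
have [d dE] := exists_denom tp.
by apply/mkfracP; exists d; rewrite scaler0 /= mulr1 dE.
Qed.

Lemma nonmaximal_field (p : prime_idealr R) (z : ring_at p) : ~ maximal_ideal p ->
  z != 0 -> exists w, w * z = 1.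
Proof.
move=> npm; elim/fracW: z => /= a' s; pose a : R := a'; rewrite -[a']/a; have [ap|anp] := boolP (a \in p).
  by rewrite nonmaximal_mkfrac0 ?eqxx.
have [d dE] := exists_denom anp => _; exists (mkfrac (at_prime p) ((s : R) : R^o) d).
apply: etrans (fracR_mulE _ _ _ _) _; apply/mkfracP; exists (denom1 (at_prime p)).
by rewrite /GRing.scale /= !mul1r !mulr1 dE mulrC.
Qed.

Lemma krull_dim_nonmaximal (p : prime_idealr R) : ~ maximal_ideal p ->
  krull_dim (ring_at p) = Some 0%N.
Proof.
move=> npm; apply/nat_supP; split.
  by have [P _] := @extend_prime R p p (fun _ h => h); exists (fun=> P).
case=> // n [P /(_ 0%N isT)[_ nsub]]; case: nsub => z zP.
have [->|/(nonmaximal_field npm)[w wz]] := eqVneq z 0; first exact: idealr0.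
by have := idealr1 (P 1%N); rewrite -{1}wz idealMr.
Qed.

Lemma depth_nonmaximal M (p : prime_idealr R) : ~ maximal_ideal p -> supp M p ->
  depth (localize M p) (@max_at R p) = Some 0%N.
Proof.
move=> npm [z z0]; have znil : z \notin submod_pred (ideal_mul (localize M p) [::]).
  by apply: contraNN z0 => /ideal_mul_nil ->.
apply/nat_supP; split.
  exists [::]; split=> //; split=> //; apply/quotm_neq0.
  by exists z.
move=> n [s [<- sp reg]]; case: s sp reg => [//|al s] sp reg.
have [a [t [ap alE]]] := sp al (mem_head _ _).
have al0 : al = 0 by rewrite alE nonmaximal_mkfrac0.
have z00 : z = 0 by apply: (regular_seq_head reg); rewrite al0 scale0r.
by rewrite z00 eqxx in z0.
Qed.

(** A regular sequence of length one over [R_m] comes from some [a] in [m]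
    acting injectively on [M]; if [s] is regular, [a] is nilpotent modulo [s],
    so [s] acts injectively as well. *)
Lemma CM_torsion_free M : CM R M -> torsion_free M.
Proof.
move=> [_ cmM] s y regs sy; apply: contrapT => y0.
have [p pm] := max_prime noethR locR.
have supM : supp M p.
  exists (mkfrac (at_prime p) y (denom1 _)); apply/eqP => /mkfrac_eq0[u [up uy]].
  exact: y0 (maximal_local_eq0 pm up uy).
have := cmM p supM; rewrite krull_dim_maximal // => /nat_supP[[s' [ss sp reg]] _].
case: s' ss sp reg => [|al [|? ?]] // _ sp reg.
have [a [t [ap alE]]] := sp al (mem_head _ _).
have inja (z : M) : a *: z = 0 -> z = 0.
  move=> az; have /mkfrac_eq0[u [up uz]] : mkfrac (at_prime p) z (denom1 _) = (0 : localize M p).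
    apply: (regular_seq_head reg); rewrite alE scale_frac az.
    by apply/mkfrac_eq0; exists 1; rewrite scaler0 idealr1.
  exact: maximal_local_eq0 pm up uz.
have am : a \in m by rewrite -pm.
have [n [r aE]] := lreg_power_mem noethR locR dimR redR (principal_ideal s)
  (ex_intro _ 1 (esym (mul1r s))) regs am.
have : a ^+ n *: y = 0 by rewrite aE -scalerA sy scaler0.
elim: n {aE} => [|n IH]; first by rewrite scale1r.
by rewrite exprS -scalerA => /inja.
Qed.

Lemma nakayama M x : x \in m -> fin_gen M -> (forall y : M, exists z, y = x *: z) ->
  forall y : M, y = 0.
Proof.
move=> xm /fin_genP[n [g gM]] xM; elim: n g gM => [g gM y|n IH g gM].
  by have [r ->] := gM y; rewrite /row_comb big_ord0.
pose g' (i : 'I_n) := g (fintype.lift ord0 i).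
suff g'M : forall y, exists r, y = row_comb g' r by exact: IH g'M.
move=> y.
have [z g0E] := xM (g ord0); have [c zE] := gM z.
have [u u1] : exists u, u * (1 - x * c 0 ord0) = 1.
  by apply: (one_sub_unit noethR locR); rewrite mulrC idealMr.
have g0 : g ord0 = row_comb g' (u *: (x *: \row_i c 0 (fintype.lift ord0 i))).
  have : (1 - x * c 0 ord0) *: g ord0 = x *: row_comb g' (\row_i c 0 (fintype.lift ord0 i)).
    rewrite scalerBl scale1r {1}g0E zE /row_comb big_ord_recl scalerDr scalerA.
    rewrite addrC addKr; congr (_ *: _); apply: eq_bigr => i _; by rewrite mxE.
  move=> /(congr1 ( *:%R u)); rewrite scalerA u1 scale1r => ->.
  by rewrite !row_combZ.
have [r ->] := gM y; rewrite {1}/row_comb big_ord_recl.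
exists (r 0 ord0 *: (u *: (x *: \row_i c 0 (fintype.lift ord0 i))) + \row_i r 0 (fintype.lift ord0 i)).
rewrite row_combD row_combZ -g0; congr (_ + _); apply: eq_bigr => i _.
by rewrite mxE.
Qed.

(** No non-maximal prime contains both [a] and the annihilator of [M]: by
    [nonmaximal_kill] some [t] outside it satisfies [t * a = 0], and then [t]
    annihilates [M] because [a] acts injectively. *)
Lemma power_mod_annihilator M a b : fin_gen M -> (forall y : M, a *: y = 0 -> y = 0) ->
    b \in m -> exists n r, forall y : M, b ^+ n *: y = a *: (r *: y).
Proof.
move=> /fin_genP[n [g gM]] inja bm.
pose N : set R := [set r | forall y : M, r *: y = 0].
have iN : ideal N.
  split=> [y|r s rN sN y|r s sN y]; first exact: scale0r.
    by rewrite scalerDl rN sN addr0.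
  by rewrite -scalerA sN scaler0.
have [k [_ [w [[r ->] wN bE]]]] : exists k, isum (principal a) N (b ^+ k).
  apply: (power_mem noethR (isum_ideal (principal_ideal a) iN) bm) => p pI.
  apply: locR.2; apply: contrapT => npm.
  have ap : a \in p.
    by apply: pI; exists a, 0; split; [exists 1; rewrite mul1r | case: iN | rewrite addr0].
  have [t [tp ta]] := nonmaximal_kill noethR locR dimR redR npm ap.
  move/negP: tp; apply; apply: pI; exists 0, t; rewrite add0r; split=> //.
    by case: (principal_ideal a).
  by move=> y; apply: inja; rewrite scalerA mulrC ta scale0r.
by exists k, r => y; rewrite bE scalerDl wN addr0 scalerA mulrC.
Qed.

(** At a non-maximal prime [R_p] is a field and the depth is zero.  At the
    maximal ideal a regular element of the ring starts a regular sequence, by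
    Nakayama's lemma; it cannot be prolonged, by [power_mod_annihilator]. *)
Lemma torsion_free_CM M : fin_gen M -> torsion_free M -> CM R M.
Proof.
move=> fgM tfM; split=> // p supM.
have [pmax|npm] := pselect (maximal_ideal p); last first.
  by rewrite krull_dim_nonmaximal // depth_nonmaximal.
have pm := locR.2 p pmax; rewrite krull_dim_maximal //.
have [y0 y0P] := supp_witness supM.
have eq0 (y : M) s : mkfrac (at_prime p) y s = (0 : localize M p) -> y = 0.
  by move=> /mkfrac_eq0[u [up uy]]; exact: maximal_local_eq0 pm up uy.
apply/nat_supP; split.
  have [x [xm regx]] := exists_lreg noethR locR dimR redR.
  pose al : ring_at p := to_frac (at_prime p) x.
  exists [:: al]; split=> // [z|].
    by rewrite inE => /eqP ->; exists x, (denom1 _); rewrite pm.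
  split=> [[|//] _ q|].
    rewrite -[q]lift_reprK; elim/fracW: (lift_repr q) => y t.
    rewrite -linearZ_LR => /proj_eq0/ideal_mul_nil; rewrite [X in X = _](scale_to_frac x y t).
    move=> /eq0 /(tfM _ _ regx) ->.
    by apply/proj_eq0; rewrite (_ : mkfrac _ _ _ = 0) ?rpred0 //; apply/mkfrac_eq0; exists 1; rewrite scaler0 idealr1.
  apply/quotm_neq0; apply: contrapT => nz.
  have xM (y : M) : exists z, y = x *: z.
    have /ideal_mul1[w] : mkfrac (at_prime p) y (denom1 _) \in
        submod_pred (ideal_mul (localize M p) [:: al]).
      by apply: contraT => ny; case: nz; eexists; exact: ny.
    elim/fracW: w => z t; rewrite (scale_to_frac x z t) => /mkfracP[u].
    rewrite /= mulr1 => uty.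
    have : (u : R) * (t : R) \notin p by rewrite prime_idealrM negb_or !denom_notin.
    rewrite pm => /(local_unit noethR locR)[v vu]; exists (v *: ((u : R) *: z)).
    by rewrite -[LHS]scale1r -vu -scalerA uty !scalerA; congr (_ *: _); ring.
  have /(_ y0) y00 := nakayama xm fgM xM.
  by apply: (y0P 1); rewrite ?idealr1 // y00 scaler0.
move=> n [s [<- sp reg]]; case: s sp reg => [//|al [//|be s]] sp reg.
have [a [t [ap alE]]] := sp al (mem_head _ _).
have [|b [t' [bp beE]]] := sp be _; first by rewrite !inE eqxx orbT.
have inja (y : M) : a *: y = 0 -> y = 0.
  move=> ay; apply: (@eq0 y (denom1 _)); apply: (regular_seq_head reg).
  rewrite alE scale_frac ay.
  by apply/mkfrac_eq0; exists 1; rewrite scaler0 idealr1.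
have bm : b \in m by rewrite -pm.
have [e [r bE]] := power_mod_annihilator fgM inja bm.
have [/(_ 1%N isT) reg1 /quotm_neq0[z zn]] := reg.
pose N := ideal_mul (localize M p) (take 1 [:: al, be & s]).
have injb (q : quotm N) : (to_frac (at_prime p) b : ring_at p) *: q = 0 -> q = 0.
  move=> bq; apply: reg1; rewrite [nth _ _ _]beE mkfrac_split -scalerA.
  by rewrite [X in _ *: X]bq scaler0.
have zN : proj N z = 0.
  have : (to_frac (at_prime p) b : ring_at p) ^+ e *: proj N z = 0.
    rewrite -rmorphXn -linearZ_LR; apply/proj_eq0.
    elim/fracW: {zn} z => y u; rewrite [X in X \in _](scale_to_frac (b ^+ e) y u) bE.
    rewrite -[mkfrac _ _ _](scale_to_frac a (r *: y) u) (to_frac_mkfrac a t) -alE.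
    by rewrite mulrC -scalerA; apply: ideal_mul_mem; rewrite mem_head.
  elim: e {bE} => [|e IH]; first by rewrite scale1r.
  by rewrite exprS -scalerA => /injb.
case/negP: zn; move/proj_eq0: zN; apply: ideal_mul_sub => c.
by rewrite !inE => ->.
Qed.
End CohenMacaulay.

Section FreeOverField.
Variables (A : comNzRingType) (W : lmodType A).
Hypothesis fieldA : forall z : A, z != 0 -> exists w, w * z = 1.

(** A generating family of least size is a basis. *)
Lemma fin_gen_field_free : fin_gen W -> free_module W.
Proof.
move=> /fin_genP fgW.
have exn : exists n, `[< exists g : 'I_n -> W, forall y, exists r, y = row_comb g r >].
  by have [n gW] := fgW; exists n; apply/asboolP.
have := ex_minnP exn; case=> n /asboolP[g gW] nmin {exn}.
have inj (r : 'rV_n) : row_comb g r = 0 -> r = 0.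
  move=> r0; apply/rowP => i; rewrite mxE; apply/eqP; apply: contraT => /fieldA[w wr].
  case: n g gW nmin r r0 i wr => [|n] g gW nmin r r0 i wr.
    by have := ltn_ord i.
  have giE : g i = row_comb (g \o fintype.lift i) (- w *: \row_j r 0 (fintype.lift i j)).
    move: r0; rewrite /row_comb (bigD1_ord i) //= => /eqP; rewrite addr_eq0 => /eqP ri.
    rewrite -[LHS]scale1r -wr -scalerA ri scalerN -scaleNr scaler_sumr.
    by apply: eq_bigr => j _; rewrite !mxE scalerA.
  suff /nmin : `[< exists g : 'I_n -> W, forall y, exists r, y = row_comb g r >] by rewrite ltnn.
  apply/asboolP; exists (g \o fintype.lift i) => y; have [s ->] := gW y.
  exists (s 0 i *: (- w *: \row_j r 0 (fintype.lift i j)) + \row_j s 0 (fintype.lift i j)).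
  rewrite row_combD row_combZ -giE {1}/row_comb (bigD1_ord i) //=; congr (_ + _).
  by apply: eq_bigr => j _; rewrite mxE.
have [s sE] := choice gW.
have sg r : s (row_comb g r) = r.
  by apply/eqP; rewrite -subr_eq0; apply/eqP/inj; rewrite raddfB /= -sE subrr.
pose h (y : W) : {freeg 'I_n / A} := \sum_i s y 0 i *: << i >>.
have hE y i : coeff i (h y) = s y 0 i.
  rewrite raddf_sum (bigD1 i) //= coeffZ coeffU eqxx !mulr1 big1 ?addr0 // => j /negPf ji.
  by rewrite coeffZ coeffU ji mulr0 mulr0.
have lh : linear h.
  move=> a u v; apply/eqP/freeg_eqP => i; rewrite coeffD coeffZ !hE.
  have -> : s (a *: u + v) = a *: s u + s v.
    by rewrite -[RHS]sg linearP /= -!sE.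
  by rewrite !mxE.
have [h' h'E] := exists_linear lh; exists 'I_n, h'.
exists (fun z => row_comb g (\row_i coeff i z)) => [y|z].
  rewrite h'E [RHS]sE; congr row_comb; apply/rowP => i; by rewrite mxE hE.
by rewrite h'E; apply/eqP/freeg_eqP => i; rewrite hE sg mxE.
Qed.
End FreeOverField.

(** * Modules detecting the conductor *)

Lemma tens_row (R : comNzRingType) (N : lmodType R) n (r : 'rV[R]_n) (z : N) :
  tens r z = \sum_i r 0 i *: tens (delta_mx 0 i : 'rV_n) z.
Proof.
rewrite {1}[r]row_sum_delta tens_suml; apply: eq_bigr => i _; exact: tensZl.
Qed.

Section TestModules.
Variables (R : comNzRingType) (m : idealr R).
Hypotheses (noethR : noetherian R) (locR : local_ring m).
Hypotheses (dimR : krull_dim R = Some 1%N) (redR : reduced R).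
Variables (x : R) (k : nat).
Hypotheses (xm : x \in m) (regx : GRing.lreg x).
Local Notation K := (total_frac R).
Local Notation iota := (to_total R).
Local Notation V := (integral_closure R).
Local Notation C := (conductor R).
Hypothesis boundV : forall v, V v -> exists a, iota (x ^+ k) * v = iota a.

Let w := x ^+ k.
Let regw : GRing.lreg w. Proof. exact: GRing.lregX. Qed.

Lemma power_conductor : C w.
Proof. exact/conductorP. Qed.

Lemma conductor_ideal : ideal C.
Proof.
split=> [|a b /conductorP aC /conductorP bC|a b /conductorP bC]; apply/conductorP => v Vv.
- by exists 0; rewrite rmorph0 mul0r.
- have [c cE] := aC v Vv; have [d dE] := bC v Vv; exists (c + d).
  by rewrite !rmorphD mulrDl cE dE.
- have [c cE] := bC v Vv; exists (a * c).
  by rewrite !rmorphM -mulrA cE.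
Qed.

Lemma conductorM c v : C c -> V v -> exists2 a, C a & iota c * v = iota a.
Proof.
move=> /conductorP cC Vv; have [a aE] := cC v Vv; exists a => //.
apply/conductorP => u Vu; rewrite -aE -mulrA; apply: cC; exact: iclM.
Qed.

(** The conductor is an ideal of [V], so the fractions multiplying it into [R]
    also stabilize it and are integral. *)
Lemma conductor_dual q : (forall c, C c -> exists a, iota c * q = iota a) -> V q.
Proof.
move=> qC; have [s [sC gs]] := noetherian_gen noethR conductor_ideal.
have [||p [mp _ pq]] := integral_of_stable_ideal (v := q) sC gs _ power_conductor.
- move=> c cC; have [a aE] := qC c cC; exists a; last by rewrite mulrC.
  apply/conductorP => v Vv; have [b bC bE] := conductorM cC Vv.
  by have [d dE] := qC b bC; exists d; rewrite -aE mulrAC bE.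
- exact: regw.
by exists p.
Qed.

Lemma integral_closure_generators : exists n (y : 'I_n.+1 -> K),
  [/\ y ord0 = 1, forall i, V (y i) &
    forall c, (forall i, exists a, iota c * y i = iota a) -> C c].
Proof.
pose b : set R := [set r | exists v, V v /\ iota r = iota w * v].
have ib : ideal b.
  split=> [|r s [v [Vv rE]] [u [Vu sE]]|r s [v [Vv sE]]].
  - by exists 0; split; [exact: icl0 | rewrite mulr0 rmorph0].
  - by exists (v + u); split; [exact: iclD | rewrite mulrDr -rE -sE rmorphD].
  - exists (iota r * v); split; last by rewrite mulrCA -sE rmorphM.
    by apply: iclM Vv; exact: icl_to_total.
have [s [sb gs]] := noetherian_gen noethR ib.
have [u uw] := to_total_unit regw.
pose y (i : 'I_(size s).+1) := if unlift ord0 i is Some j then u * iota s`_j else 1.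
exists (size s), y; rewrite /y unlift_none; split=> // [i|c cy].
  case: (unlift ord0 i) => [j|]; last exact: icl1.
  by have [v [Vv ->]] := sb _ (mem_nth 0 (ltn_ord j)); rewrite mulrA uw mul1r.
apply/conductorP => v Vv; have [r rE] := boundV Vv.
have vE : v = u * iota r by rewrite -rE mulrA uw mul1r.
rewrite vE; apply: (gs [set r | exists a, iota c * (u * iota r) = iota a]).
- split=> [|p q [a aE] [a' aE']|p q [a aE]].
  + by exists 0; rewrite rmorph0 !mulr0.
  + by exists (a + a'); rewrite !rmorphD !mulrDr aE aE'.
  + by exists (p * a); rewrite rmorphM [RHS]rmorphM -aE; ring.
- move=> z /(nthP 0)[i si <-].
  by have := cy (fintype.lift ord0 (Ordinal si)); rewrite liftK.
- by exists v; split=> //; rewrite rE.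
Qed.

(** Taking the factor [q] among the fractions makes this submodule saturated,
    so that the quotient by it is torsion-free. *)
Definition proportional n (y : 'I_n -> K) : {pred 'rV[R]_n} :=
  fun r => `[< exists q, forall i, iota (r 0 i) = q * y i >].

Lemma proportional_submod n (y : 'I_n -> K) : submod_closed (proportional y).
Proof.
split=> [|a r s /asboolP[q rE] /asboolP[p sE]]; apply/asboolP.
  by exists 0 => i; rewrite mxE rmorph0 mul0r.
exists (iota a * q + p) => i; rewrite !mxE rmorphD rmorphM rE sE mulrDl.
by rewrite mulrA.
Qed.

Definition line n (y : 'I_n -> K) : submod 'rV[R]_n := Submod (proportional_submod y).

Lemma lineP n (y : 'I_n -> K) r :
  r \in submod_pred (line y) <-> exists q, forall i, iota (r 0 i) = q * y i.
Proof. by split=> /asboolP. Qed.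

Lemma proj_line_eq0 n (y : 'I_n -> K) r :
  proj (line y) r = 0 <-> exists q, forall i, iota (r 0 i) = q * y i.
Proof. by rewrite -lineP proj_eq0. Qed.

Lemma CM_line_quotient n (y : 'I_n -> K) : CM R (quotm (line y)).
Proof.
apply: (torsion_free_CM noethR locR dimR redR).
  apply: (@fin_gen_image R _ _ (proj (line y))) (fin_gen_row R n).
  by move=> q; exists (lift_repr q); exact: lift_reprK.
move=> s q regs; rewrite -[q]lift_reprK -linearZ_LR => /proj_line_eq0[p pE].
apply/proj_line_eq0; have [u us] := to_total_unit regs; exists (u * p) => i.
by rewrite -mulrA -pE mxE rmorphM mulrA us mul1r.
Qed.

Lemma CM_subm_row n (N : submod 'rV[R]_n) : CM R (subm N).
Proof.
apply: (torsion_free_CM noethR locR dimR redR).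
  exact: fin_gen_subm (fin_gen_row R n).
move=> s r regs /(congr1 val) sr; apply: val_inj; apply/rowP => i; apply: regs.
by have /rowP/(_ i) := sr; rewrite !mxE => ->; rewrite mulr0.
Qed.

Section Line.
Variables (n : nat) (y : 'I_n.+1 -> K).
Hypotheses (y0 : y ord0 = 1) (Vy : forall i, V (y i)).
Hypothesis yC : forall c, (forall i, exists a, iota c * y i = iota a) -> C c.
Local Notation L := (quotm (line y)).
Local Notation Ky := (subm (ker (proj (line y)))).

(** Reading off the first coordinate identifies the line through [y] with the
    conductor. *)
Definition line_coord (r : Ky) : R := (val r : 'rV_n.+1) 0 ord0.

Lemma line_coordE (r : Ky) i : iota ((val r : 'rV_n.+1) 0 i) = iota (line_coord r) * y i.
Proof.
have /eqP/proj_line_eq0[q qE] := valP r.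
by rewrite qE /line_coord qE y0 mulr1.
Qed.

Lemma line_coord_conductor r : C (line_coord r).
Proof. by apply: yC => i; exists ((val r : 'rV_n.+1) 0 i); rewrite line_coordE. Qed.

Lemma line_coord_inj : injective line_coord.
Proof.
move=> r s rs; apply: val_inj; apply/rowP => i; apply: to_total_inj.
by rewrite [LHS]line_coordE [RHS]line_coordE rs.
Qed.

Lemma line_coord_surj c : C c -> exists r, line_coord r = c.
Proof.
move=> /conductorP cC; have cy i : exists a, iota c * y i = iota a by apply: cC; exact: Vy.
have [a aE] := fin_all_exists cy.
have aL : \row_i a i \in submod_pred (ker (proj (line y))).
  by apply/eqP/proj_line_eq0; exists (iota c) => i; rewrite mxE aE.
exists (Subm aL); rewrite /line_coord /= mxE; apply: to_total_inj.
by rewrite -aE y0 mulr1.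
Qed.

Lemma line_coordD r s : line_coord (r + s) = line_coord r + line_coord s.
Proof. by rewrite /line_coord /= mxE. Qed.

Lemma line_coordZ a r : line_coord (a *: r) = a * line_coord r.
Proof. by rewrite /line_coord /= mxE. Qed.

Lemma line_coord_sum (T : finType) (F : T -> Ky) :
  line_coord (\sum_i F i) = \sum_i line_coord (F i).
Proof.
apply: (big_morph line_coord) => [r s|]; first exact: line_coordD.
by rewrite -(scale0r (0 : Ky)) line_coordZ mul0r.
Qed.

(** A factorization of [r] on the line through free modules writes [r] as a
    combination of elements of the conductor; its coefficients are fractions
    multiplying the conductor into [R], hence integral. *)
Lemma conductor_of_factor l (g : 'I_l -> Ky) (u : {linear Ky -> 'rV[R]_l})
    (v : {linear 'rV[R]_n.+1 -> Ky}) r :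
  (forall s : Ky, r *: s = row_comb g (u s) + v (val s)) -> C r.
Proof.
move=> rE; have [s0 s0E] := line_coord_surj power_conductor.
have [i wi] := to_total_unit regw.
pose q j := i * iota (u s0 0 j).
have Vq j : V (q j).
  apply: conductor_dual => c cC; have [s sE] := line_coord_surj cC.
  exists (u s 0 j); rewrite /q mulrCA -rmorphM.
  have -> : c * u s0 0 j = w * u s 0 j.
    have : c *: s0 = w *: s by apply: line_coord_inj; rewrite !line_coordZ sE s0E mulrC.
    by move=> /(congr1 (fun z => u z 0 j)); rewrite !linearZ_LR !mxE.
  by rewrite rmorphM mulrA wi mul1r.
have rw : r * w = \sum_j u s0 0 j * line_coord (g j) +
    \sum_j (val s0 : 'rV_n.+1) 0 j * line_coord (v (delta_mx 0 j)).
  have := congr1 line_coord (rE s0); rewrite line_coordZ s0E => ->.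
  rewrite line_coordD (row_linearE v) /row_comb !line_coord_sum.
  by congr (_ + _); apply: eq_bigr => j _; rewrite line_coordZ.
have rK : iota r = \sum_j q j * iota (line_coord (g j)) +
    \sum_j y j * iota (line_coord (v (delta_mx 0 j))).
  apply: (to_total_mulI regw); rewrite -rmorphM mulrC rw rmorphD !rmorph_sum mulrDr !mulr_sumr.
  congr (_ + _); apply: eq_bigr => j _; rewrite rmorphM mulrA; congr (_ * _).
    by rewrite /q mulrA [_ * i]mulrC wi mul1r.
  by rewrite line_coordE s0E.
apply/conductorP => z Vz; rewrite rK mulrDl !mulr_suml.
have term (T : finType) (p : T -> K) (c : T -> Ky) : (forall j, V (p j)) ->
    exists a, \sum_j p j * iota (line_coord (c j)) * z = iota a.
  move=> Vp; have pcz j : exists a, p j * iota (line_coord (c j)) * z = iota a.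
    rewrite mulrAC mulrC; have /conductorP := line_coord_conductor (c j); apply.
    exact: (iclM (Vp j) Vz).
  have [a aE] := fin_all_exists pcz.
  by exists (\sum_j a j); rewrite rmorph_sum; apply: eq_bigr => j _; exact: aE.
have [a ->] := term _ _ g Vq; have [b ->] := term _ _ (fun j => v (delta_mx 0 j)) Vy.
by exists (a + b); rewrite rmorphD.
Qed.

(** The test modules are the quotient [M] of [R^n.+1] by the line through [y] and
    its second syzygy [N].  An element killing the class of
    [0 -> N -> R^l -> R^n.+1 -> M -> 0] factors through free modules on the line
    through [y], and [conductor_of_factor] applies. *)
Lemma Ext_test : exists M N : lmodType R,
  [/\ CM R M, CM R N, syzygy 2 (CM R) N & ann (Ext 2 M N) `<=` C].
Proof.
have fgK : fin_gen Ky := fin_gen_subm noethR _ (fin_gen_row R n.+1).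
have [l [g gK]] := (fin_genP Ky).1 fgK.
pose p := proj (line y).
have ps : forall z, exists r, p r = z by move=> z; exists (lift_repr z); exact: lift_reprK.
have qs : forall z, exists r, row_comb g r = z by move=> z; have [r ->] := gK z; exists r.
exists L, (subm (ker (row_comb g))); split.
- exact: CM_line_quotient.
- exact: CM_subm_row.
- pose Z (i : nat) : lmodType R := match i with
    | 0 => L | 1 => 'rV[R]_n.+1 | 2 => 'rV[R]_l | _ => subm (ker (row_comb g)) end.
  pose d (i : nat) : {linear Z i.+1 -> Z i} := match i with
    | 0 => p | 1 => val \o row_comb g | 2 => val | _ => \0 end.
  exists Z, d; split.
  + exists idfun; exact: (Bijective (fun _ => erefl) (fun _ => erefl)).
  + exact: CM_line_quotient.
  + by case=> [|[|//]] _; split; [exact: fin_gen_row | exact: row_projective |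
      exact: fin_gen_row | exact: row_projective].
  + by split=> //; exact: val_inj.
  + case=> [|[|//]] _ r /=; split.
    * move=> /eqP r0; have [s sE] := qs (Subm (r0 : r \in submod_pred (ker p))).
      by exists s; rewrite sE.
    * by move=> [s <-]; exact/eqP/(valP (row_comb g s)).
    * move=> r0; have kr : r \in submod_pred (ker (row_comb g)) by apply/eqP/val_inj.
      by exists (Subm kr).
    * by move=> [s <-]; rewrite (eqP (valP s)).
- move=> r rExt.
  have [u [v rE]] := ann_Ext2_syzygy (@row_projective R n.+1) ps qs rExt.
  exact: conductor_of_factor rE.
Qed.

(** With [c] a generating family of the conductor, [t = \sum_j c_j y ** e_j] is
    a torsion element of the tensor product of the line through [y] with the
    quotient by the line through [c].  The map [a y ** v |-> a v] to
    [R^l / { a c | a \in C }] shows that its annihilator lies in [C]. *)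
Lemma Tor_test : exists M N : lmodType R,
  [/\ CM R M, CM R N & ann (Tor 1 M N) `<=` C].
Proof.
have [s [sC gs]] := noetherian_gen noethR conductor_ideal.
pose l := size s; pose c (j : 'I_l) := iota s`_j.
exists L, (quotm (line c)); split; [exact: CM_line_quotient | exact: CM_line_quotient |].
move=> r rTor.
pose p := proj (line y).
have ps : forall z, exists r, p r = z by move=> z; exists (lift_repr z); exact: lift_reprK.
have kill := ann_Tor1_kernel (@row_projective R n.+1) ps rTor.
have /fin_all_exists[kap kapE] (j : 'I_l) :=
  line_coord_surj (sC _ (mem_nth 0 (ltn_ord j))).
pose t := \sum_j tens (kap j) (proj (line c) (delta_mx 0 j)).
have rt : r *: t = 0.
  apply: kill; rewrite raddf_sum.
  have -> : \sum_j tensor_map val (quotm (line c)) (tens (kap j) (proj (line c) (delta_mx 0 j))) =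
      \sum_i tens (delta_mx 0 i) (proj (line c) (\row_j (val (kap j) : 'rV_n.+1) 0 i)).
    under eq_bigr => j _ do rewrite tensor_mapE tens_row.
    rewrite exchange_big; apply: eq_bigr => i _.
    rewrite [\row_j _]row_sum_delta linear_sum tens_sumr; apply: eq_bigr => j _.
    by rewrite mxE linearZ_LR tensZr.
  rewrite big1 // => i _; rewrite (_ : proj _ _ = 0) ?tens0r //.
  apply/proj_line_eq0; exists (y i) => j.
  by rewrite mxE line_coordE kapE mulrC.
pose D : {pred 'rV[R]_l} := fun v => `[< exists2 a, C a & forall j, v 0 j = a * s`_j >].
have [C0 CD CM'] := conductor_ideal.
have cD : submod_closed D.
  split=> [|b u v /asboolP[a aC uE] /asboolP[a' a'C vE]]; apply/asboolP.
    by exists 0 => // j; rewrite mxE mul0r.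
  exists (b * a + a'); first by apply: CD => //; exact: CM'.
  by move=> j; rewrite !mxE uE vE mulrDl mulrA.
pose pD := proj (Submod cD).
have pDP b u v : pD (b *: u + v) = b *: pD u + pD v by exact: linearP.
have pDZ b u : pD (b *: u) = b *: pD u by exact: linearZ.
have lineD a v : C a -> v \in submod_pred (line c) -> pD (a *: v) = 0.
  move=> aC /lineP[q vE]; apply/proj_eq0/asboolP.
  have Vq : V q.
    apply: conductor_dual => b bC.
    apply: (gs [set b | exists d, iota b * q = iota d]) bC.
      split=> [|b1 b2 [d1 E1] [d2 E2]|b1 b2 [d E]].
      - by exists 0; rewrite rmorph0 mul0r.
      - by exists (d1 + d2); rewrite !rmorphD mulrDl E1 E2.
      - by exists (b1 * d); rewrite !rmorphM -mulrA E.
    move=> z /(nthP 0)[j js <-]; exists (v 0 (Ordinal js)).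
    by rewrite vE mulrC.
  have [b bC bE] := conductorM aC Vq; exists b => // j.
  by apply: to_total_inj; rewrite mxE !rmorphM vE -bE mulrA.
pose h (kp : Ky) (z : quotm (line c)) := pD (line_coord kp *: lift_repr z).
have hE kp v : h kp (proj (line c) v) = pD (line_coord kp *: v).
  apply/eqP; rewrite -subr_eq0 -linearB -scalerBr; apply/eqP/lineD.
    exact: line_coord_conductor.
  by apply/proj_eq/lift_reprK.
have [||H HE] := @tensor_lift R Ky (quotm (line c)) _ h.
- move=> z a k1 k2; rewrite /h line_coordD line_coordZ scalerDl -scalerA.
  exact: pDP.
- move=> kp a z1 z2; rewrite -[z1]lift_reprK -[z2]lift_reprK -linearP !hE.
  by rewrite scalerDr scalerA mulrC -scalerA pDP.
have : pD (r *: \row_j s`_j) = 0.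
  have := congr1 H rt; rewrite raddf0 linearZ_LR linear_sum => Ht.
  rewrite pDZ -[RHS]Ht; congr (_ *: _).
  rewrite [\row_j _]row_sum_delta [LHS](linear_sum pD); apply: eq_bigr => j _.
  by rewrite [RHS](etrans (HE _ _) (hE _ _)) kapE mxE.
move=> /proj_eq0/asboolP[a aC aE].
have ra b : C b -> r * b = a * b.
  apply: (gs [set b | r * b = a * b]); last first.
    by move=> z /(nthP 0)[j js <-]; have := aE (Ordinal js); rewrite !mxE.
  split=> [|b1 b2 /= E1 E2|b1 b2 /= E2]; first by rewrite /= !mulr0.
    by rewrite !mulrDr E1 E2.
  by rewrite mulrCA E2 mulrCA.
have := ra _ power_conductor; rewrite mulrC [a * _]mulrC => /regw ->.
exact: aC.
Qed.
End Line.
Lemma conductor_ann_Ext (X : lmodType R -> Prop) n : C `<=` ann_Ext n (CM R) X.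
Proof.
move=> c cC [|i] M N // _ cmM _.
have [l [phi [psi pp]]] := conductor_factor noethR locR dimR redR xm regx boundV
  cmM.1 (CM_torsion_free noethR locR dimR redR cmM) cC.
exact: ann_Ext_of_factor (@row_projective R l) pp.
Qed.

Lemma conductor_ann_Tor (Y : lmodType R -> Prop) n : C `<=` ann_Tor n (CM R) Y.
Proof.
move=> c cC [|i] M N // _ cmM _.
have [l [phi [psi pp]]] := conductor_factor noethR locR dimR redR xm regx boundV
  cmM.1 (CM_torsion_free noethR locR dimR redR cmM) cC.
exact: ann_Tor_of_factor (@row_projective R l) pp.
Qed.

Lemma ann_Ext_conductor (X : lmodType R -> Prop) :
  (forall N, CM R N -> syzygy 2 (CM R) N -> X N) -> ann_Ext 1 (CM R) X `<=` C.
Proof.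
move=> XN r rX; have [n [y [y0 Vy yC]]] := integral_closure_generators.
have [M [N [cmM cmN syzN]]] := Ext_test y0 Vy yC; apply.
exact: rX cmM (XN _ cmN syzN).
Qed.

Lemma ann_Tor_conductor (Y : lmodType R -> Prop) :
  (forall N, CM R N -> Y N) -> ann_Tor 0 (CM R) Y `<=` C.
Proof.
move=> YN r rY; have [n [y [y0 Vy yC]]] := integral_closure_generators.
have [M [N [cmM cmN]]] := Tor_test y0 Vy yC; apply.
exact: rY cmM (YN _ cmN).
Qed.
End TestModules.

Theorem proposition4p1 (R : comNzRingType) (m : idealr R)
    (X Y : lmodType R -> Prop)
    (noethR : noetherian R) (locR : local_ring m)
    (dimR : krull_dim R = Some 1%N)
    (redR : reduced (completion m))
    (subX : subcategory X) (subY : subcategory Y)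
    (syzX : forall M, syzygy 2 (CM R) M -> X M)
    (cmY : forall M, CM R M -> Y M) :
  [/\ forall M : lmodType R, CM R M <-> CM0 R M,
      [/\ ann_Ext 0 (CM R) X = ann_Ext 1 (CM R) X,
          ann_Ext 1 (CM R) X = ann_Tor 0 (CM R) Y
        & ann_Tor 0 (CM R) Y = conductor R]
    & [/\ ann_Ext 0 (CM R) (CM R) = ann_Ext 1 (CM R) (CM R),
          ann_Ext 1 (CM R) (CM R) = ann_Tor 0 (CM R) (CM R)
        & ann_Tor 0 (CM R) (CM R) = conductor R]].
Proof.
have rR := completion_reduced noethR locR redR.
have [x [xm regx]] := exists_lreg noethR locR dimR rR.
have [k boundV] := integral_closure_bounded noethR locR dimR rR xm regx redR.
have Ext1 (Z : lmodType R -> Prop) :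
    (forall N, CM R N -> syzygy 2 (CM R) N -> Z N) -> ann_Ext 1 (CM R) Z = conductor R.
  move=> ZN; apply/seteqP; split.
    exact: (ann_Ext_conductor noethR locR dimR rR regx boundV).
  exact: (conductor_ann_Ext noethR locR dimR rR xm regx boundV).
have Ext0 (Z : lmodType R -> Prop) :
    (forall N, CM R N -> syzygy 2 (CM R) N -> Z N) -> ann_Ext 0 (CM R) Z = conductor R.
  move=> ZN; apply/seteqP; split; last first.
    exact: (conductor_ann_Ext noethR locR dimR rR xm regx boundV).
  rewrite -(Ext1 _ ZN) => r rZ i M N i1; apply: rZ; exact: ltnW.
have Tor0 (Z : lmodType R -> Prop) :
    (forall N, CM R N -> Z N) -> ann_Tor 0 (CM R) Z = conductor R.
  move=> ZN; apply/seteqP; split.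
    exact: (ann_Tor_conductor noethR locR dimR rR regx boundV).
  exact: (conductor_ann_Tor noethR locR dimR rR xm regx boundV).
split.
- move=> M; split=> [cmM|[]//]; split=> // p npm.
  apply: fin_gen_field_free (fin_gen_localize p cmM.1) => z.
  exact: (nonmaximal_field noethR locR dimR rR npm).
- by rewrite Ext0 ?Ext1 ?Tor0 //; move=> N _; exact: syzX.
- by rewrite Ext0 ?Ext1 ?Tor0.
Qed.
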